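(* Let $A$ be an associative $k$-algebra which is a right contramodule over the left bialgebroid $(A^e,A)$, $A^e=A\otimes A^{\mathrm{op}}$, with contraaction $\gamma$. Then $$(\tau f)(a_1,\ldots,a_n)=\gamma\big(a_1f(a_2,\ldots,a_n,-)\big)$$ defines a cocyclic operator on the Hochschild complex $C^\bullet(A,A)=\mathrm{Hom}_k(A^{\otimes\bullet},A)$ such that the respective endomorphism operad $C(A,A)$ becomes a para-cyclic operad with multiplication, which is cyclic if $A$ is stable over $A^e$. Hence (in the stable case) its Hochschild cohomology groups $H^\bullet(A,A)$ (respectively $\mathrm{Ext}^\bullet_{A^e}(A,A)$ if $A$ is $k$-projective) form a Batalin-Vilkovisky algebra.
   Context: $k$ is a commutative ring; algebras are unital. A right $A^e$-contramodule structure on $A$ (whose right $A$-module structure is right multiplication) amounts to a $k$-linear map $\gamma:\mathrm{Hom}_k(A,A)\to A$ (contraaction) such that: $\gamma(x\mapsto f(ax))=\gamma(f)a$ for all $f\in\mathrm{Hom}_k(A,A)$, $a\in A$; $\gamma\big(x\mapsto\gamma(y\mapsto g(x\otimes y))\big)=\gamma\big(x\mapsto g(x\otimes1_A)\big)$ for all $g\in\mathrm{Hom}_k(A\otimes A,A)$; $\gamma(x\mapsto mx)=m$ for all $m\in A$. ''Stable over $A^e$'' means $\gamma(x\mapsto xm)=m$ for all $m\in A$. In these formulas and in $\tau$, juxtaposition is the product of $A$. In degree $0$, $\tau m=\gamma(x\mapsto xm)$. Endomorphism operad $C(A,A)$: $O(n)=\mathrm{Hom}_k(A^{\otimes n},A)$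 with, for $\varphi\in O(p)$, $\psi\in O(q)$, $(\varphi\circ_i\psi)(a_1,\ldots,a_{p+q-1})=\varphi(a_1,\ldots,a_{p-i},\psi(a_{p-i+1},\ldots,a_{p+q-i}),a_{p+q-i+1},\ldots,a_{p+q-1})$, $\mathbb1=\mathrm{id}_A$, multiplication $\mu(a,b)=ab$ and unit $e=1_A$. An operad with multiplication has $\mu\in O(2)$, $e\in O(0)$ with $\mu\circ_1\mu=\mu\circ_2\mu$ and $\mu\circ_1e=\mu\circ_2e=\mathbb1$. A (non-$\Sigma$) operad $O$ is para-cyclic if there are $k$-linear maps $\tau:O(n)\to O(n)$ with $\tau(\varphi\circ_1\psi)=\tau\psi\circ_q\tau\varphi$ for $p,q\ge1$, $\tau(\varphi\circ_i\psi)=\tau\varphi\circ_{i-1}\psi$ for $q\ge0$, $2\le i\le p$, and $\tau\mathbb1=\mathbb1$ (where $\varphi\in O(p),\psi\in O(q)$); cyclic if moreover $\tau^{n+1}=\mathrm{id}_{O(n)}$. A (para-)cyclic operad with multiplication also satisfies $\tau\mu=\mu$. A Gerstenhaber algebra is a graded commutative algebra $(V,\smile)$, $V=\bigoplus_{p\in\mathbb N}V^p$, with a graded Lie bracket $\{\cdot,\cdot\}:V^{p+1}\otimes V^{q+1}\to V^{p+q+1}$ on $V[1]$ such that $\{\gamma,\alpha\smile\beta\}=\{\gamma,\alpha\}\smile\beta+(-1)^{pq}\alpha\smile\{\gamma,\beta\}$ for $\gamma\in V^{p+1},\alpha\in V^q$. It is a Batalin-Vilkovisky algebra if there is a $k$-linear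 $B:V^n\to V^{n-1}$, $B^2=0$, with $\{\alpha,\beta\}=(-1)^p\big(B(\alpha\smile\beta)-B(\alpha)\smile\beta-(-1)^p\alpha\smile B(\beta)\big)$ for $\alpha\in V^p$. On $H^\bullet(A,A)$ the product and bracket are those induced by the operad with multiplication (cup product and Gerstenhaber bracket), and $B$ is induced by Connes' operator of the cocyclic module. *)

(* Defs.v *)
From HB Require Import structures.
From mathcomp Require Import all_boot all_order all_algebra.
From mathcomp Require Import boolp functions.

Set Implicit Arguments.
Unset Strict Implicit.
Unset Printing Implicit Defensive.

Import GRing.Theory.
Local Open Scope ring_scope.
Local Open Scope quotient_scope.

Section Submodule.
Variables (k : comPzRingType) (V : lmodType k).

Record submodule := Submodule {
  carrier :> V -> Prop;
  carrier0 : carrier 0;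
  carrier_lin : forall (c : k) u v, carrier u -> carrier v -> carrier (c *: u + v)
}.

Variable S : submodule.

Definition carrierb : {pred V} := [pred v | `[< S v >]].

Fact carrierb_submod : submod_closed carrierb.
Proof.
split=> [|c u v /asboolP Su /asboolP Sv]; first exact/asboolP/carrier0.
exact/asboolP/carrier_lin.
Qed.
HB.instance Definition _ := GRing.isSubmodClosed.Build k V carrierb carrierb_submod.

Record sub_of := SubOf { sub_val :> V; sub_valP : sub_val \in carrierb }.

HB.instance Definition _ := [isSub for sub_val].
HB.instance Definition _ := [Choice of sub_of by <:].
HB.instance Definition _ := [SubChoice_isSubLmodule of sub_of by <:].

Lemma sub_of_in (x : sub_of) : S x.
Proof. by apply/asboolP; case: x. Qed.

Definition to_sub (v : V) (Sv : S v) : sub_of := SubOf (asboolT Sv).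

Lemma sub_ofD (x y : sub_of) : sub_val (x + y) = sub_val x + sub_val y.
Proof. by []. Qed.

Lemma sub_ofZ c (x : sub_of) : sub_val (c *: x) = c *: sub_val x.
Proof. by []. Qed.

Definition quotient : Type := Quotient.quot carrierb.

HB.instance Definition _ := GRing.Zmodule.on quotient.

Definition cls (v : V) : quotient := \pi_(Quotient.quot carrierb) v.

Lemma clsD u v : cls (u + v) = cls u + cls v.
Proof. exact: (raddfD (\pi_(Quotient.quot carrierb))). Qed.

Lemma cls_eq u v : cls u = cls v <-> S (u - v).
Proof.
split=> [/eqP|Suv]; last by apply/eqP; rewrite /cls -Quotient.idealrBE; apply/asboolP.
by rewrite /cls -Quotient.idealrBE => /asboolP.
Qed.

Lemma cls_repr (x : quotient) : cls (repr (x : Quotient.quot carrierb)) = x.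
Proof. exact: reprK. Qed.

Definition quotient_scale (c : k) (x : quotient) : quotient :=
  cls (c *: repr (x : Quotient.quot carrierb)).

Lemma quotient_scaleE c v : quotient_scale c (cls v) = cls (c *: v).
Proof.
apply/cls_eq; rewrite -scalerBr -[_ *: _]addr0.
by apply: carrier_lin (carrier0 S); apply/cls_eq/cls_repr.
Qed.

Fact quotient_scaleA a b x :
  quotient_scale a (quotient_scale b x) = quotient_scale (a * b) x.
Proof. by rewrite -[x]cls_repr !quotient_scaleE scalerA. Qed.
Fact quotient_scale1 : left_id 1 quotient_scale.
Proof. by move=> x; rewrite -[x]cls_repr quotient_scaleE scale1r. Qed.
Fact quotient_scaleDr : right_distributive quotient_scale +%R.
Proof.
move=> a x y; rewrite -[x]cls_repr -[y]cls_repr -clsD !quotient_scaleE -clsD.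
by rewrite scalerDr.
Qed.
Fact quotient_scaleDl x : {morph quotient_scale^~ x : a b / a + b}.
Proof.
by move=> a b; rewrite -[x]cls_repr !quotient_scaleE -clsD scalerDl.
Qed.
HB.instance Definition _ := GRing.Zmodule_isLmodule.Build k quotient
  quotient_scaleA quotient_scale1 quotient_scaleDr quotient_scaleDl.

End Submodule.

Arguments to_sub {k V S}.
Arguments cls {k V S}.

Section Subquotient.
Variables (k : comPzRingType) (V : lmodType k) (Z B : submodule V).

Fact subquotient_rel0 : B (sub_val (0 : sub_of Z)).
Proof. exact: carrier0. Qed.
Fact subquotient_rel_lin (c : k) (u v : sub_of Z) :
  B (sub_val u) -> B (sub_val v) -> B (sub_val (c *: u + v)).
Proof. exact: carrier_lin. Qed.

Definition subquotient_rel : submodule (sub_of Z) :=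
  @Submodule k (sub_of Z) (fun z => B (sub_val z))
    subquotient_rel0 subquotient_rel_lin.

Definition subquotient : Type := quotient subquotient_rel.

HB.instance Definition _ := GRing.Lmodule.on subquotient.

Definition represents (v : V) (x : subquotient) : Prop :=
  exists z : sub_of Z, sub_val z = v /\ x = cls z.

End Subquotient.

Section Homk.
Variables (k : comPzRingType) (U V : lmodType k).

Fact linear_map0 : linear (0 : U -> V).
Proof. by move=> a u v; rewrite scaler0 addr0. Qed.
Fact linear_map_lin (c : k) (f g : U -> V) :
  linear f -> linear g -> linear (c *: f + g).
Proof.
move=> lf lg a u v; rewrite !addrfctE !scalrfctE lf lg !scalerDr !scalerA.
by rewrite [c * a]mulrC addrACA.
Qed.

Lemma linear_map_zero (f : U -> V) : linear f -> f 0 = 0.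
Proof. by move=> /(_ (-1) 0 0); rewrite scaler0 addr0 scaleN1r addNr. Qed.

Definition linear_maps : submodule (U -> V) := Submodule linear_map0 linear_map_lin.

Definition homk : Type := sub_of linear_maps.

HB.instance Definition _ := GRing.Lmodule.on homk.

Definition Homk (f : U -> V) (lf : linear f) : homk := @to_sub _ _ linear_maps f lf.
Definition homk_fun (f : homk) : U -> V := sub_val f.

Lemma homk_linear (f : homk) : linear (homk_fun f).
Proof. exact: (@sub_of_in _ _ linear_maps f). Qed.

Lemma homkP (f g : homk) : homk_fun f =1 homk_fun g <-> f = g.
Proof. by split=> [/funext fg|->//]; apply: val_inj. Qed.

End Homk.
Coercion homk_fun : homk >-> Funclass.

Section Multilinear.
Variables (k : comPzRingType) (U V : lmodType k) (n : nat).

Definition upd (a : n.-tuple U) (i : 'I_n) (x : U) : n.-tuple U :=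
  [tuple if j == i then x else tnth a j | j < n].

Definition multilinear (f : n.-tuple U -> V) : Prop :=
  forall (i : 'I_n) (a : n.-tuple U), linear (fun x => f (upd a i x)).

Fact multilinear0 : multilinear 0.
Proof. by move=> i a; apply: linear_map0. Qed.
Fact multilinear_lin (c : k) (f g : n.-tuple U -> V) :
  multilinear f -> multilinear g -> multilinear (c *: f + g).
Proof. by move=> mf mg i a; apply: linear_map_lin (mf i a) (mg i a). Qed.

(* Hom_k(U^{(x) n}, V), by the universal property of the tensor power *)
Definition multilinear_maps : submodule (n.-tuple U -> V) :=
  Submodule multilinear0 multilinear_lin.

Definition mlin : Type := sub_of multilinear_maps.

HB.instance Definition _ := GRing.Lmodule.on mlin.

Definition Mlin (f : n.-tuple U -> V) (mf : multilinear f) : mlin :=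
  @to_sub _ _ multilinear_maps f mf.
Definition mlin_fun (f : mlin) : n.-tuple U -> V := sub_val f.

Lemma mlin_multilinear (f : mlin) : multilinear (mlin_fun f).
Proof. exact: (@sub_of_in _ _ multilinear_maps f). Qed.

Lemma mlinP (f g : mlin) : mlin_fun f =1 mlin_fun g <-> f = g.
Proof. by split=> [/funext fg|->//]; apply: val_inj. Qed.

Lemma mlinD (f g : mlin) a : mlin_fun (f + g) a = mlin_fun f a + mlin_fun g a.
Proof. by []. Qed.
Lemma mlinZ c (f : mlin) a : mlin_fun (c *: f) a = c *: mlin_fun f a.
Proof. by []. Qed.

Lemma nth_upd (x0 : U) (a : n.-tuple U) (i : 'I_n) x (j : nat) :
  nth x0 (upd a i x) j = if j == i then x else nth x0 a j.
Proof.
case: (ltnP j n) => [lt_jn|le_nj]; last first.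
  rewrite !nth_default ?size_tuple //.
  by case: eqP le_nj => // ->; rewrite leqNgt ltn_ord.
by rewrite -(tnth_nth x0 _ (Ordinal lt_jn)) tnth_mktuple -(tnth_nth x0 _ (Ordinal lt_jn)).
Qed.

End Multilinear.
Coercion mlin_fun : mlin >-> Funclass.

(* op_circ p q n i phi psi is phi o_i psi, seen in O(n); it is meaningful only
   when 1 <= i <= p and n = p + q - 1, that is, under [insertable p q n i]. *)
Definition insertable (p q n i : nat) : bool :=
  (0 < i <= p)%N && (p + q == n.+1)%N.

Record mult_operad (k : comPzRingType) := MultOperad {
  op :> nat -> lmodType k;
  op_circ : forall p q n : nat, nat -> op p -> op q -> op n;
  op_id : op 1;
  op_mul : op 2;
  op_unit : op 0
}.

Section OperadTheory.
Variables (k : comPzRingType) (O : mult_operad k).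

Local Notation circ n i phi psi := (@op_circ k O _ _ n i phi psi).
Local Notation id1 := (op_id O).
Local Notation mu := (op_mul O).
Local Notation e := (op_unit O).

(* The case j >= q + i of the usual associativity axiom is [circ_par] read from
   right to left. *)
Record is_operad : Prop := {
  circ_linl : forall p q n i (psi : O q), insertable p q n i ->
    linear (fun phi : O p => circ n i phi psi);
  circ_linr : forall p q n i (phi : O p), insertable p q n i ->
    linear (fun psi : O q => circ n i phi psi);
  circ_par : forall p q r m l n i j (phi : O p) (psi : O q) (chi : O r),
    (0 < j < i)%N -> (i <= p)%N ->
    (p + q = m.+1)%N -> (p + r = l.+1)%N -> (m + r = n.+1)%N ->
    circ n j (circ m i phi psi) chi = circ n (i + r - 1)%N (circ l j phi chi) psi;
  circ_seq : forall p q r m l n i j (phi : O p) (psi : O q) (chi : O r),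
    (0 < i <= p)%N -> (i <= j < q + i)%N ->
    (p + q = m.+1)%N -> (q + r = l.+1)%N -> (m + r = n.+1)%N ->
    circ n j (circ m i phi psi) chi = circ n i phi (circ l (j - i + 1)%N psi chi);
  circ_1l : forall q (psi : O q), circ q 1 id1 psi = psi;
  circ_1r : forall p i (phi : O p), (0 < i <= p)%N -> circ p i phi id1 = phi
}.

Record is_mult_operad : Prop := {
  mult_operad_operad : is_operad;
  op_mulA : circ 3 1 mu mu = circ 3 2 mu mu;
  op_mul1r : circ 1 1 mu e = id1;
  op_mul1l : circ 1 2 mu e = id1
}.

Variable tau : forall n, O n -> O n.

Record is_para_cyclic_operad : Prop := {
  tau_linear : forall n, linear (@tau n);
  tau_circ1 : forall p q n (phi : O p) (psi : O q),
    (0 < p)%N -> (0 < q)%N -> (p + q = n.+1)%N ->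
    tau (circ n 1 phi psi) = circ n q (tau psi) (tau phi);
  tau_circ : forall p q n i (phi : O p) (psi : O q),
    (1 < i <= p)%N -> (p + q = n.+1)%N ->
    tau (circ n i phi psi) = circ n i.-1 (tau phi) psi;
  tau_id : tau id1 = id1
}.

Definition is_para_cyclic_mult_operad : Prop :=
  [/\ is_mult_operad, is_para_cyclic_operad & tau mu = mu].

Definition is_cyclic_mult_operad : Prop :=
  is_para_cyclic_mult_operad /\
  forall n (phi : O n), iter n.+1 (@tau n) phi = phi.

Definition coface n (i : nat) (phi : O n) : O n.+1 :=
  if i == 0%N then circ n.+1 2 mu phi
  else if i == n.+1 then circ n.+1 1 mu phi
  else circ n.+1 i phi mu.

Definition codegen n (j : nat) (phi : O n.+1) : O n := circ n j.+1 phi e.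

Definition op_cup p q (phi : O p) (psi : O q) : O (p + q)%N :=
  circ (p + q)%N 1 (circ p.+1 2 mu phi) psi.

(* phi{psi} = sum_(1 <= i <= p) (-1)^((q-1)(i-1)) phi o_i psi; the sign is
   written with q + 1 in place of q - 1, which may be negative. *)
Definition op_brace p q n (phi : O p) (psi : O q) : O n :=
  \sum_(i < p) (-1) ^+ (q.+1 * i)%N *: circ n i.+1 phi psi.

Definition op_bracket p q n (phi : O p) (psi : O q) : O n :=
  op_brace n phi psi - (-1) ^+ (p.+1 * q.+1)%N *: op_brace n psi phi.

(* The cofaces above are numbered from the right: on the endomorphism operad of
   an algebra, the i-th coface of Hochschild's complex is [coface (n + 1 - i)],
   and likewise for codegeneracies.  In Hochschild's numbering the cyclic
   operator of the cocyclic module is t = tau^-1 = tau^n in degree n, and Connes'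
   operator is B = N s_{-1} (1 - lambda), where lambda = (-1)^n t,
   N = sum_i lambda^i and the extra codegeneracy s_{-1} is t followed by the last
   codegeneracy, which here is [codegen 0].  Had B been computed with tau and the
   right-to-left numbering, it would differ by the sign (-1)^(n-1) on H^n and not
   satisfy the Batalin-Vilkovisky identity below. *)
Definition tau_inv n (phi : O n) : O n := iter n (@tau n) phi.

Definition lambda n (phi : O n) : O n := (-1) ^+ n *: tau_inv phi.

Definition connes n (phi : O n.+1) : O n :=
  \sum_(i < n.+1)
     iter i (@lambda n) (codegen 0 (tau_inv (phi - lambda phi))).

End OperadTheory.

Section Cocyclic.
Variables (k : comPzRingType) (C : nat -> lmodType k).
Variables (d : forall n, nat -> C n -> C n.+1) (s : forall n, nat -> C n.+1 -> C n).
Variable t : forall n, C n -> C n.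

Record is_cosimplicial : Prop := {
  coface_linear : forall n i, (i <= n.+1)%N -> linear (@d n i);
  codegen_linear : forall n j, (j <= n)%N -> linear (@s n j);
  coface_coface : forall n i j (x : C n), (i < j <= n.+2)%N ->
    d j (d i x) = d i (d j.-1 x);
  codegen_codegen : forall n i j (x : C n.+2), (i <= j <= n)%N ->
    s j (s i x) = s i (s j.+1 x);
  codegen_coface_lt : forall n i j (x : C n.+1), (i < j <= n.+1)%N ->
    s j (d i x) = d i (s j.-1 x);
  codegen_coface_eq : forall n j (x : C n), (j <= n)%N ->
    s j (d j x) = x /\ s j (d j.+1 x) = x;
  codegen_coface_gt : forall n i j (x : C n.+1), (j.+1 < i <= n.+2)%N ->
    s j (d i x) = d i.-1 (s j x)
}.

Record is_para_cocyclic : Prop := {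
  cocyclic_cosimplicial : is_cosimplicial;
  cocyclic_linear : forall n, linear (@t n);
  cocyclic_coface : forall n i (x : C n), (0 < i <= n.+1)%N ->
    t (d i x) = d i.-1 (t x);
  cocyclic_coface0 : forall n (x : C n), t (d 0 x) = d n.+1 x;
  cocyclic_codegen : forall n i (x : C n.+1), (0 < i <= n)%N ->
    t (s i x) = s i.-1 (t x);
  cocyclic_codegen0 : forall n (x : C n.+1), t (s 0 x) = s n (t (t x))
}.

Definition is_cocyclic : Prop :=
  is_para_cocyclic /\ forall n (x : C n), iter n.+1 (@t n) x = x.

End Cocyclic.

(* Operations on a graded module V = (+)_n V^n are given by their homogeneous
   components: [gcup p q n] is the component V^p x V^q -> V^n of the product, and
   so on; components of the wrong degree are required to vanish, in accordance
   with V^{-1} = 0 for the bracket and for B. *)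
Record bv_ops (k : comPzRingType) (V : nat -> lmodType k) := BVOps {
  gcup : forall p q n, V p -> V q -> V n;
  gone : V 0;
  gbr : forall p q n, V p -> V q -> V n;
  gB : forall m n, V m -> V n
}.

Section BV.
Variables (k : comPzRingType) (V : nat -> lmodType k) (X : bv_ops V).

Local Notation cup n a b := (@gcup k V X _ _ n a b).
Local Notation br n a b := (@gbr k V X _ _ n a b).
Local Notation B n a := (@gB k V X _ n a).

Record is_graded_commutative_algebra : Prop := {
  gcup_deg : forall p q n (a : V p) (b : V q), (p + q != n)%N -> cup n a b = 0;
  gcup_linl : forall p q n (b : V q), linear (fun a : V p => cup n a b);
  gcup_linr : forall p q n (a : V p), linear (fun b : V q => cup n a b);
  gcupA : forall p q r (a : V p) (b : V q) (c : V r),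
    cup (p + q + r)%N a (cup (q + r)%N b c) = cup (p + q + r)%N (cup (p + q)%N a b) c;
  gcup1l : forall p (a : V p), cup p (gone X) a = a;
  gcup1r : forall p (a : V p), cup p a (gone X) = a;
  gcupC : forall p q (a : V p) (b : V q),
    cup (p + q)%N a b = (-1) ^+ (p * q)%N *: cup (p + q)%N b a
}.

(* An element of V^p has degree p - 1 in V[1]; signs are written with p + 1 in
   place of p - 1. *)
Record is_shifted_lie : Prop := {
  gbr_deg : forall p q n (a : V p) (b : V q), (p + q != n.+1)%N -> br n a b = 0;
  gbr_linl : forall p q n (b : V q), linear (fun a : V p => br n a b);
  gbr_linr : forall p q n (a : V p), linear (fun b : V q => br n a b);
  gbrC : forall p q n (a : V p) (b : V q), (p + q = n.+1)%N ->
    br n a b = - ((-1) ^+ (p.+1 * q.+1)%N *: br n b a);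
  gbr_jacobi : forall p q r n (a : V p) (b : V q) (c : V r), (p + q + r = n.+2)%N ->
    br n a (br (q + r).-1 b c) =
      br n (br (p + q).-1 a b) c
      + (-1) ^+ (p.+1 * q.+1)%N *: br n b (br (p + r).-1 a c)
}.

Record is_gerstenhaber : Prop := {
  gerstenhaber_cup : is_graded_commutative_algebra;
  gerstenhaber_lie : is_shifted_lie;
  gbr_cup : forall p q r n (c : V p) (a : V q) (b : V r), (p + q + r = n.+1)%N ->
    br n c (cup (q + r)%N a b) =
      cup n (br (p + q).-1 c a) b
      + (-1) ^+ (p.+1 * q)%N *: cup n a (br (p + r).-1 c b)
}.

Record is_bv : Prop := {
  bv_gerstenhaber : is_gerstenhaber;
  gB_deg : forall m n (a : V m), (m != n.+1)%N -> B n a = 0;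
  gB_linear : forall m n, linear (fun a : V m => B n a);
  gBB : forall l m n (a : V l), B n (B m a) = 0;
  gbr_B : forall p q n (a : V p) (b : V q), (p + q = n.+1)%N ->
    br n a b = (-1) ^+ p *: (B n (cup (p + q)%N a b) - cup n (B p.-1 a) b
                             - (-1) ^+ p *: cup n a (B q.-1 b))
}.

End BV.

Section BVMorphism.
Variables (k : comPzRingType) (V W : nat -> lmodType k).
Variables (X : bv_ops V) (Y : bv_ops W) (f : forall n, homk (V n) (W n)).

Record is_bv_morphism : Prop := {
  bvm_cup : forall p q n (a : V p) (b : V q),
    f n (gcup X n a b) = gcup Y n (f p a) (f q b);
  bvm_one : f 0%N (gone X) = gone Y;
  bvm_br : forall p q n (a : V p) (b : V q),
    f n (gbr X n a b) = gbr Y n (f p a) (f q b);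
  bvm_B : forall m n (a : V m), f n (gB X n a) = gB Y n (f m a)
}.

End BVMorphism.

Section Contraaction.
Variables (k : comPzRingType) (A : algType k).

Fact homk_premul_linear (a : A) (f : homk A A) : linear (fun x : A => f (a * x)).
Proof. by move=> c x y; rewrite mulrDr -scalerAr homk_linear. Qed.
Definition homk_premul a f : homk A A := Homk (homk_premul_linear a f).

Fact homk_lmul_linear (m : A) : linear (fun x : A => m * x).
Proof. by move=> c x y; rewrite mulrDr -scalerAr. Qed.
Definition homk_lmul m : homk A A := Homk (homk_lmul_linear m).

Fact homk_rmul_linear (m : A) : linear (fun x : A => x * m).
Proof. by move=> c x y; rewrite mulrDl -scalerAl. Qed.
Definition homk_rmul m : homk A A := Homk (homk_rmul_linear m).

Variable gamma : homk (homk A A) A.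

(* Hom_k(A (x) A, A) is represented by Hom_k(A, Hom_k(A, A)). *)
Fact homk_iter_linear (g : homk A (homk A A)) : linear (fun x : A => gamma (g x)).
Proof. by move=> c x y; rewrite homk_linear homk_linear. Qed.
Definition homk_iter g : homk A A := Homk (homk_iter_linear g).

Fact homk_eval1_linear (g : homk A (homk A A)) : linear (fun x : A => (g x : homk A A) 1).
Proof. by move=> c x y; rewrite homk_linear. Qed.
Definition homk_eval1 g : homk A A := Homk (homk_eval1_linear g).

Record is_contraaction : Prop := {
  contra_right : forall (f : homk A A) (a : A), gamma (homk_premul a f) = gamma f * a;
  contra_assoc : forall g : homk A (homk A A), gamma (homk_iter g) = gamma (homk_eval1 g);
  contra_unit : forall m : A, gamma (homk_lmul m) = m
}.

Definition is_stable : Prop := forall m : A, gamma (homk_rmul m) = m.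

End Contraaction.

Section Endomorphism.
Variables (k : comPzRingType) (A : algType k).

Lemma mlin_upd n (V : lmodType k) (f : mlin A V n) (i : 'I_n) (a : n.-tuple A)
    (F : A -> n.-tuple A) (g : A -> A) :
  linear g -> (forall x, F x = upd a i (g x)) -> linear (fun x => f (F x)).
Proof.
by move=> lg FE c x y; rewrite !FE lg (mlin_multilinear f i a).
Qed.

Section Composition.
Variables (p q n i : nat) (phi : mlin A A p) (psi : mlin A A q).

(* phi(a_1, .., a_(p-i), psi(a_(p-i+1), .., a_(p+q-i)), a_(p+q-i+1), .., a_(p+q-1)),
   where the indices below start at 0 *)
Definition endo_circ_fun (a : n.-tuple A) : A :=
  phi [tuple if (j < p - i)%N then a`_j
             else if j == (p - i)%N :> nat then psi [tuple a`_(p - i + l) | l < q]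
             else a`_(j + q - 1) | j < p].

Fact endo_circ_multilinear : insertable p q n i -> multilinear endo_circ_fun.
Proof.
move=> /andP[/andP[i_gt0 le_ip] /eqP pq] l a.
set t := (p - i)%N; have lt_tp : (t < p)%N by rewrite /t; case: (p) (i) i_gt0 le_ip => [|p'] [|i'] // _ _; rewrite subSS ltnS leq_subr.
pose args (b : n.-tuple A) := [tuple if (j < t)%N then b`_j
             else if j == t :> nat then psi [tuple b`_(t + l) | l < q]
             else b`_(j + q - 1) | j < p].
have argsE b : endo_circ_fun b = phi (args b) by [].
have psi_eq (b c : n.-tuple A) :
    (forall r, (r < q)%N -> b`_(t + r) = c`_(t + r)) ->
    psi [tuple b`_(t + l) | l < q] = psi [tuple c`_(t + l) | l < q].
  by move=> bc; congr (mlin_fun psi _); apply: eq_from_tnth => r; rewrite !tnth_mktuple bc.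
have [lt_lt|le_tl] := ltnP l t.
  apply: (@mlin_upd _ _ phi (Ordinal (ltn_trans lt_lt lt_tp)) (args a) _ id) => // x.
  apply: eq_from_tnth => j; rewrite !tnth_mktuple -val_eqE ![val _]/= !nth_upd -/t.
  case: (ltnP j t) => [//|le_tj].
  have -> : (j : nat) == l = false by apply/negbTE; rewrite neq_ltn (leq_trans lt_lt le_tj) orbT.
  case: (eqVneq (j : nat) t) => [_|ne_jt].
    by apply: psi_eq => r _; rewrite nth_upd -[_ == _]negbK neq_ltn (leq_trans lt_lt (leq_addr _ _)) orbT.
  have lt_tj : (t < j)%N by rewrite ltn_neqAle eq_sym ne_jt.
  suff /negbTE-> : ((j + q - 1)%N != l) by [].
  have : (t <= j + q - 1)%N by rewrite -addnBAC ?(leq_trans _ lt_tj) //; apply: leq_trans (leq_addr _ _); case: (j : nat) lt_tj => // j'; rewrite subn1.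
  by move=> h; rewrite neq_ltn (leq_trans lt_lt h) orbT.
have [lt_ltq|le_tql] := ltnP l (t + q)%N.
  have lt_ltq' : (l - t < q)%N by rewrite ltn_subLR.
  pose b := [tuple a`_(t + r) | r < q].
  apply: (@mlin_upd _ _ phi (Ordinal lt_tp) (args a) _ (fun x => psi (upd b (Ordinal lt_ltq') x))) => [|x].
    exact: mlin_multilinear.
  apply: eq_from_tnth => j; rewrite !tnth_mktuple -val_eqE ![val _]/= !nth_upd -/t.
  case: (ltngtP j t) => [lt_jt|lt_tj|_].
  - by rewrite [_ == _]ltn_eqF // (leq_trans lt_jt).
  - suff /negbTE-> : ((j + q - 1)%N != l) by [].
    by rewrite neq_ltn orbC (leq_trans lt_ltq) // -addnBAC ?(leq_trans _ lt_tj) // leq_add2r; case: (j : nat) lt_tj => // j'; rewrite subn1.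
  congr (mlin_fun psi _); apply: eq_from_tnth => r; rewrite !tnth_mktuple -val_eqE ![val _]/= nth_upd.
  by rewrite -{1}(subnKC le_tl) eqn_add2l.
have q_le_l : (q <= l)%N by apply: leq_trans le_tql; rewrite leq_addl.
have lt_lp : (l - q + 1 < p)%N.
  by rewrite addn1 -(ltn_add2r q) addSn subnK // pq ltnS.
apply: (@mlin_upd _ _ phi (Ordinal lt_lp) (args a) _ id) => // x.
apply: eq_from_tnth => j; rewrite !tnth_mktuple -val_eqE ![val _]/= !nth_upd -/t.
have lt_tl : (t < l - q + 1)%N by rewrite addn1 ltnS leq_subRL // addnC.
case: (ltngtP j t) => [lt_jt|lt_tj|jt].
- have jl : (j < l)%N by apply: leq_trans lt_jt (leq_trans (leq_addr q t) le_tql).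
  have jl1 : (j < l - q + 1)%N by apply: ltn_trans lt_jt lt_tl.
  by rewrite !ltn_eqF.
- suff -> : ((j + q - 1)%N == l) = ((j : nat) == l - q + 1)%N by [].
  case: (j : nat) lt_tj => // j' _; rewrite addSn subn1 /= addn1 eqSS.
  by rewrite -{1}(subnK q_le_l) eqn_add2r.
rewrite jt ltn_eqF //; apply: psi_eq => r lt_rq; rewrite nth_upd [_ == _]ltn_eqF //.
by apply: leq_trans le_tql; rewrite ltn_add2l.
Qed.

Definition endo_circ : mlin A A n :=
  match @idP (insertable p q n i) with
  | ReflectT ok => Mlin (endo_circ_multilinear ok)
  | ReflectF _ => 0
  end.

Lemma endo_circE a : insertable p q n i -> endo_circ a = endo_circ_fun a.
Proof. by rewrite /endo_circ; case: {-}_ / idP. Qed.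

End Composition.

Fact endo_id_multilinear : multilinear (fun a : 1.-tuple A => thead a).
Proof. by move=> i a c x y; rewrite /thead !tnth_mktuple !(ord1 i). Qed.

Fact endo_mul_multilinear : multilinear (fun a : 2.-tuple A => a`_0 * a`_1).
Proof.
move=> i a c x y; rewrite !nth_upd.
by case: i => [[|[|//]]] ? /=; rewrite ?mulrDl ?mulrDr -?scalerAl -?scalerAr.
Qed.

Fact endo_unit_multilinear : multilinear (fun _ : 0.-tuple A => 1 : A).
Proof. by case. Qed.

Definition endo_operad : mult_operad k := {|
  op := fun n => mlin A A n : lmodType k;
  op_circ := fun p q n i => @endo_circ p q n i;
  op_id := Mlin endo_id_multilinear;
  op_mul := Mlin endo_mul_multilinear;
  op_unit := Mlin endo_unit_multilinear
|}.

Variable gamma : homk (homk A A) A.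

Section Tau.
Variables (n : nat) (f : mlin A A n).

(* a_1 f(a_2, .., a_n, x), and x f() if n = 0: the first entry of (a_1, .., a_n, x)
   times the value of f on the remaining ones *)
Definition rotate_eval (a : n.-tuple A) (x : A) : A :=
  (rcons a x)`_0 * f [tuple (rcons a x)`_j.+1 | j < n].

Fact rotate_eval_linear a : linear (rotate_eval a).
Proof.
rewrite /rotate_eval; case: n f a => [|m] g a c x y.
  have [h G] : exists h, forall u : 0.-tuple A, g u = h.
    by exists (g [tuple]) => u; rewrite (tuple0 u).
  by rewrite !G !nth_rcons !size_tuple /= mulrDl -scalerAl.
rewrite !nth_rcons !size_tuple /=; set a0 := a`_0.
pose b := [tuple a`_j.+1 | j < m.+1].
have E z : [tuple (rcons a z)`_j.+1 | j < m.+1] = upd b ord_max z.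
  apply: eq_from_tnth => j; rewrite !tnth_mktuple nth_rcons size_tuple -val_eqE /= eqSS ltnS.
  by case: (ltngtP j m) => // lt_mj; move: (ltn_ord j); rewrite ltnS leqNgt lt_mj.
by rewrite !E (mlin_multilinear g ord_max b) mulrDr -scalerAr.
Qed.

Definition tau_fun (a : n.-tuple A) : A := gamma (Homk (rotate_eval_linear a)).

Fact rotate_eval_multilinear y : multilinear (fun a => rotate_eval a y).
Proof.
rewrite /rotate_eval; case: n f => [|m] g [l lt_l] a; first by have := lt_l.
move=> c x z; rewrite !nth_rcons !size_tuple ltn0Sn !nth_upd.
have argE u (j : 'I_m.+1) : (rcons (upd a (Ordinal lt_l) u) y)`_j.+1 =
    if j.+1 == l then u else (rcons a y)`_j.+1.
  rewrite !nth_rcons !size_tuple nth_upd /=.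
  case: ltnP => // le_mj; case: (eqVneq j.+1 l) => // jl.
  by have := lt_l; rewrite -jl ltnNge le_mj.
case: l lt_l argE => [|l] lt_l argE.
  rewrite eqxx mulrDl -scalerAl.
  have E u : [tuple (rcons (upd a (Ordinal lt_l) u) y)`_j.+1 | j < m.+1] =
      [tuple (rcons a y)`_j.+1 | j < m.+1].
    by apply: eq_from_tnth => j; rewrite !tnth_mktuple argE.
  by rewrite !E.
pose b := [tuple (rcons a y)`_j.+1 | j < m.+1].
have E u : [tuple (rcons (upd a (Ordinal lt_l) u) y)`_j.+1 | j < m.+1] =
    upd b (Ordinal (ltnW lt_l)) u.
  by apply: eq_from_tnth => j; rewrite !tnth_mktuple argE eqSS -val_eqE.
by rewrite !E (mlin_multilinear g _ b) mulrDr -scalerAr.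
Qed.

Fact tau_multilinear : multilinear tau_fun.
Proof.
move=> i a c x y; rewrite /tau_fun.
have -> : Homk (rotate_eval_linear (upd a i (c *: x + y))) =
    c *: Homk (rotate_eval_linear (upd a i x)) + Homk (rotate_eval_linear (upd a i y)).
  by apply/homkP => z; apply: rotate_eval_multilinear.
by rewrite homk_linear.
Qed.

Definition tau : mlin A A n := Mlin tau_multilinear.

End Tau.
End Endomorphism.

(* An A-bimodule over k is a module over A^e = A (x)_k A^op. *)
Record bimodule (k : comPzRingType) (A : algType k) := Bimodule {
  bm :> lmodType k;
  lact : A -> bm -> bm;
  ract : bm -> A -> bm;
  lact_linear : forall a, linear (lact a);
  lact_linearl : forall m, linear (lact^~ m);
  ract_linear : forall a, linear (ract^~ a);
  ract_linearr : forall m, linear (ract m);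
  lact1 : forall m, lact 1 m = m;
  lactM : forall a b m, lact (a * b) m = lact a (lact b m);
  ract1 : forall m, ract m 1 = m;
  ractM : forall m a b, ract m (a * b) = ract (ract m a) b;
  lractA : forall a m b, lact a (ract m b) = ract (lact a m) b
}.

Section RegularBimodule.
Variables (k : comPzRingType) (A : algType k).

Fact regular_ract_linear (a : A) : linear (fun m : A => m * a).
Proof. exact: homk_rmul_linear. Qed.
Fact regular_lact_linear (a : A) : linear (fun m : A => a * m).
Proof. exact: homk_lmul_linear. Qed.

Definition regular : bimodule A := @Bimodule k A A *%R *%R
  regular_lact_linear regular_ract_linear regular_ract_linear regular_lact_linear
  (@mul1r A) (fun a b m => esym (mulrA a b m)) (@mulr1 A) (@mulrA A) (@mulrA A).

End RegularBimodule.

Section BimoduleHom.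
Variables (k : comPzRingType) (A : algType k) (M N : bimodule A).

Definition is_bimodule_map (f : M -> N) : Prop :=
  [/\ linear f, forall a m, f (lact a m) = lact a (f m)
    & forall m a, f (ract m a) = ract (f m) a].

Fact bimodule_map0 : is_bimodule_map 0.
Proof.
split=> [|a m|m a]; first exact: linear_map0.
  by rewrite [RHS](linear_map_zero (lact_linear a)).
by rewrite [RHS](linear_map_zero (ract_linear a)).
Qed.
Fact bimodule_map_lin (c : k) (f g : M -> N) :
  is_bimodule_map f -> is_bimodule_map g -> is_bimodule_map (c *: f + g).
Proof.
move=> [lf fl fr] [lg gl gr]; split=> [|a m|m a]; first exact: linear_map_lin.
  by rewrite !addrfctE !scalrfctE fl gl lact_linear.
by rewrite !addrfctE !scalrfctE fr gr ract_linear.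
Qed.

Definition bimodule_maps : submodule (M -> N) :=
  Submodule bimodule_map0 bimodule_map_lin.

(* Hom_{A^e}(M, N) *)
Definition bhom : Type := sub_of bimodule_maps.

HB.instance Definition _ := GRing.Lmodule.on bhom.

Definition bhom_fun (f : bhom) : M -> N := sub_val f.

Lemma bhom_is_bimodule_map (f : bhom) : is_bimodule_map (bhom_fun f).
Proof. exact: (@sub_of_in _ _ bimodule_maps f). Qed.

Fact bhom_comp_multilinear (f : bhom) n (theta : mlin A M n) :
  multilinear (fun a => bhom_fun f (theta a)).
Proof.
have [lf _ _] := bhom_is_bimodule_map f.
by move=> i a c x y; rewrite mlin_multilinear lf.
Qed.

Definition bhom_comp f n theta : mlin A N n := Mlin (@bhom_comp_multilinear f n theta).

End BimoduleHom.
Coercion bhom_fun : bhom >-> Funclass.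

Definition surjective (T U : Type) (f : T -> U) : Prop := forall u, exists t, f t = u.

Definition projective_module (k : comPzRingType) (P : lmodType k) : Prop :=
  forall (M N : lmodType k) (g : homk M N) (f : homk P N), surjective g ->
  exists h : homk P M, forall x, g (h x) = f x.

Definition projective_bimodule (k : comPzRingType) (A : algType k) (P : bimodule A) :
    Prop :=
  forall (M N : bimodule A) (g : bhom M N) (f : bhom P N), surjective g ->
  exists h : bhom P M, forall x, g (h x) = f x.

Section Hochschild.
Variables (k : comPzRingType) (A : algType k) (M : bimodule A).

Definition hochschild_d n (f : mlin A M n) (a : n.+1.-tuple A) : M :=
  lact a`_0 (f [tuple a`_j.+1 | j < n])
  + \sum_(i < n) (-1) ^+ i.+1 *:
      f [tuple if (j < i)%N then a`_j
               else if j == i then a`_i * a`_i.+1 else a`_j.+1 | j < n]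
  + (-1) ^+ n.+1 *: ract (f [tuple a`_j | j < n]) a`_n.

Lemma hochschild_d_linear n (a : n.+1.-tuple A) :
  linear (fun f : mlin A M n => hochschild_d f a).
Proof.
move=> c f g; rewrite /hochschild_d !mlinD !mlinZ lact_linear ract_linear.
under eq_bigr do rewrite mlinD mlinZ scalerDr scalerA mulrC -scalerA.
rewrite big_split /= -scaler_sumr !scalerDr !scalerA [_ * c]mulrC -!scalerA.
set L := c *: lact _ _; set S := c *: \sum_(i < n) _.
by rewrite [L + _ + _]addrACA [L + S + _ + _]addrACA.
Qed.

Definition is_cocycle n (f : mlin A M n) : Prop := forall a, hochschild_d f a = 0.

Definition is_coboundary n : mlin A M n -> Prop :=
  match n with
  | 0 => fun f => f = 0
  | m.+1 => fun f => exists g : mlin A M m, forall a, f a = hochschild_d g a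
  end.

Fact is_cocycle0 n : is_cocycle (0 : mlin A M n).
Proof.
by move=> a; rewrite (linear_map_zero (hochschild_d_linear a)).
Qed.
Fact is_cocycle_lin n (c : k) (f g : mlin A M n) :
  is_cocycle f -> is_cocycle g -> is_cocycle (c *: f + g).
Proof. by move=> zf zg a; rewrite hochschild_d_linear zf zg scaler0 addr0. Qed.

Fact is_coboundary0 n : is_coboundary (0 : mlin A M n).
Proof. by case: n => [//|n]; exists 0 => a; rewrite is_cocycle0. Qed.
Fact is_coboundary_lin n (c : k) (f g : mlin A M n) :
  is_coboundary f -> is_coboundary g -> is_coboundary (c *: f + g).
Proof.
case: n f g => [f g -> ->|n f g [f' ff'] [g' gg']].
  by rewrite scaler0 addr0.
by exists (c *: f' + g') => a; rewrite mlinD mlinZ hochschild_d_linear ff' gg'.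
Qed.

Definition cocycles n : submodule (mlin A M n) :=
  Submodule (@is_cocycle0 n) (@is_cocycle_lin n).
Definition coboundaries n : submodule (mlin A M n) :=
  Submodule (@is_coboundary0 n) (@is_coboundary_lin n).

Definition HH (n : nat) : lmodType k := subquotient (cocycles n) (coboundaries n).

Definition HH_class n (f : mlin A M n) (x : HH n) : Prop :=
  @represents k _ (cocycles n) (coboundaries n) f x.

End Hochschild.

Lemma mlin_sum (k : comPzRingType) (U V : lmodType k) n m (F : 'I_m -> mlin U V n) a :
  (\sum_(i < m) F i : mlin U V n) a = \sum_(i < m) F i a.
Proof. by elim/big_rec2: _ => [//|i x y _ <-]; rewrite mlinD. Qed.

(* Hochschild's differential is the alternating sum of the cofaces of the
   endomorphism operad, which are numbered from the right. *)
Lemma hochschild_d_coface (k : comPzRingType) (A : algType k) n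
    (f : mlin A A n) (a : n.+1.-tuple A) :
  @hochschild_d k A (regular A) n f a =
  (\sum_(i < n.+2) (-1) ^+ i *: @coface k (endo_operad A) n (n.+1 - i) f
     : mlin A A n.+1) a.
Proof.
have nth2 (F : 'I_2 -> A) : [tuple F j | j < 2]`_0 * [tuple F j | j < 2]`_1 =
    F ord0 * F ord_max.
  by rewrite (nth_mktuple F 0 ord0) (nth_mktuple F 0 ord_max).
rewrite mlin_sum big_ord_recl big_ord_recr addrA /hochschild_d; congr (_ + _ + _).
- rewrite expr0 scale1r subn0 /coface eqxx /= endo_circE; last first.
    by rewrite /insertable /= !addSn add0n eqxx.
  by rewrite /endo_circ_fun -[RHS]/(_ * _) nth2.
- apply: eq_bigr => i _; rewrite mlinZ lift0 subSS; congr (_ *: _).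
  have ni : (n - i)%N != 0%N by rewrite subn_eq0 -ltnNge.
  have ni1 : (n - i == n.+1)%N = false by apply/negbTE; rewrite neq_ltn ltnS leq_subr.
  rewrite /coface (negbTE ni) ni1 endo_circE; last first.
    by rewrite /insertable lt0n ni leq_subr addn2 eqxx.
  rewrite /endo_circ_fun subKn; last exact: ltnW (ltn_ord i).
  apply: (congr1 (mlin_fun f)); apply: eq_from_tnth => j; rewrite !tnth_mktuple -val_eqE.
  case: ltnP => // _; case: eqP => [_|_]; last by rewrite addn2 subn1.
  by rewrite -[RHS]/(_ * _) nth2 addn0 addn1.
rewrite lift0 subnn mlinZ /coface eqxx endo_circE; last first.
  by rewrite /insertable /= !addSn add0n eqxx.
congr (_ *: _); rewrite /endo_circ_fun -[RHS]/(_ * _) nth2 /=.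
by rewrite add1n subn1.
Qed.

Section Ext.
Variables (k : comPzRingType) (A : algType k).

Record resolution := Resolution {
  res :> nat -> bimodule A;
  res_projective : forall n, projective_bimodule (res n);
  res_d : forall n, bhom (res n.+1) (res n);
  res_eps : bhom (res 0) (regular A);
  res_eps_surj : surjective res_eps;
  res_exact0 : forall x, res_eps x = 0 <-> exists y, res_d 0 y = x;
  res_exact : forall n x, res_d n x = 0 <-> exists y, res_d n.+1 y = x
}.

Variables (P : resolution) (M : bimodule A).

Definition is_ext_cocycle n (f : bhom (P n) M) : Prop :=
  forall y, f (res_d P n y) = 0.

Definition is_ext_coboundary n : bhom (P n) M -> Prop :=
  match n with
  | 0 => fun f => f = 0
  | m.+1 => fun f => exists g : bhom (P m) M, forall x, f x = g (res_d P m x)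
  end.

Fact is_ext_cocycle0 n : is_ext_cocycle (0 : bhom (P n) M).
Proof. by []. Qed.
Fact is_ext_cocycle_lin n (c : k) (f g : bhom (P n) M) :
  is_ext_cocycle f -> is_ext_cocycle g -> is_ext_cocycle (c *: f + g).
Proof.
move=> zf zg y; rewrite -[LHS]/(c *: f (res_d P n y) + g (res_d P n y)).
by rewrite zf zg scaler0 addr0.
Qed.

Fact is_ext_coboundary0 n : is_ext_coboundary (0 : bhom (P n) M).
Proof. by case: n => [//|n]; exists 0. Qed.
Fact is_ext_coboundary_lin n (c : k) (f g : bhom (P n) M) :
  is_ext_coboundary f -> is_ext_coboundary g -> is_ext_coboundary (c *: f + g).
Proof.
case: n f g => [f g -> ->|n f g [f' ff'] [g' gg']].
  by rewrite scaler0 addr0.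
exists (c *: f' + g') => x.
by rewrite -[LHS]/(c *: f x + g x) ff' gg'.
Qed.

Definition ext_cocycles n : submodule (bhom (P n) M) :=
  Submodule (@is_ext_cocycle0 n) (@is_ext_cocycle_lin n).
Definition ext_coboundaries n : submodule (bhom (P n) M) :=
  Submodule (@is_ext_coboundary0 n) (@is_ext_coboundary_lin n).

Definition Ext (n : nat) : lmodType k :=
  subquotient (ext_cocycles n) (ext_coboundaries n).

Definition Ext_class n (f : bhom (P n) M) (x : Ext n) : Prop :=
  @represents k _ (ext_cocycles n) (ext_coboundaries n) f x.

(* A chain map over id_A from the bar resolution of A, whose n-th module is
   A (x) A^{(x) n} (x) A, to P: bimodule maps from this module to P_n are the
   multilinear maps A^n -> P_n. *)
Definition is_comparison (theta : forall n, mlin A (P n) n) : Prop :=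
  res_eps P (theta 0%N [tuple]) = 1 /\
  forall n (a : n.+1.-tuple A),
    res_d P n (theta n.+1 a) = hochschild_d (theta n) a.

End Ext.

Definition operad_class (k : comPzRingType) (A : algType k) n (phi : endo_operad A n)
    (x : HH (regular A) n) : Prop :=
  @HH_class k A (regular A) n phi x.

Record is_induced (k : comPzRingType) (A : algType k) (gamma : homk (homk A A) A)
    (X : bv_ops (HH (regular A))) : Prop := {
  induced_cup : forall p q (phi : endo_operad A p) (psi : endo_operad A q) x y,
    operad_class phi x -> operad_class psi y ->
    operad_class (op_cup phi psi) (gcup X (p + q) x y);
  induced_one : operad_class (op_unit (endo_operad A)) (gone X);
  induced_br : forall p q n (phi : endo_operad A p) (psi : endo_operad A q) x y,
    (p + q = n.+1)%N -> operad_class phi x -> operad_class psi y ->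
    operad_class (op_bracket n phi psi) (gbr X n x y);
  induced_B : forall n (phi : endo_operad A n.+1) x,
    operad_class phi x ->
    operad_class (connes (O := endo_operad A) (tau gamma) phi) (gB X n x)
}.

(* Y is the transport of X along the isomorphism Phi from Ext(A, A), computed with
   P, to H(A, A) which is induced by the comparison map theta. *)
Record is_ext_transport (k : comPzRingType) (A : algType k) (P : resolution A)
    (X : bv_ops (HH (regular A))) (Y : bv_ops (Ext P (regular A)))
    (theta : forall n, mlin A (P n) n)
    (Phi : forall n, homk (Ext P (regular A) n) (HH (regular A) n)) : Prop := {
  transport_comparison : is_comparison theta;
  transport_induced : forall n (f : bhom (P n) (regular A)) (x : Ext P (regular A) n),
    Ext_class f x -> HH_class (bhom_comp f (theta n)) (Phi n x);
  transport_bijective : forall n, bijective (Phi n);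
  transport_morphism : is_bv_morphism Y X Phi
}.

(* Main.v *)
Require Import Defs.
From mathcomp Require Import all_boot all_order all_algebra.
From mathcomp Require Import zify.
From mathcomp Require Import boolp.

(** The cyclic structure.  Write [gam] for the contraaction.  Right linearity moves a
    right factor under [gam], and contraassociativity evaluates a nested [gam] at 1; with
    these two rules the para-cyclic axioms are identities between values of multilinear
    maps.  In the stable case, [gam] is a trace, [gam (x => a h(x)) = gam (x => h(x) a)]
    ([gam_trace]), and [tau] is an adjoint of the cyclic shift of arguments ([gam_tau]).
    Moving all letters of a cyclic word once around shows that [tau^(n+1)] is the
    identity ([tau_order_endo]).

    The Batalin-Vilkovisky structure exists on the cohomology of every cyclic operad with
    multiplication ([cohomology_bv]).  The differential of a composite of a cochain with
    a cocycle is a difference of two consecutive terms of one family ([bd_circ_step]), so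
    alternating sums of composites have telescoping differentials.  Three such sums give
    the homotopies that are needed: the brace of two cocycles for the commutativity of
    the cup product ([bd_brace]), the simultaneous insertion of two cocycles for the
    derivation property of the bracket ([brace_cup_right]), and a sum over rotations for
    Connes' operator ([bd_bplus_brace]).  The last one says that, for cocycles [phi] and
    [psi], the brace of [phi] and [psi] is cohomologous to the product of [B phi] and
    [psi] plus the part of [B] of the product of [phi] and [psi] in which the output is
    an input of [phi].  Since [B] of the product is the sum of two such parts
    ([bplus_cup]), this is the Batalin-Vilkovisky identity ([bracket_bv]).  The Jacobi
    identity holds for cochains, because the associator of the brace is graded symmetric
    ([brace_prelie]).  The operator [bplus] used in these computations differs from
    Connes' operator by a sign and, on cocycles, a coboundary ([connes_cohomologous]).

    For a projective resolution of [A], restriction along a comparison map is an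
    isomorphism from Ext to Hochschild cohomology with coefficients in any bimodule
    ([restr_iso]).  This is shown by dimension shifting along the embedding of a bimodule
    in the coinduced one, whose cohomology of both kinds vanishes in positive degrees.
    Projectivity of [A] over [k] enters in three places: multilinear maps lift along
    surjections ([mlin_lift]), projective bimodules are projective over [k], and hence
    the resolution splits over [k] ([res_split]). *)

Set Implicit Arguments.
Unset Strict Implicit.
Unset Printing Implicit Defensive.

Import GRing.Theory.
Local Open Scope ring_scope.

(** * Identities in abelian groups *)

(** Formal signed sums of atoms; an atom is given by its position in an environment. *)
Inductive gexp := GVar of nat | GZero | GAdd of gexp & gexp | GOpp of gexp.

(** The number of positive and of negative occurrences of atom [i]. *)
Fixpoint gcount (i : nat) (x : gexp) : nat * nat :=
  match x with
  | GVar j => (nat_of_bool (i == j), 0)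
  | GZero => (0, 0)
  | GAdd y z => ((gcount i y).1 + (gcount i z).1, (gcount i y).2 + (gcount i z).2)
  | GOpp y => ((gcount i y).2, (gcount i y).1)
  end%N.

(** The value of a formal sum. *)
Fixpoint geval (V : zmodType) (env : seq V) (x : gexp) : V :=
  match x with
  | GVar j => nth 0 env j
  | GZero => 0
  | GAdd y z => geval env y + geval env z
  | GOpp y => - geval env y
  end.

(** Equality of the multiplicities of the first [n] atoms. *)
Definition gequal (n : nat) (x y : gexp) : bool :=
  all (fun i => (gcount i x).1 + (gcount i y).2 == (gcount i y).1 + (gcount i x).2)%N
    (iota 0 n).

Lemma geval_count (V : zmodType) (env : seq V) (x : gexp) :
  geval env x =
  \sum_(i < size env) (env`_i *+ (gcount i x).1 - env`_i *+ (gcount i x).2).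
Proof.
elim: x => [j||x IHx y IHy|x IHx] /=.
- case: (ltnP j (size env)) => [lt_j|le_j].
    rewrite (bigD1 (Ordinal lt_j)) //= eqxx subr0 big1 ?addr0 // => i.
    by rewrite -val_eqE /= => /negbTE ->; rewrite subr0.
  rewrite nth_default // big1 // => i _; rewrite (_ : (i == j :> nat) = false) ?subr0 //.
  by apply/negbTE; rewrite neq_ltn (leq_trans (ltn_ord i) le_j).
- by rewrite big1 // => i _; rewrite subr0.
- rewrite IHx IHy -big_split; apply: eq_bigr => i _ /=.
  by rewrite !mulrnDr opprD addrACA.
- by rewrite IHx -sumrN; apply: eq_bigr => i _; rewrite opprB.
Qed.

Lemma gequalP (V : zmodType) (env : seq V) (x y : gexp) :
  gequal (size env) x y -> geval env x = geval env y.
Proof.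
move=> /allP xy; rewrite !geval_count; apply: eq_bigr => i _.
have /xy : (i : nat) \in iota 0 (size env) by rewrite mem_iota ltn_ord.
move=> /eqP E; apply/eqP; rewrite subr_eq addrAC eq_sym subr_eq -!mulrnDr.
by apply/eqP; rewrite E.
Qed.

(* Atoms are compared up to conversion, because equal terms may carry different
   presentations of the same algebraic structure. *)
Ltac g_index t env :=
  match env with
  | t :: _ => constr:(0%N)
  | ?u :: _ => let _ := match goal with _ => unify t u end in constr:(0%N)
  | _ :: ?e => let i := g_index t e in constr:(S i)
  end.

(* Adds the atoms of [t] to the environment. *)
Ltac g_atoms V t env :=
  match t with
  | @GRing.add _ ?x ?y => let e := g_atoms V x env in g_atoms V y e
  | @GRing.opp _ ?x => g_atoms V x env
  | @GRing.zero _ => env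
  | _ => match env with
         | _ => let i := g_index t env in env
         | _ => constr:(@cons V t env)
         end
  end.

(* The formal sum denoted by [t]. *)
Ltac g_reify t env :=
  match t with
  | @GRing.add _ ?x ?y =>
      let u := g_reify x env in let v := g_reify y env in constr:(GAdd u v)
  | @GRing.opp _ ?x => let u := g_reify x env in constr:(GOpp u)
  | @GRing.zero _ => constr:(GZero)
  | _ => let i := g_index t env in constr:(GVar i)
  end.

(** Proves an equality between two signed sums of the same terms. *)
Ltac abelian :=
  match goal with
  | |- @eq ?V ?x ?y =>
      let e := g_atoms V x (@nil V) in
      let env := g_atoms V y e in
      let u := g_reify x env in
      let v := g_reify y env in
      exact: (@gequalP _ env u v isT)
  end.

(** * Signs *)

(* Proves an equality between powers of -1 whose exponents are polynomials. *)
Ltac parity :=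
  rewrite -?exprD -?exprMn -?exprS -?exprM -?exprSr;
  rewrite -[LHS]signr_odd -[RHS]signr_odd; congr (_ ^+ nat_of_bool _);
  rewrite ?(oddD, oddM, oddS, negbK, oddX) /=;
  repeat match goal with |- context [odd ?n] => case: (odd n) => /= end; by [].

Lemma sign_congr (k : pzRingType) (a b : nat) :
  odd a = odd b -> (-1) ^+ a = (-1) ^+ b :> k.
Proof. by move=> ab; rewrite -signr_odd ab signr_odd. Qed.

Lemma sign_sq (k : pzRingType) (a : nat) : (-1) ^+ a * (-1) ^+ a = 1 :> k.
Proof. by rewrite -exprD -signr_odd addnn odd_double. Qed.

Lemma sign_scale (k : pzRingType) (V : lmodType k) (n : nat) (x : V) :
  (-1) ^+ n *: x = if odd n then - x else x.
Proof. by rewrite -signr_odd; case: odd; rewrite ?expr1 ?scaleN1r ?scale1r. Qed.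

(** * Linear maps *)

Section LinearLemmas.
Variables (k : pzRingType) (U V : lmodType k) (f : U -> V) (lf : linear f).

Lemma linB : {morph f : x y / x - y}.
Proof. by move=> x y; have := lf (-1) y x; rewrite !scaleN1r addrC [- _ + _]addrC. Qed.
Lemma lin0 : f 0 = 0.
Proof. by have := linB 0 0; rewrite !subr0 => ->; rewrite -(subrr (f 0)) -linB subrr. Qed.
Lemma linN : {morph f : x / - x}.
Proof. by move=> x; rewrite -[- x]add0r linB lin0 add0r. Qed.
Lemma linD : {morph f : x y / x + y}.
Proof. by move=> x y; rewrite -{1}[y]opprK linB linN opprK. Qed.
Lemma linZ c x : f (c *: x) = c *: f x.
Proof. by rewrite -[c *: x]addr0 lf lin0 addr0. Qed.
Lemma lin_sum (I : Type) (r : seq I) (P : pred I) (F : I -> U) :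
  f (\sum_(i <- r | P i) F i) = \sum_(i <- r | P i) f (F i).
Proof. exact: (big_morph f linD lin0). Qed.

End LinearLemmas.

Lemma lin_comp (k : pzRingType) (U V W : lmodType k) (f : U -> V) (g : V -> W) :
  linear f -> linear g -> linear (fun x => g (f x)).
Proof. by move=> lf lg c x y; rewrite lf lg. Qed.

Lemma lin_iter (k : pzRingType) (U : lmodType k) (f : U -> U) n :
  linear f -> linear (iter n f).
Proof. by move=> lf; elim: n => [//|n IHn] c x y; rewrite !iterS IHn lf. Qed.

(** * Alternating sums of cofaces *)

Lemma alternating_square (k : pzRingType) (C : nat -> lmodType k)
    (d : forall n, nat -> C n -> C n.+1) :
  (forall n i, linear (@d n i)) ->
  (forall n i j (x : C n), (i < j <= n.+2)%N -> d _ j (d _ i x) = d _ i (d _ j.-1 x)) ->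
  forall n (x : C n),
    \sum_(0 <= j < n.+3) (-1) ^+ j *: d _ j (\sum_(0 <= i < n.+2) (-1) ^+ i *: d _ i x) = 0.
Proof.
move=> d_lin dd n x.
pose F j i := (-1) ^+ (i + j) *: d n.+1 j (d n i x).
have -> : \sum_(0 <= j < n.+3) (-1) ^+ j *: d _ j (\sum_(0 <= i < n.+2) (-1) ^+ i *: d _ i x) =
    \sum_(0 <= j < n.+3) (\sum_(0 <= i < n.+2) (if (i < j)%N then F j i else 0) +
      \sum_(0 <= i < n.+2) (if (i < j)%N then 0 else F j i)).
  apply: eq_bigr => j _; rewrite (lin_sum (d_lin _ _)) scaler_sumr -big_split.
  apply: eq_bigr => i _ /=; rewrite (linZ (d_lin _ _)) scalerA -exprD addnC -/(F j i).
  by case: ifP; rewrite ?add0r ?addr0.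
rewrite big_split big_nat_recl //= big1 // add0r [X in _ + X]big_nat_recr //=.
rewrite [X in _ + (_ + X)]big_nat_cond [X in _ + (_ + X)]big1 => [|i]; last first.
  by rewrite andbT => /andP[_ ->].
rewrite addr0 [X in _ + X]exchange_big_nat -big_split big_nat_cond big1 //= => i i_in.
rewrite -big_split big_nat_cond big1 //= => j j_in; rewrite ltnS.
have [ji|ij] := leqP j i; last by rewrite add0r.
rewrite /F dd; last by lia.
by rewrite addnS exprS mulN1r scaleNr /= [(j + i)%N]addnC addNr.
Qed.

(** * Operads with multiplication *)

(** Partial compositions are supposed to vanish outside of their range, which makes
    them bilinear without side conditions. *)
Section Operad.
Variables (k : comPzRingType) (O : mult_operad k).
Hypothesis mO : is_mult_operad O.
Hypothesis circ0 : forall p q n i (phi : O p) (psi : O q),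
  ~~ insertable p q n i -> op_circ n i phi psi = 0.

Local Notation circ n i phi psi := (@op_circ k O _ _ n i phi psi).
Local Notation mu := (op_mul O).
Local Notation e1 := (op_unit O).
Local Notation oO := (mult_operad_operad mO).

Lemma circ_lin_l p q n i (psi : O q) : linear (fun phi : O p => circ n i phi psi).
Proof.
have [/(circ_linl oO)//|ni] := boolP (insertable p q n i).
by move=> c x y; rewrite !circ0 // scaler0 addr0.
Qed.
Lemma circ_lin_r p q n i (phi : O p) : linear (fun psi : O q => circ n i phi psi).
Proof.
have [/(circ_linr oO)//|ni] := boolP (insertable p q n i).
by move=> c x y; rewrite !circ0 // scaler0 addr0.
Qed.

Section Circ.
Variables (p q n i : nat).
Lemma circDl (x y : O p) (z : O q) : circ n i (x + y) z = circ n i x z + circ n i y z.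
Proof. exact: (linD (circ_lin_l n i z)). Qed.
Lemma circDr (x : O p) (y z : O q) : circ n i x (y + z) = circ n i x y + circ n i x z.
Proof. exact: (linD (circ_lin_r n i x)). Qed.
Lemma circBl (x y : O p) (z : O q) : circ n i (x - y) z = circ n i x z - circ n i y z.
Proof. exact: (linB (circ_lin_l n i z)). Qed.
Lemma circNl (x : O p) (z : O q) : circ n i (- x) z = - circ n i x z.
Proof. exact: (linN (circ_lin_l n i z)). Qed.
Lemma circZl c (x : O p) (z : O q) : circ n i (c *: x) z = c *: circ n i x z.
Proof. exact: (linZ (circ_lin_l n i z)). Qed.
Lemma circZr c (x : O p) (z : O q) : circ n i x (c *: z) = c *: circ n i x z.
Proof. exact: (linZ (circ_lin_r n i x)). Qed.
Lemma circ0l (z : O q) : circ n i (0 : O p) z = 0.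
Proof. exact: (lin0 (circ_lin_l n i z)). Qed.
Lemma circ0r (x : O p) : circ n i x (0 : O q) = 0.
Proof. exact: (lin0 (circ_lin_r n i x)). Qed.
Lemma circ_suml (I : Type) (r : seq I) (P : pred I) (F : I -> O p) (z : O q) :
  circ n i (\sum_(j <- r | P j) F j) z = \sum_(j <- r | P j) circ n i (F j) z.
Proof. exact: (lin_sum (circ_lin_l n i z)). Qed.
Lemma circ_sumr (I : Type) (r : seq I) (P : pred I) (F : I -> O q) (x : O p) :
  circ n i x (\sum_(j <- r | P j) F j) = \sum_(j <- r | P j) circ n i x (F j).
Proof. exact: (lin_sum (circ_lin_r n i x)). Qed.
End Circ.

(** * Cofaces of a partial composition *)

Local Notation d m phi := (coface m phi).

Lemma coface_lin n m : linear (@coface k O n m).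
Proof.
move=> c x y; rewrite /coface; case: ifP => _; first exact: circ_lin_r.
by case: ifP => _; [exact: circ_lin_r | exact: circ_lin_l].
Qed.

Lemma coface_first n (phi : O n) : d 0 phi = circ n.+1 2 mu phi.
Proof. by []. Qed.
Lemma coface_last n (phi : O n) : d n.+1 phi = circ n.+1 1 mu phi.
Proof. by rewrite /coface eqxx. Qed.
Lemma coface_mid n m (phi : O n) : (0 < m <= n)%N -> d m phi = circ n.+1 m phi mu.
Proof.
move=> m_in; rewrite /coface.
have -> : (m == 0)%N = false by lia.
by have -> : (m == n.+1)%N = false by lia.
Qed.

Section Faces.
Variables (p q n j : nat) (phi : O p) (psi : O q).
Hypotheses (pq : (p + q = n.+1)%N) (jp : (0 < j <= p)%N).

Lemma coface_circ_lt m : (m < j)%N ->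
  d m (circ n j phi psi) = circ n.+1 j.+1 (d m phi) psi.
Proof.
case: m => [|m] mj.
  rewrite !coface_first (@circ_seq _ _ oO 2 p q p.+1 n n.+1 2 j.+1); try lia.
  by congr (circ _ _ _ (circ _ _ _ _)); lia.
rewrite !coface_mid; try lia.
rewrite (@circ_par _ _ oO p q 2 n p.+1 n.+1); try lia.
by congr (circ _ _ _ _); lia.
Qed.

Lemma coface_circ_mid m : (j <= m < j + q)%N ->
  d m (circ n j phi psi) = circ n.+1 j phi (d (m - j + 1) psi).
Proof.
move=> mj; rewrite !coface_mid; try lia.
by rewrite (@circ_seq _ _ oO p q 2 n q.+1 n.+1); try lia.
Qed.

Lemma coface_circ_ge m : (j + q <= m <= n.+1)%N ->
  d m (circ n j phi psi) = circ n.+1 j (d (m + 1 - q) phi) psi.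
Proof.
move=> mj; have [->|mn] := eqVneq m n.+1.
  have -> : (n.+1 + 1 - q = p.+1)%N by lia.
  rewrite !coface_last (@circ_seq _ _ oO 2 p q p.+1 n n.+1); try lia.
  by congr (circ _ _ _ (circ _ _ _ _)); lia.
rewrite !coface_mid; try lia.
rewrite (@circ_par _ _ oO p 2 q p.+1 n n.+1); try lia.
by congr (circ _ _ _ _); lia.
Qed.

Lemma circ_coface_right : circ n.+1 j.+1 (d j phi) psi = circ n.+1 j phi (d 0 psi).
Proof.
rewrite coface_first coface_mid // (@circ_seq _ _ oO p 2 q p.+1 q.+1 n.+1); try lia.
by congr (circ _ _ _ (circ _ _ _ _)); lia.
Qed.

Lemma circ_coface_left : circ n.+1 j (d j phi) psi = circ n.+1 j phi (d q.+1 psi).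
Proof.
rewrite coface_last coface_mid // (@circ_seq _ _ oO p 2 q p.+1 q.+1 n.+1); try lia.
by congr (circ _ _ _ (circ _ _ _ _)); lia.
Qed.

End Faces.

(** * The cosimplicial module *)

Lemma coface_mul m : (m <= 3)%N -> d m mu = circ 3 1 mu mu.
Proof.
case: m => [|[|[|[|//]]]] _; first by rewrite (op_mulA mO).
- by rewrite coface_mid.
- by rewrite coface_mid // (op_mulA mO).
by rewrite coface_last.
Qed.

Lemma coface_cofaceE n i j (x : O n) : (i < j <= n.+2)%N ->
  d j (d i x) = d i (d j.-1 x).
Proof.
case: i => [|i] ij.
  rewrite !coface_first.
  have [->|j1] := eqVneq j 1%N.
    rewrite (@coface_circ_lt 2 n n.+1 2) //= coface_first.
    rewrite -[circ n.+2 2 mu _]coface_first (@coface_circ_lt 2 n n.+1 2) //.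
    by rewrite !coface_mul.
  have [jn|jn] := eqVneq j n.+2; last first.
    rewrite (@coface_circ_mid 2 n n.+1 2); try lia.
    by congr (circ _ _ _ (coface _ _)); lia.
  rewrite jn (@coface_circ_ge 2 n n.+1 2); try lia.
  have -> : (n.+2 + 1 - n = 3)%N by lia.
  rewrite coface_last coface_last (op_mulA mO).
  by rewrite (@circ_seq _ _ oO 2 2 n 3 n.+1 n.+2); try lia.
have [ine|i_n] := eqVneq i n.
  have -> : j = n.+2 by lia.
  rewrite ine /= [coface n.+1 x]coface_last.
  rewrite (@coface_circ_ge 2 n n.+1 1 _ _ _ _ n.+2); try lia.
  rewrite (@coface_circ_ge 2 n n.+1 1 _ _ _ _ n.+1); try lia.
  by rewrite !coface_mul; try lia.
rewrite [coface i.+1 x]coface_mid; last lia.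
have [->|ji] := eqVneq j i.+2.
  rewrite (@coface_circ_mid n 2 n.+1 i.+1) /=; try lia.
  rewrite [coface i.+1 x]coface_mid; last lia.
  rewrite (@coface_circ_mid n 2 n.+1 i.+1) /=; try lia.
  by rewrite !coface_mul; try lia.
rewrite (@coface_circ_ge n 2 n.+1 i.+1) /=; try lia.
rewrite [RHS]coface_mid; last lia.
by congr (circ _ _ (coface _ _) _); lia.
Qed.

Local Notation s j phi := (codegen j phi).

Lemma codegen_lin n j : linear (@codegen k O n j).
Proof. exact: circ_lin_l. Qed.

Lemma codegen_codegenE n i j (x : O n.+2) : (i <= j <= n)%N ->
  s j (s i x) = s i (s j.+1 x).
Proof.
move=> ij; rewrite /codegen.
rewrite (@circ_par _ _ oO n.+2 0 0 n.+1 n.+1 n j.+2 i.+1); try lia.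
by congr (circ _ _ _ _); lia.
Qed.

Lemma codegen_coface_ltE n i j (x : O n.+1) : (i < j <= n.+1)%N ->
  s j (d i x) = d i (s j.-1 x).
Proof.
rewrite /codegen; case: i => [|i] ij.
  rewrite !coface_first (@circ_seq _ _ oO 2 n.+1 0 n.+2 n n.+1); try lia.
  by congr (circ _ _ _ (circ _ _ _ _)); lia.
rewrite !coface_mid; try lia.
rewrite (@circ_par _ _ oO n.+1 0 2 n n.+2 n.+1); try lia.
by congr (circ _ _ _ _); lia.
Qed.

Lemma codegen_coface_same n j (x : O n) : (j <= n)%N -> s j (d j x) = x.
Proof.
rewrite /codegen; case: j => [|j] jn.
  rewrite coface_first (@circ_par _ _ oO 2 n 0 n.+1 1 n); try lia.
  by rewrite (op_mul1r mO) (circ_1l oO).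
rewrite coface_mid; last lia.
rewrite (@circ_seq _ _ oO n 2 0 n.+1 1 n); try lia.
have -> : (j.+2 - j.+1 + 1 = 2)%N by lia.
by rewrite (op_mul1l mO) (circ_1r oO).
Qed.

Lemma codegen_coface_succ n j (x : O n) : (j <= n)%N -> s j (d j.+1 x) = x.
Proof.
rewrite /codegen => jn; have [->|j_n] := eqVneq j n.
  rewrite coface_last.
  have -> : n.+1 = (2 + n - 1)%N by lia.
  rewrite -(@circ_par _ _ oO 2 0 n 1 n.+1 n); try lia.
  by rewrite (op_mul1l mO) (circ_1l oO).
rewrite coface_mid; last lia.
rewrite (@circ_seq _ _ oO n 2 0 n.+1 1 n); try lia.
have -> : (j.+1 - j.+1 + 1 = 1)%N by lia.
by rewrite (op_mul1r mO) (circ_1r oO) //; lia.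
Qed.

Lemma codegen_coface_gtE n i j (x : O n.+1) : (j.+1 < i <= n.+2)%N ->
  s j (d i x) = d i.-1 (s j x).
Proof.
rewrite /codegen => ij; have [->|i_n] := eqVneq i n.+2.
  rewrite !coface_last (@circ_seq _ _ oO 2 n.+1 0 n.+2 n n.+1); try lia.
  by congr (circ _ _ _ (circ _ _ _ _)); lia.
rewrite !coface_mid; try lia.
rewrite (@circ_par _ _ oO n.+1 2 0 n.+2 n n.+1); try lia.
by congr (circ _ _ _ _); lia.
Qed.

Lemma operad_cosimplicial : is_cosimplicial (@coface k O) (@codegen k O).
Proof.
split.
- by move=> n i _; apply: coface_lin.
- by move=> n i _; apply: codegen_lin.
- exact: coface_cofaceE.
- exact: codegen_codegenE.
- exact: codegen_coface_ltE.
- by move=> n j x jn; rewrite codegen_coface_same // codegen_coface_succ.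
- exact: codegen_coface_gtE.
Qed.

(** * The differential *)

(** The alternating sum of the cofaces.  These are numbered from the right, so that
    Hochschild's differential is [bd] up to the sign [(-1)^(n + 1)] in degree [n]. *)
Definition bd n (x : O n) : O n.+1 := \sum_(0 <= m < n.+2) (-1) ^+ m *: d m x.
(** All cofaces but the last. *)
Definition bd' n (x : O n) : O n.+1 := \sum_(0 <= m < n.+1) (-1) ^+ m *: d m x.

Lemma bdE n (x : O n) : bd x = bd' x + (-1) ^+ n.+1 *: d n.+1 x.
Proof. by rewrite /bd big_nat_recr. Qed.

Lemma coface_sum_lin n a b :
  linear (fun x : O n => \sum_(a <= m < b) (-1) ^+ m *: d m x : O n.+1).
Proof.
move=> c x y; rewrite scaler_sumr -big_split; apply: eq_bigr => m _ /=.
by rewrite coface_lin scalerDr !scalerA mulrC.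
Qed.
Lemma bd_lin n : linear (@bd n). Proof. exact: coface_sum_lin. Qed.

(** The coface [d j] of [phi] occurs in both sums: composing [phi] with the
    multiplication at [j] leaves two inputs for [psi], and the two terms cancel the outer
    cofaces of [psi] in the last summand. *)
Lemma bd_circ p q n j (phi : O p) (psi : O q) :
  (p + q = n.+1)%N -> (0 < j <= p)%N ->
  bd (circ n j phi psi) =
    circ n.+1 j.+1 (\sum_(0 <= m < j.+1) (-1) ^+ m *: d m phi) psi
    + (-1) ^+ q.+1 *: circ n.+1 j (\sum_(j <= m < p.+2) (-1) ^+ m *: d m phi) psi
    + (-1) ^+ j.+1 *: circ n.+1 j phi (bd psi).
Proof.
move=> pq jp; rewrite /bd.
rewrite (@big_cat_nat _ _ _ j) /=; [|lia|lia].
rewrite (@big_cat_nat _ _ _ (j + q) j n.+2) /=; [|lia|lia].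
rewrite [\sum_(0 <= _ < j.+1) _]big_nat_recr //= circDl circZl (circ_coface_right _ _ pq jp).
rewrite [\sum_(j <= _ < p.+2) _]big_ltn; last lia.
rewrite circDl circZl (circ_coface_left _ _ pq jp).
rewrite [\sum_(0 <= _ < q.+2) _]big_ltn // [\sum_(1 <= _ < q.+2) _]big_nat_recr //= scale1r.
rewrite !circDr circZr !scalerDr.
have -> : \sum_(0 <= m < j) (-1) ^+ m *: d m (circ n j phi psi) =
    circ n.+1 j.+1 (\sum_(0 <= m < j) (-1) ^+ m *: d m phi) psi.
  rewrite circ_suml; apply: eq_big_nat => m mj.
  by rewrite (coface_circ_lt _ _ pq jp) ?circZl; last lia.
have -> : \sum_(j <= m < j + q) (-1) ^+ m *: d m (circ n j phi psi) =
    (-1) ^+ j.+1 *: circ n.+1 j phi (\sum_(1 <= m < q.+1) (-1) ^+ m *: d m psi).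
  rewrite -{1}[j]add0n big_addn -[1%N]add0n [in RHS]big_addn circ_sumr scaler_sumr.
  have -> : (j + q - j = q.+1 - 1)%N by lia.
  apply: eq_big_nat => m mj.
  rewrite (coface_circ_mid _ _ pq jp) ?circZr ?scalerA; last lia.
  congr (_ *: circ n.+1 j phi (d _ psi)); last lia.
  by parity.
have -> : \sum_(j + q <= m < n.+2) (-1) ^+ m *: d m (circ n j phi psi) =
    (-1) ^+ q.+1 *: circ n.+1 j (\sum_(j.+1 <= m < p.+2) (-1) ^+ m *: d m phi) psi.
  rewrite -[(j + q)%N]add0n big_addn -[j.+1]add0n [in RHS]big_addn circ_suml scaler_sumr.
  have -> : (n.+2 - (j + q) = p.+2 - j.+1)%N by lia.
  apply: eq_big_nat => m mj.
  rewrite (coface_circ_ge _ _ pq jp) ?circZl ?scalerA; last lia.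
  congr (_ *: circ n.+1 j (d _ phi) psi); last lia.
  by parity.
rewrite !scalerA.
have -> : (-1) ^+ j.+1 * (-1) ^+ q.+1 = - ((-1) ^+ q.+1 * (-1) ^+ j) :> k.
  by rewrite exprS mulN1r mulNr mulrC.
have -> : (-1) ^+ j.+1 = - (-1) ^+ j :> k by rewrite exprS mulN1r.
rewrite !scaleNr.
abelian.
Qed.

(** The part of [bd] given by the cofaces of index [a, .., b - 1]. *)
Definition dsum n a b (x : O n) : O n.+1 := \sum_(a <= m < b) (-1) ^+ m *: d m x.

Lemma dsum_cat n (x : O n) a b c : (a <= b <= c)%N -> dsum a c x = dsum a b x + dsum b c x.
Proof. by case/andP=> ab bc; rewrite /dsum (big_cat_nat ab bc). Qed.

Lemma bd_dsum n (x : O n) : bd x = dsum 0 n.+2 x. Proof. by []. Qed.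

Lemma bd_bd n (x : O n) : bd (bd x) = 0.
Proof. exact: alternating_square coface_lin coface_cofaceE n x. Qed.

(** The part of the differential of [phi] given by the cofaces of index at most [i],
    composed with [psi].  For a cocycle [psi], the differential of [phi o_(i+1) psi] is
    [upart (i+1)] minus a sign times [upart i], up to a multiple of [bd phi]; hence the
    alternating sums of these composites have telescoping differentials. *)
Definition upart p q n i (phi : O p) (psi : O q) : O n :=
  circ n i.+1 (dsum 0 i.+1 phi) psi.

Section Chain.
Variables (p q n : nat) (phi : O p) (psi : O q).
Hypotheses (pq : (p + q = n.+1)%N) (bpsi : bd psi = 0).
Local Notation U i := (upart n.+1 i phi psi).

Lemma bd_circ_step i : (i < p)%N ->
  bd (circ n i.+1 phi psi) =
    U i.+1 + (-1) ^+ q.+1 *: (circ n.+1 i.+1 (bd phi) psi - U i).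
Proof.
move=> ip; rewrite (bd_circ _ _ pq) // bpsi circ0r scaler0 addr0; congr (_ + _ *: _).
rewrite -circBl bd_dsum (@dsum_cat _ _ 0 i.+1 p.+2); last lia.
by rewrite [dsum 0 _ _ + _]addrC addrK.
Qed.

Lemma bd'_circ_step i : (i < p)%N ->
  bd' (circ n i.+1 phi psi) =
    U i.+1 + (-1) ^+ q.+1 *: (circ n.+1 i.+1 (bd' phi) psi - U i).
Proof.
move=> ip; have := bd_circ_step ip; rewrite bdE (bdE phi) circDl circZl.
rewrite (coface_circ_ge _ _ pq); [|lia|lia].
have -> : (n.+1 + 1 - q = p.+1)%N by lia.
rewrite addrAC scalerDr scalerA -exprD.
have -> : (-1) ^+ (q.+1 + p.+1) = (-1) ^+ n.+1 :> k.
  by apply: sign_congr; lia.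
by rewrite addrA => /addIr.
Qed.

Lemma bd_partial_brace s : (s <= p)%N ->
  bd (\sum_(0 <= i < s) (-1) ^+ (q.+1 * i) *: circ n i.+1 phi psi) =
  (\sum_(0 <= i < s) (-1) ^+ (q.+1 * i.+1) *: circ n.+1 i.+1 (bd phi) psi)
  + (-1) ^+ (q.+1 * s.+1) *: U s - (-1) ^+ q.+1 *: U 0.
Proof.
elim: s => [|s IHs] sp.
  by rewrite !big_nil (lin0 (@bd_lin _)) muln1 add0r subrr.
rewrite big_nat_recr //= [in RHS]big_nat_recr //= (linD (@bd_lin _)) IHs; last lia.
rewrite (linZ (@bd_lin _)) bd_circ_step // scalerDr scalerBr scalerBr !scalerA.
have -> : (-1) ^+ (q.+1 * s) * (-1) ^+ q.+1 = (-1) ^+ (q.+1 * s.+1) :> k by parity.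
have -> : (-1) ^+ (q.+1 * s) = (-1) ^+ (q.+1 * s.+2) :> k by parity.
by abelian.
Qed.

End Chain.

Lemma op_braceE p q n (phi : O p) (psi : O q) :
  op_brace n phi psi = \sum_(0 <= i < p) (-1) ^+ (q.+1 * i) *: circ n i.+1 phi psi.
Proof. by rewrite big_mkord. Qed.

(** * The operations on cochains *)

(** The cup product, with values in [O n] for [n = p + q]. *)
Definition cup p q n (phi : O p) (psi : O q) : O n := circ n 1 (d 0 phi) psi.

Lemma op_cupE p q (phi : O p) (psi : O q) : op_cup phi psi = cup (p + q) phi psi.
Proof. by []. Qed.

Section CupLinear.
Variables (p q n : nat).
Lemma cup_lin_l (psi : O q) : linear (fun phi : O p => cup n phi psi).
Proof. exact: lin_comp (coface_lin _) (circ_lin_l _ _ _). Qed.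
Lemma cup_lin_r (phi : O p) : linear (fun psi : O q => cup n phi psi).
Proof. exact: circ_lin_r. Qed.
End CupLinear.

(** The other description of the cup product, with the two factors inserted in the
    multiplication in the other order. *)
Lemma cup_last p q n (phi : O p) (psi : O q) : (p + q = n)%N ->
  cup n phi psi = circ n q.+1 (d q.+1 psi) phi.
Proof.
move=> pq; rewrite /cup coface_first coface_last.
rewrite (@circ_par _ _ oO 2 p q p.+1 q.+1 n); try lia.
by congr (circ n _ _ _); lia.
Qed.

Lemma upart0 p q n (phi : O p) (psi : O q) : upart n 0 phi psi = cup n phi psi.
Proof. by rewrite /upart /dsum big_nat1 expr0 scale1r. Qed.

Lemma upart_last p q n (phi : O p) (psi : O q) : (p + q = n)%N ->
  upart n p phi psi = circ n p.+1 (bd phi) psi + (-1) ^+ p *: cup n psi phi.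
Proof.
move=> pq; rewrite /upart (@cup_last _ _ _ psi) 1?addnC // bdE circDl circZl -addrA.
by rewrite -scalerDl exprS mulN1r addNr scale0r addr0.
Qed.

(** The cup product is a derivation of the differential. *)
Lemma bd_cup p q n (phi : O p) (psi : O q) : (p + q = n)%N ->
  bd (cup n phi psi) = cup n.+1 phi (bd psi) + (-1) ^+ q *: cup n.+1 (bd phi) psi.
Proof.
move=> pq; rewrite /cup (@bd_circ p.+1 q n 1); [|lia|lia].
rewrite big_nat_recr //= big_nat1 expr0 expr1 scale1r scaleN1r.
rewrite (@coface_cofaceE _ 0 1) // subrr circ0l add0r addrC -signr_odd /= expr0 scale1r.
congr (_ + _); rewrite big_add1 /= [in RHS]/bd (lin_sum (@coface_lin _ _)) !circ_suml.
rewrite !scaler_sumr; apply: eq_big_nat => m mp.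
rewrite coface_cofaceE; last lia.
by rewrite (linZ (@coface_lin _ _)) !circZl !scalerA; congr (_ *: _); parity.
Qed.

(** The cup product is graded commutative up to the homotopy given by the brace. *)
Lemma bd_brace p q n (phi : O p) (psi : O q) : (p + q = n.+1)%N ->
  bd phi = 0 -> bd psi = 0 ->
  bd (op_brace n phi psi) =
    (-1) ^+ q *: (cup n.+1 phi psi - (-1) ^+ (p * q) *: cup n.+1 psi phi).
Proof.
move=> pq bphi bpsi.
rewrite op_braceE (bd_partial_brace _ pq bpsi) // upart0 upart_last // bphi.
rewrite big1 => [|i _]; last by rewrite circ0l scaler0.
rewrite circ0l !add0r scalerBr !scalerA.
have -> : (-1) ^+ (q.+1 * p.+1) * (-1) ^+ p = - ((-1) ^+ q * (-1) ^+ (p * q)) :> k.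
  by rewrite -[RHS]mulN1r; parity.
by rewrite exprS mulN1r !scaleNr opprK addrC.
Qed.

Lemma cup_comm0 q (phi : O 0) (psi : O q) :
  bd phi = 0 -> cup q phi psi = cup q psi phi.
Proof.
rewrite (@cup_last _ _ _ psi) ?addn0 // /bd big_nat_recr //= big_nat1.
by rewrite expr1 scaleN1r expr0 scale1r => /subr0_eq; rewrite /cup => ->.
Qed.

Lemma cupA p q r (phi : O p) (psi : O q) (chi : O r) :
  cup (p + q + r) phi (cup (q + r) psi chi) = cup (p + q + r) (cup (p + q) phi psi) chi.
Proof.
rewrite /cup (@coface_circ_lt p.+1 q (p + q) 1) // -(@coface_cofaceE _ 0 1) //.
rewrite (@circ_coface_right p.+1 q (p + q) 1) //.
by rewrite (@circ_seq _ _ oO p.+1 q.+1 r _ (q + r) (p + q + r)); try lia.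
Qed.

Lemma cup1r p (phi : O p) : cup p phi e1 = phi.
Proof. exact: (@codegen_coface_same p 0 phi). Qed.

Lemma cup1l p (phi : O p) : cup p e1 phi = phi.
Proof. by rewrite cup_last // -[RHS](@codegen_coface_succ p p phi). Qed.

Lemma bd_unit : bd e1 = 0.
Proof.
rewrite /bd big_nat_recr //= big_nat1 expr1 scaleN1r expr0 scale1r.
by rewrite coface_first coface_last (op_mul1r mO) (op_mul1l mO) subrr.
Qed.

(** * The derivation property of the bracket *)

(** Inserting in a cup product is inserting in one of the factors. *)
Lemma brace_cup_left p q r n (phi : O p) (psi : O q) (chi : O r) :
  (p + q + r = n.+1)%N ->
  op_brace n (cup (p + q) phi psi) chi =
    cup n phi (op_brace (q + r).-1 psi chi)
    + (-1) ^+ (r.+1 * q) *: cup n (op_brace (p + r).-1 phi chi) psi.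
Proof.
move=> pqr.
rewrite !op_braceE.
rewrite (@big_cat_nat _ _ _ q) /=; [|lia|lia]; congr (_ + _).
  rewrite (lin_sum (cup_lin_r _ _)); apply: eq_big_nat => i iq.
  rewrite (linZ (cup_lin_r _ _)); congr (_ *: _); rewrite /cup.
  rewrite (@circ_seq _ _ oO p.+1 q r (p + q) (q + r).-1 n); try lia.
  by congr (circ _ _ _ (circ _ _ _ _)); lia.
rewrite -{1}[q]add0n big_addn (lin_sum (cup_lin_l _ _)) scaler_sumr.
have -> : (p + q - q = p)%N by lia.
apply: eq_big_nat => i ip.
rewrite (linZ (cup_lin_l _ _)) scalerA; congr (_ *: _); first by parity.
rewrite /cup (@coface_circ_lt p r (p + r).-1 i.+1); try lia.
rewrite (@circ_par _ _ oO p.+1 r q (p + r).-1.+1 (p + q) n i.+2 1); try lia.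
by congr (circ _ _ _ _); lia.
Qed.

Lemma cup_circ_first p q r n m l i (phi : O p) (psi : O q) (chi : O r) : (i < q)%N ->
    (p + q = m)%N -> (q + r = l.+1)%N -> (m + r = n.+1)%N ->
  circ n i.+1 (cup m phi psi) chi = cup n phi (circ l i.+1 psi chi).
Proof.
move=> iq pq qr mr; rewrite /cup (@circ_seq _ _ oO p.+1 q r m l n); try lia.
by congr (circ _ _ _ (circ _ _ _ _)); lia.
Qed.

(** A cocycle of degree [p] acts on the cup product of two cocycles as a derivation,
    up to the homotopy given by the insertion of both factors. *)
Lemma brace_cup_right p q r n (c : O p) (a : O q) (b : O r) :
  (p + q + r = n.+2)%N -> bd c = 0 -> bd a = 0 -> bd b = 0 ->
  exists h : O n, bd h =
    op_brace n.+1 c (cup (q + r) a b)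
    - cup n.+1 (op_brace (p + q).-1 c a) b
    - (-1) ^+ (p.+1 * q) *: cup n.+1 a (op_brace (p + r).-1 c b).
Proof.
move=> pqr bc ba bb.
have [p0|p_gt0] := posnP p.
  exists 0; rewrite (lin0 (@bd_lin _)); case: _ / (esym p0) c {bc pqr} => c.
  by rewrite !op_braceE !big_nil (lin0 (cup_lin_l _ _)) (lin0 (cup_lin_r _ _)) scaler0 !subr0.
pose m := (p + q).-1; pose Y j := circ m j.+1 c a; pose u j := upart m.+1 j c a.
have pq : (p + q = m.+1)%N by rewrite /m; lia.
have mr : (m + r = n.+1)%N by rewrite /m; lia.
pose S j := \sum_(0 <= i < j) (-1) ^+ (r.+1 * i.+1) *: circ n.+1 i.+1 (u j) b.
exists ((-1) ^+ r.+1 *: \sum_(0 <= j < p) (-1) ^+ (q.+1 * j) *: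
  \sum_(0 <= i < j) (-1) ^+ (r.+1 * i) *: circ n i.+1 (Y j) b).
have bY j : (j < p)%N -> bd (Y j) = u j.+1 - (-1) ^+ q.+1 *: u j.
  by move=> jp; rewrite (bd_circ_step _ pq ba) // bc circ0l sub0r scalerN.
have uY j : (j < p)%N -> upart n.+1 j (Y j) b =
    circ n.+1 j.+1 (u j.+1) b + (-1) ^+ j *: circ n.+1 j.+1 c (cup (q + r) a b).
  move=> jp; rewrite {1}/upart /u /upart (@dsum_cat _ c 0 j.+1 j.+2); last lia.
  rewrite /dsum big_nat1 !circDl circZl (circ_coface_right _ _ pq); last lia.
  rewrite circZl (@circ_seq _ _ oO p q.+1 r m.+1 (q + r) n.+1); try lia.
  have -> : (j.+1 - j.+1 + 1 = 1)%N by lia.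
  rewrite -addrA -scalerDl exprS mulN1r addNr scale0r addr0.
  congr (circ _ _ _ _); rewrite circ_suml; apply: eq_big_nat => i ij.
  by rewrite (coface_circ_lt _ _ pq) ?circZl //; lia.
have step s : (s <= p)%N ->
  bd (\sum_(0 <= j < s) (-1) ^+ (q.+1 * j) *:
      \sum_(0 <= i < j) (-1) ^+ (r.+1 * i) *: circ n i.+1 (Y j) b) =
  (-1) ^+ (q.+1 * s.+1) *: S s
  - (-1) ^+ r.+1 *: cup n.+1 (\sum_(0 <= j < s) (-1) ^+ (q.+1 * j) *: Y j) b
  + (-1) ^+ r.+1 *: \sum_(0 <= j < s) (-1) ^+ ((q + r).+1 * j) *:
      circ n.+1 j.+1 c (cup (q + r) a b).
  elim: s => [|s IHs] sp.
    by rewrite /S !big_nil (lin0 (@bd_lin _)) (lin0 (cup_lin_l _ _)) !scaler0 subr0 addr0.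
  rewrite big_nat_recr //= !(big_nat_recr s) //= (linD (@bd_lin _)) IHs; last lia.
  rewrite (linZ (@bd_lin _)) (bd_partial_brace _ mr bb); last by rewrite /m; lia.
  rewrite upart0 uY // bY //.
  have -> : \sum_(0 <= i < s) (-1) ^+ (r.+1 * i.+1) *:
       circ n.+1 i.+1 (u s.+1 - (-1) ^+ q.+1 *: u s) b =
     S s.+1 - (-1) ^+ (r.+1 * s.+1) *: circ n.+1 s.+1 (u s.+1) b - (-1) ^+ q.+1 *: S s.
    rewrite /S big_nat_recr //= addrK scaler_sumr -sumrB; apply: eq_bigr => i _.
    by rewrite circBl circZl scalerBr !scalerA [_ * (-1) ^+ q.+1]mulrC.
  rewrite (linD (cup_lin_l _ _)) (linZ (cup_lin_l _ _)) !scalerDr !scalerN !scalerA.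
  have -> : (-1) ^+ (q.+1 * s) * (-1) ^+ q.+1 = (-1) ^+ (q.+1 * s.+1) :> k by parity.
  have -> : (-1) ^+ (q.+1 * s) = (-1) ^+ (q.+1 * s.+2) :> k by parity.
  have -> : (-1) ^+ (q.+1 * s.+2) * ((-1) ^+ (r.+1 * s.+1) * (-1) ^+ s) =
    (-1) ^+ r.+1 * (-1) ^+ ((q + r).+1 * s) :> k by parity.
  have -> : (-1) ^+ (q.+1 * s.+2) * (-1) ^+ r.+1 =
    (-1) ^+ r.+1 * (-1) ^+ (q.+1 * s.+2) :> k by rewrite mulrC.
  abelian.
rewrite (linZ (@bd_lin _)) step // -!op_braceE.
have -> : S p = (-1) ^+ (p + r.+1) *: cup n.+1 a (op_brace (p + r).-1 c b).
  rewrite /S op_braceE (lin_sum (cup_lin_r _ _)) scaler_sumr; apply: eq_big_nat => i ip.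
  rewrite /u upart_last // bc circ0l add0r circZl (linZ (cup_lin_r _ _)).
  rewrite (@cup_circ_first q p r n.+1 m.+1 (p + r).-1); try lia.
  by rewrite !scalerA; congr (_ *: _); parity.
rewrite !scalerDr !scalerN !scalerA sign_sq !scale1r.
have -> : (-1) ^+ r.+1 * ((-1) ^+ (q.+1 * p.+1) * (-1) ^+ (p + r.+1)) =
    - (-1) ^+ (p.+1 * q) :> k by rewrite -[RHS]mulN1r; parity.
by rewrite scaleNr; abelian.
Qed.

(** * The Jacobi identity *)

Lemma brace_lin_l p q n (psi : O q) : linear (fun phi : O p => op_brace n phi psi).
Proof.
move=> c x y; rewrite !op_braceE scaler_sumr -big_split; apply: eq_bigr => i _ /=.
by rewrite circ_lin_l scalerDr !scalerA mulrC.
Qed.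
Lemma brace_lin_r p q n (phi : O p) : linear (fun psi : O q => op_brace n phi psi).
Proof.
move=> c x y; rewrite !op_braceE scaler_sumr -big_split; apply: eq_bigr => i _ /=.
by rewrite circ_lin_r scalerDr !scalerA mulrC.
Qed.

(** The part of [(x{y}){z}] in which [z] is inserted in [x] at an input
    of smaller index than [y]. *)
Definition brace_left p q r m n (x : O p) (y : O q) (z : O r) : O n :=
  \sum_(0 <= i < p) \sum_(0 <= j < p | (j < i)%N)
    (-1) ^+ (q.+1 * i + r.+1 * j) *: circ n j.+1 (circ m i.+1 x y) z.

(** The associator of the brace operation is graded symmetric. *)
Lemma brace_prelie p q r n (x : O p) (y : O q) (z : O r) : (p + q + r = n.+2)%N ->
  op_brace n (op_brace (p + q).-1 x y) z =
    op_brace n x (op_brace (q + r).-1 y z)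
    + brace_left (p + q).-1 n x y z
    + (-1) ^+ (q.+1 * r.+1) *: brace_left (p + r).-1 n x z y.
Proof.
move=> pqr; rewrite /brace_left.
under [X in _ + _ *: X]eq_bigr do rewrite big_mkcond.
rewrite [X in _ + _ *: X]exchange_big_nat /= scaler_sumr.
rewrite [op_brace (p + q).-1 x y]op_braceE (lin_sum (@brace_lin_l _ _ _ _)).
rewrite [op_brace n x _]op_braceE -!big_split.
apply: eq_big_nat => i ip; rewrite (linZ (@brace_lin_l _ _ _ _)) op_braceE /=.
rewrite (@big_cat_nat _ _ _ i) /=; [|lia|lia].
rewrite (@big_cat_nat _ _ _ (i + q) i (p + q).-1) /=; [|lia|lia].
rewrite !scalerDr addrA [_ + _ *: \sum_(i <= _ < _) _]addrC; congr (_ + _ + _).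
- rewrite (@big_addn _ _ _ 0 (i + q) i) op_braceE circ_sumr !scaler_sumr.
  have -> : (i + q - i = q)%N by lia.
  apply: eq_big_nat => j jq; rewrite circZr !scalerA.
  rewrite (@circ_seq _ _ oO p q r (p + q).-1 (q + r).-1 n); try lia.
  congr (_ *: circ n i.+1 x (circ (q + r).-1 _ y z)); last lia.
  rewrite -!exprD; apply: sign_congr.
  have -> : (q + r).-1.+1 = (q + r)%N by lia.
  by rewrite !(oddD, oddM, oddS); case: (odd q); case: (odd r); case: (odd i); case: (odd j).
- rewrite scaler_sumr (big_nat_widen 0 i p); last lia.
  by apply: eq_bigr => j _; rewrite scalerA -exprD.
rewrite -[in RHS]big_mkcond -(@big_nat_widenl _ _ _ i.+1 0 p xpredT) //.
rewrite -[(i + q)%N]add0n big_addn -[i.+1]add0n [in RHS]big_addn !scaler_sumr.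
have -> : ((p + q).-1 - (i + q) = p - i.+1)%N by lia.
apply: eq_big_nat => j jp; rewrite !scalerA.
rewrite (@circ_par _ _ oO p r q (p + r).-1 (p + q).-1 n); try lia.
congr (_ *: circ n _ (circ _ _ x y) z); last lia.
rewrite -!exprD; apply: sign_congr; rewrite !(oddD, oddM, oddS).
by case: (odd q); case: (odd r); case: (odd i); case: (odd j).
Qed.

Lemma bracket_lin_l p q n (y : O q) : linear (fun x : O p => op_bracket n x y).
Proof.
move=> c x x'; rewrite /op_bracket brace_lin_l brace_lin_r.
rewrite scalerDr scalerBr !scalerA [c * _]mulrC; abelian.
Qed.
Lemma bracket_lin_r p q n (x : O p) : linear (fun y : O q => op_bracket n x y).
Proof.
move=> c y y'; rewrite /op_bracket brace_lin_l brace_lin_r.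
rewrite scalerDr scalerBr !scalerA [c * _]mulrC; abelian.
Qed.

Lemma bracketC p q n (x : O p) (y : O q) :
  op_bracket n x y = - ((-1) ^+ (p.+1 * q.+1) *: op_bracket n y x).
Proof.
by rewrite /op_bracket scalerBr scalerA [(q.+1 * _)%N]mulnC sign_sq scale1r opprB.
Qed.

Lemma bracket_nested p q r n (x : O p) (y : O q) (z : O r) : (p + q + r = n.+2)%N ->
  op_bracket n x (op_bracket (q + r).-1 y z) =
    op_brace n x (op_brace (q + r).-1 y z)
    - (-1) ^+ (q.+1 * r.+1) *: op_brace n x (op_brace (q + r).-1 z y)
    - (-1) ^+ (p.+1 * (q + r)) *:
       (op_brace n (op_brace (q + r).-1 y z) x
        - (-1) ^+ (q.+1 * r.+1) *: op_brace n (op_brace (q + r).-1 z y) x).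
Proof.
move=> pqr; rewrite {1}/op_bracket /op_bracket.
have [qr0|qr_gt0] := posnP (q + r).
  have [q0 r0] : q = 0%N /\ r = 0%N by lia.
  move: qr0 pqr; subst q r => _ _.
  rewrite [op_brace _ y z]op_braceE [op_brace _ z y]op_braceE !big_nil scaler0 subr0.
  rewrite (lin0 (@brace_lin_l _ _ _ _)) (lin0 (@brace_lin_r _ _ _ _)).
  by rewrite !(scaler0, subr0).
rewrite (linB (@brace_lin_l _ _ _ _)) (linB (@brace_lin_r _ _ _ _)).
rewrite (linZ (@brace_lin_l _ _ _ _)) (linZ (@brace_lin_r _ _ _ _)).
by rewrite prednK.
Qed.

Lemma bracket_jacobi p q r n (x : O p) (y : O q) (z : O r) : (p + q + r = n.+2)%N ->
  op_bracket n x (op_bracket (q + r).-1 y z) =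
    op_bracket n (op_bracket (p + q).-1 x y) z
    + (-1) ^+ (p.+1 * q.+1) *: op_bracket n y (op_bracket (p + r).-1 x z).
Proof.
move=> pqr; rewrite [op_bracket n (op_bracket _ _ _) z]bracketC.
have -> : (-1) ^+ ((p + q).-1.+1 * r.+1) *:
    op_bracket n z (op_bracket (p + q).-1 x y) =
    (-1) ^+ ((p + q) * r.+1) *: op_bracket n z (op_bracket (p + q).-1 x y).
  have [pq0|pq_gt0] := posnP (p + q); last by rewrite prednK.
  have [p0 q0] : p = 0%N /\ q = 0%N by lia.
  move: pq0 pqr; subst p q => _ _.
  rewrite [op_bracket _ x y]/op_bracket !op_braceE !big_nil scaler0 subr0.
  by rewrite (lin0 (@bracket_lin_r _ _ _ _)) !scaler0.
rewrite !bracket_nested; try lia.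
have E1 := @brace_prelie _ _ _ _ x y z pqr.
have E2 := @brace_prelie _ _ _ n x z y ltac:(lia).
have E3 := @brace_prelie _ _ _ n y x z ltac:(lia).
have E4 := @brace_prelie _ _ _ n y z x ltac:(lia).
have E5 := @brace_prelie _ _ _ n z x y ltac:(lia).
have E6 := @brace_prelie _ _ _ n z y x ltac:(lia).
move: E1 E2 E3 E4 E5 E6; rewrite [(q + p)%N]addnC [(r + p)%N]addnC [(r + q)%N]addnC.
move=> -> -> -> -> -> ->; rewrite !sign_scale !(oddD, oddM, oddS).
by case: (odd p); case: (odd q); case: (odd r); rewrite /=; abelian.
Qed.

(** * Calculus of coboundaries *)

(** Differentials of cochains; in degree 0 only zero is one. *)
Definition coboundary n : O n -> Prop :=
  match n with
  | 0 => fun x => x = 0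
  | m.+1 => fun x => exists y : O m, x = bd y
  end.

Lemma coboundary0 n : coboundary (0 : O n).
Proof. by case: n => // n; exists 0; rewrite (lin0 (@bd_lin _)). Qed.
Lemma coboundary_lin n c (x y : O n) :
  coboundary x -> coboundary y -> coboundary (c *: x + y).
Proof.
case: n x y => [x y -> ->|n x y [x' ->] [y' ->]]; first by rewrite scaler0 addr0.
by exists (c *: x' + y'); rewrite bd_lin.
Qed.
Lemma coboundaryD n (x y : O n) : coboundary x -> coboundary y -> coboundary (x + y).
Proof. by rewrite -{2}[x]scale1r; apply: coboundary_lin. Qed.
Lemma coboundaryZ n c (x : O n) : coboundary x -> coboundary (c *: x).
Proof. by rewrite -[c *: x]addr0 => /coboundary_lin; apply; apply: coboundary0. Qed.
Lemma coboundaryN n (x : O n) : coboundary x -> coboundary (- x).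
Proof. by rewrite -scaleN1r; apply: coboundaryZ. Qed.
Lemma coboundaryB n (x y : O n) : coboundary x -> coboundary y -> coboundary (x - y).
Proof. by move=> cx /coboundaryN; apply: coboundaryD. Qed.

Lemma coboundary_bd n (x : O n) : coboundary (bd x). Proof. by exists x. Qed.

Lemma coboundary_cocycle n (x : O n) : coboundary x -> bd x = 0.
Proof.
by case: n x => [x ->|n x [y ->]]; rewrite ?bd_bd ?(lin0 (@bd_lin _)).
Qed.

Lemma cup_deg p q n (x : O p) (y : O q) : (p + q != n)%N -> cup n x y = 0.
Proof.
by move=> pq; rewrite /cup circ0 // /insertable addSn eqSS (negbTE pq) andbF.
Qed.

Lemma cocycle_cup p q n (phi : O p) (psi : O q) :
  bd phi = 0 -> bd psi = 0 -> bd (cup n phi psi) = 0.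
Proof.
have [pq|pq] := eqVneq (p + q)%N n; last first.
  by rewrite (cup_deg _ _ pq) (lin0 (@bd_lin _)).
move=> bphi bpsi; rewrite bd_cup // bphi bpsi.
by rewrite (lin0 (@cup_lin_l _ _ _ _)) (lin0 (@cup_lin_r _ _ _ _)) scaler0 addr0.
Qed.

Lemma coboundary_cup_l p q n (phi : O p) (psi : O q) :
  bd psi = 0 -> coboundary phi -> coboundary (cup n phi psi).
Proof.
have [pq|pq] := eqVneq (p + q)%N n; last first.
  by rewrite (cup_deg _ _ pq) => _ _; apply: coboundary0.
move=> bpsi; case: p phi pq => [phi _ ->|p phi pq [y ->]].
  by rewrite (lin0 (@cup_lin_l _ _ _ _)); apply: coboundary0.
case: n pq => // n [pq]; exists ((-1) ^+ q *: cup n y psi).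
rewrite (linZ (@bd_lin _)) bd_cup // bpsi (lin0 (@cup_lin_r _ _ _ _)) add0r.
by rewrite scalerA sign_sq scale1r.
Qed.

Lemma coboundary_cup_r p q n (phi : O p) (psi : O q) :
  bd phi = 0 -> coboundary psi -> coboundary (cup n phi psi).
Proof.
have [pq|pq] := eqVneq (p + q)%N n; last first.
  by rewrite (cup_deg _ _ pq) => _ _; apply: coboundary0.
move=> bphi; case: q psi pq => [psi _ ->|q psi pq [y ->]].
  by rewrite (lin0 (@cup_lin_r _ _ _ _)); apply: coboundary0.
case: n pq => [|n]; first by rewrite addnS.
rewrite addnS => -[pq]; exists (cup n phi y).
by rewrite bd_cup // bphi (lin0 (@cup_lin_l _ _ _ _)) scaler0 addr0.
Qed.

Lemma cup_commutative p q n (phi : O p) (psi : O q) : (p + q = n)%N ->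
  bd phi = 0 -> bd psi = 0 ->
  coboundary (cup n phi psi - (-1) ^+ (p * q) *: cup n psi phi).
Proof.
move=> pq bphi bpsi; case: n pq => [|n] pq.
  have [p0 q0] : p = 0%N /\ q = 0%N by lia.
  by subst p q; rewrite (cup_comm0 _ bphi) scale1r subrr.
exists ((-1) ^+ q *: op_brace n phi psi).
by rewrite (linZ (@bd_lin _)) bd_brace // scalerA sign_sq scale1r.
Qed.

Lemma bracket_leibniz p q r n (c : O p) (a : O q) (b : O r) :
  (p + q + r = n.+1)%N -> bd c = 0 -> bd a = 0 -> bd b = 0 ->
  coboundary (op_bracket n c (cup (q + r) a b)
    - cup n (op_bracket (p + q).-1 c a) b
    - (-1) ^+ (p.+1 * q) *: cup n a (op_bracket (p + r).-1 c b)).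
Proof.
move=> pqr bc ba bb; rewrite /op_bracket (@brace_cup_left q r p n a b c); last lia.
rewrite (linB (@cup_lin_l _ _ _ _)) (linB (@cup_lin_r _ _ _ _)).
rewrite (linZ (@cup_lin_l _ _ _ _)) (linZ (@cup_lin_r _ _ _ _)).
rewrite [(r + p)%N]addnC [(q + p)%N]addnC !(scalerDr, scalerN) !scalerA.
have -> : (-1) ^+ (p.+1 * (q + r).+1) * (-1) ^+ (p.+1 * r) = (-1) ^+ (p.+1 * q.+1) :> k.
  by parity.
have -> : (-1) ^+ (p.+1 * q) * (-1) ^+ (p.+1 * r.+1) = (-1) ^+ (p.+1 * (q + r).+1) :> k.
  by parity.
set x := op_brace n c _; set y := cup n (op_brace _ c a) b; set z := cup n a (op_brace _ c b).
suff : coboundary (x - y - (-1) ^+ (p.+1 * q) *: z) by congr (coboundary _); abelian.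
rewrite /x /y /z; case: n pqr {x y z} => [|n] pqr; last first.
  by have [h <-] := brace_cup_right pqr bc ba bb; apply: coboundary_bd.
have [p0|p_gt0] := posnP p.
  subst p; rewrite !op_braceE !big_nil.
  by rewrite (lin0 (@cup_lin_l _ _ _ _)) (lin0 (@cup_lin_r _ _ _ _)) scaler0 !subr0.
have [p1 [q0 r0]] : p = 1%N /\ q = 0%N /\ r = 0%N by lia.
(* in degree 0, the vanishing of the differential of [c] is the product rule *)
subst p q r; rewrite !op_braceE !big_nat1 muln0 expr0 !scale1r /= -[RHS]oppr0.
have := congr1 (fun x => circ 0 1 (circ 1 2 x a) b) bc; rewrite !circ0l => <-.
rewrite bd_dsum /dsum !big_nat_recr //= big_nil add0r expr0 scale1r expr1 scaleN1r.
rewrite -signr_odd /= expr0 scale1r !(circDl, circNl).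
rewrite (@circ_coface_right 1 0 0 1) // (@circ_seq _ _ oO 1 1 0 1 0 0) //.
rewrite -(@coface_circ_lt 1 0 0 1) //.
rewrite (@cup_last 0 0 0 a (circ 0 1 c b)) // (@coface_circ_ge 1 0 0 1 c b _ _ 1) //.
rewrite (@circ_par _ _ oO 2 0 0 1 1 0 2 1) //.
rewrite /cup /=. abelian.
Qed.

(** * Para-cyclic operads *)

Section ParaCyclic.
Variable tau : forall n, O n -> O n.
Hypothesis pO : is_para_cyclic_operad (@tau).
Hypothesis tau_mul : tau mu = mu.

(** A para-cyclic operad with multiplication is a para-cocyclic module, except that
    the operad axioms do not say how [tau] acts on a composite with a cochain of
    degree 0, such as the unit, in the input of index 1. *)
Lemma operad_para_cocyclic :
  (forall x : O 0, tau (d 1 x) = d 0 (tau x)) ->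
  (forall n (x : O n.+1), tau (s 0 x) = s n (tau (tau x))) ->
  is_para_cocyclic (@coface k O) (@codegen k O) (@tau).
Proof.
move=> tau_d1 tau_s0; split=> //.
- exact: operad_cosimplicial.
- by move=> n; apply: tau_linear pO n.
- move=> n i x i_in; have [n0|n_gt0] := posnP n.
    by subst n; have -> : i = 1%N by lia.
  have [->|i_n] := eqVneq i n.+1.
    by rewrite coface_last (tau_circ1 pO) /= ?tau_mul ?coface_mid; try lia.
  rewrite coface_mid; last lia.
  have [i1|i1] := eqVneq i 1%N.
    by rewrite i1 (tau_circ1 pO) /= ?tau_mul ?coface_first; try lia.
  by rewrite (tau_circ pO) /= ?coface_mid; try lia.
- by move=> n x; rewrite coface_first coface_last (tau_circ pO) ?tau_mul; try lia.
- by move=> n i x i_in; rewrite /codegen (tau_circ pO) /= ?prednK; try lia.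
Qed.

(** * Connes' operator *)

Section Cyclic.
Hypothesis coO : is_cocyclic (@coface k O) (@codegen k O) (@tau).
Local Notation pcO := (proj1 coO).

Lemma tau_lin n : linear (@tau n). Proof. exact: tau_linear pO n. Qed.
Lemma tau_order n (x : O n) : iter n.+1 (@tau n) x = x. Proof. exact: (proj2 coO). Qed.

(** The rotation with its sign. *)
Definition srot n (x : O n) : O n := (-1) ^+ n *: tau x.

Lemma srot_lin n : linear (@srot n).
Proof. by move=> c x y; rewrite /srot tau_lin scalerDr !scalerA [c * _]mulrC. Qed.

Lemma iter_srotE n i (x : O n) : iter i (@srot n) x = (-1) ^+ (n * i) *: iter i (@tau n) x.
Proof.
elim: i => [|i IHi]; first by rewrite muln0 scale1r.
by rewrite !iterS IHi /srot (linZ (@tau_lin n)) scalerA; congr (_ *: _); parity.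
Qed.

Lemma srot_order n (x : O n) : iter n.+1 (@srot n) x = x.
Proof.
by rewrite iter_srotE tau_order -signr_odd oddM oddS andbN scale1r.
Qed.

Lemma iter_srot_lin n i : linear (iter i (@srot n)). Proof. exact: lin_iter (@srot_lin n). Qed.

(** The sum of the first [j] powers of the rotation. *)
Definition psum n j (x : O n) : O n := \sum_(0 <= i < j) iter i (@srot n) x.

Lemma psum_lin n j : linear (@psum n j).
Proof.
move=> c x y; rewrite /psum scaler_sumr -big_split; apply: eq_bigr => i _ /=.
exact: iter_srot_lin.
Qed.

Lemma psum0 n (x : O n) : psum 0 x = 0. Proof. by rewrite /psum big_nil. Qed.
Lemma psumS n j (x : O n) : psum j.+1 x = psum j x + iter j (@srot n) x.
Proof. by rewrite /psum big_nat_recr. Qed.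

Lemma psum_srot n j (x : O n) : psum j (srot x) = psum j.+1 x - x.
Proof.
rewrite /psum big_nat_recl //= addrAC subrr add0r; apply: eq_bigr => i _.
by rewrite -iterSr.
Qed.

(** The norm is invariant under rotation. *)
Lemma norm_srot n (x : O n) : psum n.+1 (srot x) = psum n.+1 x.
Proof. by rewrite psum_srot psumS srot_order addrK. Qed.

Lemma norm_iter_srot n i (x : O n) : psum n.+1 (iter i (@srot n) x) = psum n.+1 x.
Proof. by elim: i => //= i IHi; rewrite norm_srot. Qed.

Lemma norm_iter_tau n i (x : O n) :
  psum n.+1 (iter i (@tau n) x) = (-1) ^+ (n * i) *: psum n.+1 x.
Proof.
rewrite -[in RHS](norm_iter_srot i) iter_srotE (linZ (@psum_lin _ _)) scalerA sign_sq.
by rewrite scale1r.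
Qed.

Lemma psum_add n i j (x : O n) : psum (i + j) x = psum i x + iter i (@srot n) (psum j x).
Proof.
elim: j => [|j IHj].
  by rewrite addn0 psum0 (lin0 (@iter_srot_lin _ _)) addr0.
by rewrite addnS !psumS IHj (linD (@iter_srot_lin _ _)) -addrA -iterD.
Qed.

Lemma coface_srot n m (x : O n) : (0 < m <= n.+1)%N -> srot (d m x) = - d m.-1 (srot x).
Proof.
move=> m_in; rewrite /srot (cocyclic_coface pcO) //.
by rewrite (linZ (@coface_lin _ _)) exprS mulN1r scaleNr.
Qed.

Lemma coface0_srot n (x : O n) : srot (d 0 x) = (-1) ^+ n.+1 *: d n.+1 x.
Proof. by rewrite /srot (cocyclic_coface0 pcO). Qed.

Lemma coface_iter_srot n m i (x : O n) : (m + i <= n.+1)%N ->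
  d m (iter i (@srot n) x) = (-1) ^+ i *: iter i (@srot _) (d (m + i) x).
Proof.
elim: i m => [|i IHi] m mi; first by rewrite addn0 scale1r.
have -> : d m (iter i.+1 (@srot n) x) = - srot (d m.+1 (iter i (@srot n) x)).
  by rewrite coface_srot ?opprK //; lia.
rewrite IHi ?addnS -?addSn; last lia.
by rewrite (linZ (@srot_lin _)) exprS mulN1r scaleNr addSn.
Qed.

(** How the differential commutes with a power of the rotation. *)
Lemma bd_iter_srot n i (x : O n) : (i <= n.+1)%N ->
  bd (iter i (@srot n) x) =
    iter i (@srot _) (bd' x) + iter i.+1 (@srot _) (dsum 0 i.+1 x)
    - iter i (@srot _) (dsum 0 i x).
Proof.
have bd_srot (y : O n) : bd (srot y) = srot (bd y) - srot (d 0 y) - srot (srot (d 1 y)).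
  rewrite (@coface_srot _ 1) //= (linN (@srot_lin _)) opprK.
  rewrite [srot (d 0 (srot y))]coface0_srot [bd (srot y)]bdE.
  congr (_ + _).
  rewrite -(linB (@srot_lin _)) /bd big_ltn // expr0 scale1r addrAC subrr add0r.
  rewrite (lin_sum (@srot_lin _)) big_add1 /bd'; apply: eq_big_nat => m mn.
  rewrite (linZ (@srot_lin _)) coface_srot; last lia.
  by rewrite exprS mulN1r scaleNr scalerN opprK.
elim: i => [|i IHi] i_n.
  by rewrite /= /dsum big_nat1 big_nil subr0 expr0 scale1r coface0_srot -bdE.
rewrite iterS bd_srot IHi; last lia.
have E m : (m <= 1)%N -> d m (iter i (@srot n) x) =
    iter i (@srot _) ((-1) ^+ i *: d (m + i) x).
  by move=> m1; rewrite coface_iter_srot ?(linZ (@iter_srot_lin _ _)) //; lia.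
have dsumS j : dsum 0 j.+1 x = dsum 0 j x + (-1) ^+ j *: d j x.
  by rewrite /dsum big_nat_recr.
rewrite !E // add0n add1n !iterS (dsumS i.+1) (dsumS i).
rewrite !(linD (@iter_srot_lin _ _), linB (@srot_lin _), linD (@srot_lin _)).
rewrite exprS mulN1r !scaleNr !(linN (@iter_srot_lin _ _)) !(linN (@srot_lin _)).
abelian.
Qed.

Lemma bd_psum n j (x : O n) : (j <= n.+2)%N ->
  bd (psum j x) = psum j (bd' x) + iter j (@srot _) (dsum 0 j x).
Proof.
elim: j => [|j IHj] jn.
  by rewrite /psum /dsum !big_nil (lin0 (@bd_lin _)) addr0.
rewrite !psumS (linD (@bd_lin _)) IHj; last lia.
by rewrite bd_iter_srot; [abelian | lia].
Qed.

Lemma bd_norm n (x : O n) : bd (psum n.+1 x) = psum n.+2 (bd' x).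
Proof. by rewrite bd_psum // [in RHS]psumS. Qed.

(** The unit put in the output of a cochain, which one rotation makes an input. *)
Definition plug m n (x : O m) : O n := circ n m (tau x) e1.
(** Connes' operator, up to a sign and without its degenerate part: the sum of all
    rotations of [plug].  It takes values in [O n] for every [n], and is zero unless
    [m = n + 1]. *)
Definition bplus m n (x : O m) : O n := psum n.+1 (plug n x).

Lemma plug_lin m n : linear (@plug m n).
Proof. exact: lin_comp (@tau_lin _) (circ_lin_l _ _ _). Qed.
Lemma bplus_lin m n : linear (@bplus m n).
Proof. exact: lin_comp (@plug_lin _ _) (@psum_lin _ _). Qed.

Lemma plugE n (x : O n.+1) : plug n x = s n (tau x). Proof. by []. Qed.

(** Up to the rotation, [plug] is a contraction of the truncated differential. *)
Lemma plug_bd n (x : O n.+1) : plug n.+1 (bd x) = x - bd' (plug n x) - srot x.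
Proof.
rewrite plugE /bd (lin_sum (@tau_lin _)) (lin_sum (@codegen_lin _ _)).
rewrite big_ltn // big_nat_recr //= expr0 scale1r (cocyclic_coface0 pcO).
rewrite codegen_coface_succ //.
rewrite (linZ (@tau_lin _)) (linZ (@codegen_lin _ _)) (cocyclic_coface pcO) //=.
rewrite codegen_coface_same // /srot exprS mulN1r scaleNr -addrA; congr (_ + (_ - _)).
rewrite big_add1 /= plugE /bd' -sumrN; apply: eq_big_nat => m mn.
rewrite (linZ (@tau_lin _)) (linZ (@codegen_lin _ _)) (cocyclic_coface pcO) //=; last lia.
by rewrite codegen_coface_ltE ?exprS ?mulN1r ?scaleNr //; lia.
Qed.

Lemma bplus_bd n (x : O n.+1) : bplus n.+1 (bd x) = - bd (bplus n x).
Proof.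
rewrite /bplus plug_bd bd_norm (linB (@psum_lin _ _)) (linB (@psum_lin _ _)).
by rewrite norm_srot addrAC subrr add0r.
Qed.

(** The homotopy between the brace of two cocycles and the terms of Connes' operator.
    Its summands have the unit in the output of [phi] and [psi] in an input; they are
    the rotations of [plug r phi o_(j+1) psi] that come before the one carrying [psi] to
    the output. *)
Lemma bd_bplus_brace r q n (phi : O r.+1) (psi : O q) : (r + q = n.+1)%N ->
  bd phi = 0 -> bd psi = 0 ->
  exists h : O n, bd h =
    op_brace n.+1 phi psi - cup n.+1 (bplus r phi) psi
    - (-1) ^+ (q.+1 * r) *: psum r.+1 (circ n.+1 r.+1 (srot phi) psi).
Proof.
move=> rq bphi bpsi; pose chi := plug r phi.
pose u j := upart n.+1 j chi psi; pose W j := circ n.+1 j.+1 (bd' chi) psi.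
exists ((-1) ^+ q.+1 *: \sum_(0 <= j < r) (-1) ^+ (q.+1 * j) *:
  psum j.+1 (circ n j.+1 chi psi)).
have bchi : bd' chi = phi - srot phi.
  have := plug_bd phi; rewrite bphi (lin0 (@plug_lin _ _)) => /eqP.
  by rewrite eq_sym subr_eq0 subr_eq addrC -subr_eq => /eqP <-.
have dX j : (j < r)%N -> dsum 0 j.+1 (circ n j.+1 chi psi) =
    u j.+1 + (-1) ^+ j *: circ n.+1 j.+1 chi (d 0 psi).
  move=> jr; rewrite /u /upart (@dsum_cat _ chi 0 j.+1 j.+2); last lia.
  rewrite {3}/dsum big_nat1 !circDl circZl (circ_coface_right _ _ rq); last lia.
  rewrite -addrA -scalerDl exprS mulN1r addNr scale0r addr0 /dsum circ_suml.
  by apply: eq_big_nat => i ij; rewrite (coface_circ_lt _ _ rq) ?circZl //; lia.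
have rotX j : (j < r)%N ->
    iter j.+1 (@srot n.+1) (circ n.+1 j.+1 chi (d 0 psi)) =
    (-1) ^+ (q * j.+1) *: cup n.+1 (iter j.+1 (@srot _) chi) psi.
  move=> jr; have tauX l : (l <= j)%N ->
      iter l (@tau _) (circ n.+1 j.+1 chi (d 0 psi)) =
      circ n.+1 (j.+1 - l) (iter l (@tau _) chi) (d 0 psi).
    elim: l => [|l IHl] lj; first by rewrite subn0.
    rewrite !iterS IHl ?(tau_circ pO); try lia.
    by congr (circ _ _ _ _); lia.
  rewrite !iter_srotE iterS tauX // subSnn (tau_circ1 pO); try lia.
  rewrite (cocyclic_coface0 pcO) -iterS (linZ (cup_lin_l _ _)) cup_last; last lia.
  by rewrite !scalerA; congr (_ *: _); rewrite -rq; parity.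
have step j : (j <= r)%N ->
  bd (\sum_(0 <= i < j) (-1) ^+ (q.+1 * i) *: psum i.+1 (circ n i.+1 chi psi)) =
  (-1) ^+ (q.+1 * j.+1) *: psum j.+1 (u j)
  - (-1) ^+ q.+1 *: cup n.+1 (psum j.+1 chi) psi
  + \sum_(0 <= i < j) (-1) ^+ (q.+1 * i.+1) *: psum i.+1 (W i).
  elim: j => [|j IHj] jr.
    rewrite !big_nil (lin0 (@bd_lin _)) addr0 muln1 /psum !big_nat1 /= /u upart0.
    by rewrite subrr.
  rewrite big_nat_recr //= (big_nat_recr j) //= (linD (@bd_lin _)) IHj; last lia.
  rewrite (linZ (@bd_lin _)) bd_psum ?dX //; last by move: rq; lia.
  rewrite (bd'_circ_step _ rq bpsi) // -/(W j) -!/(u _).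
  rewrite (psumS j.+1) (linD (@psum_lin _ _)) (linZ (@psum_lin _ _)).
  rewrite (linB (@psum_lin _ _)) (linD (@iter_srot_lin _ _)) (linZ (@iter_srot_lin _ _)).
  rewrite rotX // (psumS j.+1) (linD (cup_lin_l _ _)).
  move: (iter j.+1 _ (u j.+1)) (iter j.+1 _ chi) => y z.
  rewrite !(scalerDr, scalerN) !scalerA.
  have -> : (-1) ^+ (q.+1 * j) * (-1) ^+ q.+1 = (-1) ^+ (q.+1 * j.+1) :> k by parity.
  have -> : (-1) ^+ (q.+1 * j) = (-1) ^+ (q.+1 * j.+2) :> k by parity.
  have -> : (-1) ^+ (q.+1 * j.+2) * (-1) ^+ j * (-1) ^+ (q * j.+1) = - (-1) ^+ q.+1 :> k.
    by rewrite -[RHS]mulN1r; parity.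
  by rewrite scaleNr; abelian.
have stepW j : (j <= r)%N ->
  \sum_(0 <= i < j.+1) (-1) ^+ (q.+1 * i.+1) *: psum i.+1 (W i) =
  (-1) ^+ q.+1 *: (\sum_(0 <= i < j.+1) (-1) ^+ (q.+1 * i) *: circ n.+1 i.+1 phi psi)
  - (-1) ^+ (q.+1 * j.+1) *: psum j.+1 (circ n.+1 j.+1 (srot phi) psi).
  elim: j => [|j IHj] jr.
    rewrite !big_nat1 muln0 expr0 scale1r muln1 /psum !big_nat1 /= /W bchi circBl.
    exact: scalerBr.
  rewrite big_nat_recr //= IHj; last lia.
  rewrite [in RHS]big_nat_recr //= /W bchi circBl (linB (@psum_lin _ _)).
  have -> : psum j.+1 (circ n.+1 j.+1 (srot phi) psi) =
      (-1) ^+ q.+1 *: (psum j.+2 (circ n.+1 j.+2 phi psi) - circ n.+1 j.+2 phi psi).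
    rewrite -psum_srot -(linZ (@psum_lin _ _)); congr (psum _ _).
    rewrite /srot circZl (tau_circ pO) /= ?scalerA; try lia.
    by congr (_ *: _); rewrite -rq; parity.
  rewrite !(scalerDr, scalerN) !scalerA.
  have -> : (-1) ^+ (q.+1 * j.+1) * (-1) ^+ q.+1 = (-1) ^+ (q.+1 * j.+2) :> k by parity.
  have -> : (-1) ^+ q.+1 * (-1) ^+ (q.+1 * j.+1) = (-1) ^+ (q.+1 * j.+2) :> k by parity.
  by abelian.
have uW : u r = W r by [].
rewrite (linZ (@bd_lin _)) step // uW addrAC addrC -[_ *: psum _ _ + _]addrC.
have -> : \sum_(0 <= i < r) (-1) ^+ (q.+1 * i.+1) *: psum i.+1 (W i) +
    (-1) ^+ (q.+1 * r.+1) *: psum r.+1 (W r) =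
  \sum_(0 <= i < r.+1) (-1) ^+ (q.+1 * i.+1) *: psum i.+1 (W i) by rewrite big_nat_recr.
rewrite stepW // -op_braceE -/(bplus r phi) !(scalerDr, scalerN) !scalerA sign_sq !scale1r.
have -> : (-1) ^+ q.+1 * (-1) ^+ (q.+1 * r.+1) = (-1) ^+ (q.+1 * r) :> k by parity.
abelian.
Qed.

Lemma iter_srot_psum n i j (x : O n) :
  iter i (@srot n) (psum j x) = psum j (iter i (@srot n) x).
Proof.
rewrite /psum (lin_sum (@iter_srot_lin _ _)); apply: eq_bigr => l _.
by rewrite -!iterD addnC.
Qed.

(** The part of Connes' operator on a product in which the output is an input of
    the first factor. *)
Definition conn_half p q n (phi : O p) (psi : O q) : O n :=
  psum p (circ n p (srot phi) psi).

(** The unit in the output of a product cancels the multiplication and joins the outputs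
    of the two factors. *)
Lemma plug_cup_pos p q n (phi : O p) (psi : O q) : (p + q = n.+1)%N -> (0 < q)%N ->
  plug n (cup (p + q) phi psi) = circ n q (tau psi) phi.
Proof.
move=> pq q_gt0; rewrite /plug /cup (tau_circ1 pO) ?(cocyclic_coface0 pcO); try lia.
rewrite (@circ_seq _ _ oO q p.+1 0 (p + q) p n); try lia.
congr (circ _ _ _ _); rewrite -[RHS](@codegen_coface_succ p p phi) // /codegen.
by congr (circ _ _ _ _); lia.
Qed.

Lemma plug_cup0 p n (phi : O p) (psi : O 0) : (p = n.+1)%N ->
  plug n (cup (p + 0) phi psi) = circ n p (tau phi) psi.
Proof.
move=> pn; rewrite /plug cup_last // (tau_circ1 pO) ?(cocyclic_coface pcO); try lia.
have -> : tau psi = psi by exact: (tau_order psi).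
rewrite (@circ_seq _ _ oO p 1 0 (p + 0) 0 n); try lia.
congr (circ _ _ _ _); rewrite -[RHS](@codegen_coface_same 0 0 psi) // /codegen.
by congr (circ _ _ _ _); lia.
Qed.

(** Connes' operator on a product: the output is an input of one of the two factors. *)
Lemma bplus_cup p q n (phi : O p) (psi : O q) : (p + q = n.+1)%N ->
  bplus n (cup (p + q) phi psi) =
    (-1) ^+ q *: conn_half n psi phi + (-1) ^+ (p * q + p) *: conn_half n phi psi.
Proof.
have tauE m (x : O m) : tau x = (-1) ^+ m *: srot x.
  by rewrite /srot scalerA sign_sq scale1r.
move=> pq; rewrite /bplus /conn_half; have [q0|q_gt0] := posnP q.
  subst q; rewrite plug_cup0; last lia.
  rewrite psum0 scaler0 add0r tauE circZl (linZ (@psum_lin _ _)) muln0.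
  by congr (_ *: psum _ _); lia.
rewrite plug_cup_pos // -pq addnC psum_add iter_srot_psum.
rewrite [in psum q _]tauE circZl (linZ (@psum_lin _ _)); congr (_ + _).
have [p0|p_gt0] := posnP p; first by subst p; rewrite !psum0 scaler0.
have tauX l : (l < q)%N -> iter l (@tau _) (circ n q (tau psi) phi) =
    circ n (q - l) (iter l.+1 (@tau _) psi) phi.
  elim: l => [|l IHl] lq; first by rewrite subn0.
  rewrite 2!iterS IHl ?(tau_circ pO) -?iterS; try lia.
  by congr (circ _ _ _ _); lia.
rewrite iter_srotE -[X in iter X (@tau _)](prednK q_gt0) iterS tauX; last lia.
have -> : (q - q.-1 = 1)%N by lia.
rewrite (tau_circ1 pO) ?prednK //; last lia.
rewrite -iterS tau_order tauE circZl scalerA (linZ (@psum_lin _ _)).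
congr (_ *: _); rewrite -exprD; apply: sign_congr.
rewrite !(oddD, oddM); have -> : odd n = ~~ (odd p (+) odd q) by rewrite -oddD pq negbK.
by case: (odd p); case: (odd q).
Qed.

(** * Comparison with the operator of the cocyclic module *)

Lemma tau_invK n : cancel (@tau_inv k O (@tau) n) (@tau n).
Proof. by move=> x; rewrite /tau_inv -iterS tau_order. Qed.

Lemma lambdaE n (x : O n) : lambda (@tau) x = iter n (@srot n) x.
Proof. by rewrite /lambda iter_srotE; congr (_ *: _); apply: sign_congr; rewrite oddM andbb. Qed.

Lemma lambda_norm n (x : O n) :
  \sum_(i < n.+1) iter i (@lambda k O (@tau) n) x = psum n.+1 x.
Proof.
have lam_srot i (y : O n) : iter i (lambda (@tau) (n:=n)) (iter i (@srot n) y) = y.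
  elim: i y => //= i IHi y; rewrite -[RHS](IHi y) -iterS iterSr lambdaE -iterSr.
  by rewrite srot_order.
rewrite -(big_mkord xpredT (fun i => iter i _ x)) /psum.
rewrite big_nat_recl // [in RHS]big_nat_recl //; congr (_ + _).
rewrite big_nat_rev add0n; apply: eq_big_nat => i i_n.
rewrite -[in LHS](srot_order x).
have -> : n.+1 = ((n - i.+1).+1 + i.+1)%N by lia.
by rewrite iterD lam_srot.
Qed.

Lemma connesE n (x : O n.+1) :
  connes (@tau) x = (-1) ^+ n *: (bplus n x - bplus n (lambda (@tau) x)).
Proof.
have plugI (y : O n.+1) : psum n.+1 (s 0 (tau_inv (@tau) y)) = (-1) ^+ n *: bplus n y.
  rewrite /bplus plugE -[in RHS](tau_invK y) -(cocyclic_codegen0 pcO).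
  by rewrite (norm_iter_tau 1) muln1 scalerA sign_sq scale1r.
rewrite /connes lambda_norm plugI; congr (_ *: _).
exact: (linB (@bplus_lin _ _)).
Qed.

(** [connes] starts with [1 - lambda], which kills the norm. *)
Lemma connes_bplus n (x : O n.+2) : connes (@tau) (bplus n.+1 x) = 0.
Proof. by rewrite connesE lambdaE /bplus iter_srot_psum norm_iter_srot subrr scaler0. Qed.

(** The last codegeneracy is a contraction of the truncated differential, and the norm
    carries the truncated differential to the differential. *)
Lemma norm_coboundary n (x : O n) : bd' x = 0 -> coboundary (psum n.+1 x).
Proof.
case: n x => [|n] x b'x.
  suff -> : x = 0 by rewrite (lin0 (@psum_lin _ _)).
  move: b'x; rewrite /bd' big_nat1 expr0 scale1r => d0x.
  by rewrite -(@codegen_coface_same 0 0 x) // d0x (lin0 (@codegen_lin _ _)).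
have sb' : s n.+1 (bd' x) = bd' (s n x) + (-1) ^+ n.+1 *: x.
  rewrite /bd' (lin_sum (@codegen_lin _ _)) big_nat_recr //=.
  rewrite (linZ (@codegen_lin _ _)) codegen_coface_same //; congr (_ + _).
  apply: eq_big_nat => m mn.
  by rewrite (linZ (@codegen_lin _ _)) codegen_coface_ltE //; lia.
have -> : x = (-1) ^+ n *: bd' (s n x).
  move/eqP: sb'; rewrite b'x (lin0 (@codegen_lin _ _)) eq_sym addr_eq0 => /eqP ->.
  by rewrite exprS mulN1r scaleNr opprK scalerA sign_sq scale1r.
exists ((-1) ^+ n *: psum n.+1 (s n x)).
by rewrite (linZ (@bd_lin _)) bd_norm (linZ (@psum_lin _ _)).
Qed.

(** The two operators differ by the norm of the last codegeneracy of a cocycle. *)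
Lemma connes_cohomologous n (x : O n.+1) : bd x = 0 ->
  coboundary (connes (@tau) x - (-1) ^+ n *: bplus n x).
Proof.
move=> bx; rewrite connesE scalerBr addrAC subrr add0r.
apply/coboundaryN/coboundaryZ.
rewrite /bplus plugE /lambda (linZ (@tau_lin _)) tau_invK.
rewrite (linZ (@codegen_lin _ _)) (linZ (@psum_lin _ _)).
apply/coboundaryZ/norm_coboundary.
transitivity (s n.+1 (bd x)); last by rewrite bx (lin0 (@codegen_lin _ _)).
rewrite /bd (lin_sum (@codegen_lin _ _)) big_nat_recr // big_nat_recr //=.
rewrite !(linZ (@codegen_lin _ _)) codegen_coface_same // codegen_coface_succ //.
rewrite -addrA -scalerDl [(-1) ^+ n.+2]exprS mulN1r addrN scale0r addr0.
apply: eq_big_nat => m mn.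
by rewrite (linZ (@codegen_lin _ _)) codegen_coface_ltE //; lia.
Qed.

(** * The Batalin-Vilkovisky identity *)

Lemma bplus_deg m n (x : O m) : (m != n.+1)%N -> bplus n x = 0.
Proof.
move=> mn; rewrite /bplus /plug circ0 ?(lin0 (@psum_lin _ _)) //.
by rewrite /insertable addn0; case: (m == n.+1) mn => //; rewrite andbF.
Qed.

Lemma cocycle_bplus m n (x : O m) : bd x = 0 -> bd (bplus n x) = 0.
Proof.
have [mn|mn] := eqVneq m n.+1; last by rewrite (bplus_deg _ mn) (lin0 (@bd_lin _)).
subst m => bx; apply/eqP; rewrite -oppr_eq0 -bplus_bd bx.
by rewrite (lin0 (@bplus_lin _ _)).
Qed.

Lemma coboundary_bplus m n (x : O m) : coboundary x -> coboundary (bplus n x).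
Proof.
have [mn|mn] := eqVneq m n.+1; last by rewrite (bplus_deg _ mn) => _; apply: coboundary0.
subst m; case: n x => [|n] x [y ->] {x}; last first.
  by rewrite bplus_bd; apply/coboundaryN/coboundary_bd.
rewrite /coboundary /bplus plugE /bd big_nat_recr //= big_nat1 expr0 scale1r scaleN1r.
rewrite (linB (@tau_lin _)) (cocyclic_coface0 pcO) (cocyclic_coface pcO) //=.
rewrite (linB (@codegen_lin _ _)) codegen_coface_succ // codegen_coface_same //.
have -> : tau y = y by exact: (tau_order y).
by rewrite subrr (lin0 (@psum_lin _ _)).
Qed.

Lemma bplus_bplus l m n (x : O l) : bd x = 0 -> coboundary (bplus n (bplus m x)).
Proof.
have [mn|mn] := eqVneq m n.+1; last by rewrite (bplus_deg _ mn) => _; apply: coboundary0.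
have [lm|lm] := eqVneq l m.+1; last first.
  by rewrite (bplus_deg _ lm) (lin0 (@bplus_lin _ _)) => _; apply: coboundary0.
subst m l => bx; have := connes_cohomologous (cocycle_bplus n.+1 bx).
by rewrite connes_bplus sub0r -scaleNr => /(coboundaryZ ((-1) ^+ n.+1));
  rewrite exprS mulN1r scalerA mulrNN sign_sq scale1r.
Qed.

Lemma brace_conn_half p q n (phi : O p) (psi : O q) : (p + q = n.+1)%N ->
  bd phi = 0 -> bd psi = 0 ->
  coboundary (op_brace n phi psi - cup n (bplus p.-1 phi) psi
    - (-1) ^+ (q.+1 * p.+1) *: conn_half n phi psi).
Proof.
case: p phi => [|r] phi pq bphi bpsi.
  rewrite op_braceE big_nil bplus_deg // (lin0 (@cup_lin_l _ _ _ _)).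
  by rewrite /conn_half psum0 scaler0 !subr0; apply: coboundary0.
have -> : (-1) ^+ (q.+1 * r.+2) = (-1) ^+ (q.+1 * r) :> k by parity.
case: n pq => [|n] [rq]; last first.
  by have [h <-] := bd_bplus_brace rq bphi bpsi; apply: coboundary_bd.
have [r0 q0] : r = 0%N /\ q = 0%N by lia.
subst r q; rewrite op_braceE big_nat1 /conn_half /bplus /psum !big_nat1 muln0 expr0 !scale1r /=.
have /eqP := plug_bd phi; rewrite bphi (lin0 (@plug_lin _ _)) eq_sym subr_eq0 => /eqP <-.
by rewrite circBl /bd' big_nat1 expr0 scale1r /cup /=; abelian.
Qed.

(** Connes' operator with the sign of the cocyclic module. *)
Definition bconn m n (x : O m) : O n := (-1) ^+ n *: bplus n x.

(** The Batalin-Vilkovisky identity up to coboundaries.  By [brace_conn_half], each of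
    the two braces in the bracket is one of the two parts of Connes' operator on the
    product, up to a cup product. *)
Lemma bracket_bv p q n (phi : O p) (psi : O q) : (p + q = n.+1)%N ->
  bd phi = 0 -> bd psi = 0 ->
  coboundary (op_bracket n phi psi
    - (-1) ^+ p *: (bconn n (cup (p + q) phi psi) - cup n (bconn p.-1 phi) psi
                    - (-1) ^+ p *: cup n phi (bconn q.-1 psi))).
Proof.
move=> pq bphi bpsi.
have qp : (q + p = n.+1)%N by rewrite addnC.
have pred_sign m (x : O m) : (-1) ^+ m.-1 *: bplus m.-1 x = - ((-1) ^+ m *: bplus m.-1 x).
  case: m x => [|m] x; first by rewrite bplus_deg // !scaler0 oppr0.
  by rewrite exprS mulN1r scaleNr opprK.
have comm : coboundary (cup n phi (bplus q.-1 psi)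
    + (-1) ^+ (p * q + p.+1) *: cup n (bplus q.-1 psi) phi).
  have [q0|q_gt0] := posnP q.
    subst q; rewrite bplus_deg // (lin0 (@cup_lin_l _ _ _ _)) (lin0 (@cup_lin_r _ _ _ _)).
    by rewrite scaler0 addr0; apply: coboundary0.
  have -> : (-1) ^+ (p * q + p.+1) = - (-1) ^+ (p * q.-1) :> k.
    rewrite -(prednK q_gt0) /= -[RHS]mulN1r; parity.
  by rewrite scaleNr; apply: cup_commutative => //; [lia | apply: cocycle_bplus].
have h1 := brace_conn_half pq bphi bpsi; have h2 := brace_conn_half qp bpsi bphi.
have := coboundaryB (coboundaryB h1 (coboundaryZ ((-1) ^+ (p.+1 * q.+1)) h2))
  (coboundaryZ ((-1) ^+ q) comm).
congr (coboundary _); rewrite /bconn /op_bracket bplus_cup // !pred_sign.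
rewrite (linN (@cup_lin_l _ _ _ _)) (linN (@cup_lin_r _ _ _ _)).
rewrite (linZ (@cup_lin_l _ _ _ _)) (linZ (@cup_lin_r _ _ _ _)).
rewrite !sign_scale !(oddD, oddM, oddS).
have -> : odd n = ~~ (odd p (+) odd q) by rewrite -oddD pq negbK.
by case: (odd p); case: (odd q); rewrite /=; abelian.
Qed.

(** * The operations on cohomology *)

Lemma brace_deg p q n (x : O p) (y : O q) : (p + q != n.+1)%N -> op_brace n x y = 0.
Proof.
move=> pq; rewrite op_braceE big1 // => i _.
by rewrite circ0 ?scaler0 // /insertable (negbTE pq) andbF.
Qed.

Lemma bracket_deg p q n (x : O p) (y : O q) : (p + q != n.+1)%N -> op_bracket n x y = 0.
Proof. by move=> pq; rewrite /op_bracket !brace_deg ?scaler0 ?subr0 // addnC. Qed.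

Lemma bconn_lin m n : linear (@bconn m n).
Proof. by move=> c x y; rewrite /bconn bplus_lin scalerDr !scalerA [c * _]mulrC. Qed.

Lemma cocycle_bconn m n (x : O m) : bd x = 0 -> bd (bconn n x) = 0.
Proof. by move=> bx; rewrite (linZ (@bd_lin _)) cocycle_bplus ?scaler0. Qed.

Lemma coboundary_bconn m n (x : O m) : coboundary x -> coboundary (bconn n x).
Proof. by move=> cx; apply/coboundaryZ/coboundary_bplus. Qed.

Lemma cocycleB n (x y : O n) : bd x = 0 -> bd y = 0 -> bd (x - y) = 0.
Proof. by move=> bx b_y; rewrite (linB (@bd_lin _)) bx b_y subrr. Qed.
Lemma cocycleZ n c (x : O n) : bd x = 0 -> bd (c *: x) = 0.
Proof. by move=> bx; rewrite (linZ (@bd_lin _)) bx scaler0. Qed.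
Lemma cocycle_lin n c (x y : O n) : bd x = 0 -> bd y = 0 -> bd (c *: x + y) = 0.
Proof. by move=> bx b_y; rewrite bd_lin bx b_y scaler0 addr0. Qed.

Lemma cocycle_bracket p q n (x : O p) (y : O q) :
  bd x = 0 -> bd y = 0 -> bd (op_bracket n x y) = 0.
Proof.
move=> bx b_y; have [pq|pq] := eqVneq (p + q)%N n.+1; last first.
  by rewrite (bracket_deg _ _ pq) (lin0 (@bd_lin _)).
have /coboundary_cocycle := bracket_bv pq bx b_y.
rewrite (linB (@bd_lin _)) => /eqP; rewrite subr_eq0 => /eqP ->.
apply/cocycleZ/cocycleB; last by apply/cocycleZ/cocycle_cup/cocycle_bconn.
apply: cocycleB; first exact/cocycle_bconn/cocycle_cup.
by apply: cocycle_cup => //; apply: cocycle_bconn.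
Qed.

Lemma coboundary_bracket_l p q n (x : O p) (y : O q) :
  bd y = 0 -> coboundary x -> coboundary (op_bracket n x y).
Proof.
move=> b_y cx; have bx := coboundary_cocycle cx.
have [pq|pq] := eqVneq (p + q)%N n.+1; last first.
  by rewrite (bracket_deg _ _ pq); apply: coboundary0.
have := bracket_bv pq bx b_y; set r := (X in coboundary (_ - X)) => h.
rewrite -[op_bracket n x y](subrK r); apply: coboundaryD h _.
apply/coboundaryZ/coboundaryB; last first.
  by apply/coboundaryZ/coboundary_cup_l => //; apply: cocycle_bconn.
apply: coboundaryB; first exact/coboundary_bconn/coboundary_cup_l.
by apply: coboundary_cup_l => //; apply: coboundary_bconn.
Qed.

Lemma coboundary_bracket_r p q n (x : O p) (y : O q) :
  bd x = 0 -> coboundary y -> coboundary (op_bracket n x y).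
Proof.
by move=> bx cy; rewrite bracketC; apply/coboundaryN/coboundaryZ/coboundary_bracket_l.
Qed.

(** A graded module [V] presented as the cohomology of the operad: [hcl] sends a
    cocycle to its class. *)
Section Classes.
Variables (V : nat -> lmodType k) (hcl : forall n, O n -> V n).
Hypothesis hcl_surj : forall n (x : V n), exists phi : O n, bd phi = 0 /\ hcl phi = x.
Hypothesis hcl_eq : forall n (phi psi : O n), bd phi = 0 -> bd psi = 0 ->
  hcl phi = hcl psi <-> coboundary (phi - psi).
Hypothesis hcl_lin : forall n c (phi psi : O n), bd phi = 0 -> bd psi = 0 ->
  hcl (c *: phi + psi) = c *: hcl phi + hcl psi.

Lemma hclD n (x y : O n) : bd x = 0 -> bd y = 0 -> hcl (x + y) = hcl x + hcl y.
Proof. by move=> bx b_y; rewrite -[x in LHS]scale1r hcl_lin // scale1r. Qed.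
Lemma hcl0 n : hcl (0 : O n) = 0.
Proof.
have b0 : bd (0 : O n) = 0 := lin0 (@bd_lin _).
by have /eqP := hclD b0 b0; rewrite addr0 eq_sym -subr_eq0 addrK => /eqP.
Qed.
Lemma hclZ n c (x : O n) : bd x = 0 -> hcl (c *: x) = c *: hcl x.
Proof.
have b0 : bd (0 : O n) = 0 := lin0 (@bd_lin _).
by move=> bx; rewrite -[c *: x]addr0 hcl_lin // hcl0 addr0.
Qed.
Lemma hclN n (x : O n) : bd x = 0 -> hcl (- x) = - hcl x.
Proof. by move=> bx; rewrite -scaleN1r hclZ // scaleN1r. Qed.
Lemma hclB n (x y : O n) : bd x = 0 -> bd y = 0 -> hcl (x - y) = hcl x - hcl y.
Proof.
move=> bx b_y; rewrite hclD ?hclN // -scaleN1r; exact: cocycleZ.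
Qed.
Lemma hcl_coboundary n (x : O n) : coboundary x -> hcl x = 0.
Proof.
have b0 : bd (0 : O n) = 0 := lin0 (@bd_lin _).
by move=> cx; rewrite -(hcl0 n); apply/hcl_eq; rewrite ?subr0 //; apply: coboundary_cocycle.
Qed.

(** A chosen cocycle in a class. *)
Definition rep n (x : V n) : O n := sval (cid (hcl_surj x)).
Lemma bd_rep n (x : V n) : bd (rep x) = 0.
Proof. by rewrite /rep; case: cid => y []. Qed.
Lemma hcl_rep n (x : V n) : hcl (rep x) = x.
Proof. by rewrite /rep; case: cid => y []. Qed.
Lemma rep_hcl n (x : O n) : bd x = 0 -> coboundary (rep (hcl x) - x).
Proof. by move=> bx; apply/hcl_eq; rewrite ?bd_rep ?hcl_rep. Qed.

(** The operations induced on cohomology, computed with representatives. *)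
Definition cohomology_ops : bv_ops V := {|
  gcup := fun p q n x y => hcl (cup n (rep x) (rep y));
  gone := hcl e1;
  gbr := fun p q n x y => hcl (op_bracket n (rep x) (rep y));
  gB := fun m n x => hcl (bconn n (rep x))
|}.
Local Notation X := cohomology_ops.

Lemma gcup_hcl p q n (x : O p) (y : O q) : bd x = 0 -> bd y = 0 ->
  gcup X n (hcl x) (hcl y) = hcl (cup n x y).
Proof.
move=> bx b_y; apply/hcl_eq; rewrite ?cocycle_cup ?bd_rep //.
rewrite -(subrK (cup n x (rep (hcl y))) (cup n _ _)) -addrA.
rewrite -(linB (@cup_lin_l _ _ _ _)) -(linB (@cup_lin_r _ _ _ _)); apply: coboundaryD.
  by apply: coboundary_cup_l; rewrite ?bd_rep //; apply: rep_hcl.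
by apply: coboundary_cup_r => //; apply: rep_hcl.
Qed.

Lemma gbr_hcl p q n (x : O p) (y : O q) : bd x = 0 -> bd y = 0 ->
  gbr X n (hcl x) (hcl y) = hcl (op_bracket n x y).
Proof.
move=> bx b_y; apply/hcl_eq; rewrite ?cocycle_bracket ?bd_rep //.
rewrite -(subrK (op_bracket n x (rep (hcl y))) (op_bracket n _ _)) -addrA.
rewrite -(linB (@bracket_lin_l _ _ _ _)) -(linB (@bracket_lin_r _ _ _ _)).
apply: coboundaryD.
  by apply: coboundary_bracket_l; rewrite ?bd_rep //; apply: rep_hcl.
by apply: coboundary_bracket_r => //; apply: rep_hcl.
Qed.

Lemma gB_hcl m n (x : O m) : bd x = 0 -> gB X n (hcl x) = hcl (bconn n x).
Proof.
move=> bx; apply/hcl_eq; rewrite ?cocycle_bconn ?bd_rep //.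
by rewrite -(linB (@bconn_lin _ _)); apply/coboundary_bconn/rep_hcl.
Qed.

Lemma gB_connes n (x : O n.+1) : bd x = 0 ->
  bd (connes (@tau) x) = 0 /\ gB X n (hcl x) = hcl (connes (@tau) x).
Proof.
move=> bx; have h := connes_cohomologous bx.
have bc : bd (connes (@tau) x) = 0.
  rewrite -[connes _ _](subrK (bconn n x)) (linD (@bd_lin _)) cocycle_bconn // addr0.
  exact: coboundary_cocycle.
split=> //; rewrite gB_hcl //; apply/hcl_eq => //; first exact: cocycle_bconn.
by rewrite -opprB; apply: coboundaryN.
Qed.

Lemma cohomology_graded_commutative : is_graded_commutative_algebra X.
Proof.
split.
- by move=> p q n a b pq; rewrite /= cup_deg ?hcl0.
- move=> p q n b c a a'; rewrite -[a]hcl_rep -[a']hcl_rep -[b]hcl_rep.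
  rewrite -hcl_lin ?gcup_hcl ?bd_rep ?cocycle_lin ?bd_rep //.
  by rewrite cup_lin_l hcl_lin // cocycle_cup ?bd_rep.
- move=> p q n a c b b'; rewrite -[a]hcl_rep -[b]hcl_rep -[b']hcl_rep.
  rewrite -hcl_lin ?gcup_hcl ?bd_rep ?cocycle_lin ?bd_rep //.
  by rewrite cup_lin_r hcl_lin // cocycle_cup ?bd_rep.
- move=> p q r a b c; rewrite -[a]hcl_rep -[b]hcl_rep -[c]hcl_rep.
  by rewrite !gcup_hcl ?cocycle_cup ?bd_rep // cupA.
- move=> p a; rewrite -[a]hcl_rep -[gone X]/(hcl e1).
  by rewrite gcup_hcl ?bd_unit ?bd_rep // cup1l.
- move=> p a; rewrite -[a]hcl_rep -[gone X]/(hcl e1).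
  by rewrite gcup_hcl ?bd_unit ?bd_rep // cup1r.
move=> p q a b; rewrite -[a]hcl_rep -[b]hcl_rep.
rewrite !gcup_hcl ?bd_rep // -hclZ ?cocycle_cup ?bd_rep //; apply/hcl_eq.
- by rewrite cocycle_cup ?bd_rep.
- by apply/cocycleZ; rewrite cocycle_cup ?bd_rep.
by apply: cup_commutative; rewrite ?bd_rep.
Qed.

Lemma cohomology_lie : is_shifted_lie X.
Proof.
split.
- by move=> p q n a b pq; rewrite /= bracket_deg ?hcl0.
- move=> p q n b c a a'; rewrite -[a]hcl_rep -[a']hcl_rep -[b]hcl_rep.
  rewrite -hcl_lin ?gbr_hcl ?bd_rep ?cocycle_lin ?bd_rep //.
  by rewrite bracket_lin_l hcl_lin // cocycle_bracket ?bd_rep.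
- move=> p q n a c b b'; rewrite -[a]hcl_rep -[b]hcl_rep -[b']hcl_rep.
  rewrite -hcl_lin ?gbr_hcl ?bd_rep ?cocycle_lin ?bd_rep //.
  by rewrite bracket_lin_r hcl_lin // cocycle_bracket ?bd_rep.
- move=> p q n a b _; rewrite -[a]hcl_rep -[b]hcl_rep.
  rewrite !gbr_hcl ?bd_rep // bracketC hclN ?hclZ ?cocycle_bracket ?bd_rep //.
  by apply/cocycleZ; rewrite cocycle_bracket ?bd_rep.
move=> p q r n a b c pqr; rewrite -[a]hcl_rep -[b]hcl_rep -[c]hcl_rep.
rewrite !gbr_hcl ?cocycle_bracket ?bd_rep // bracket_jacobi //.
rewrite hclD ?hclZ ?cocycle_bracket ?bd_rep //; try apply/cocycleZ.
all: by rewrite !cocycle_bracket ?bd_rep.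
Qed.

Theorem cohomology_bv : is_bv X.
Proof.
split.
- split; [exact: cohomology_graded_commutative | exact: cohomology_lie |].
  move=> p q r n c a b pqr; rewrite -[a]hcl_rep -[b]hcl_rep -[c]hcl_rep.
  move: (rep a) (rep b) (rep c) (bd_rep a) (bd_rep b) (bd_rep c).
  move=> {}a {}b {}c ba bb bc.
  rewrite !(gcup_hcl, gbr_hcl) ?(cocycle_cup, cocycle_bracket) //.
  rewrite -hclZ ?(cocycle_cup, cocycle_bracket) // -hclD //; last first.
  - by apply: cocycleZ; rewrite cocycle_cup // cocycle_bracket.
  - by rewrite cocycle_cup // cocycle_bracket.
  apply/hcl_eq; first by rewrite cocycle_bracket ?cocycle_cup.
    rewrite (linD (@bd_lin _)) cocycleZ ?addr0 cocycle_cup ?cocycle_bracket //.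
  by rewrite opprD addrA; apply: bracket_leibniz.
- by move=> m n a mn; rewrite /= /bconn bplus_deg // scaler0 hcl0.
- move=> m n c a a'; rewrite -[a]hcl_rep -[a']hcl_rep.
  rewrite -hcl_lin ?gB_hcl ?bd_rep ?cocycle_lin ?bd_rep //.
  by rewrite bconn_lin hcl_lin // cocycle_bconn ?bd_rep.
- move=> l m n a; rewrite -[a]hcl_rep !gB_hcl ?cocycle_bconn ?bd_rep //.
  apply: hcl_coboundary; rewrite {1}/bconn; apply: coboundaryZ.
  rewrite /bconn (linZ (@bplus_lin _ _)); apply/coboundaryZ/bplus_bplus.
  exact: bd_rep.
move=> p q n a b pq; rewrite -[a]hcl_rep -[b]hcl_rep.
move: (rep a) (rep b) (bd_rep a) (bd_rep b) => {}a {}b ba bb.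
have c1 : bd (cup (p + q) a b) = 0 by rewrite cocycle_cup.
have c2 : bd (bconn n (cup (p + q) a b)) = 0 by rewrite cocycle_bconn.
have c3 : bd (cup n (bconn p.-1 a) b) = 0 by rewrite cocycle_cup ?cocycle_bconn.
have c4 : bd (cup n a (bconn q.-1 b)) = 0 by rewrite cocycle_cup ?cocycle_bconn.
rewrite !(gcup_hcl, gbr_hcl, gB_hcl) ?cocycle_bconn //.
rewrite -(hclZ _ c4) -(hclB c2 c3) -hclB; [|exact: cocycleB|exact: cocycleZ].
have c5 := cocycleB (cocycleB c2 c3) (cocycleZ ((-1) ^+ p) c4).
rewrite -(hclZ _ c5); apply/hcl_eq; first exact: cocycle_bracket.
  exact: cocycleZ.
exact: bracket_bv.
Qed.

End Classes.

End Cyclic.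

End ParaCyclic.

End Operad.

(** * The endomorphism operad *)

Section Evaluation.
Variables (k : comPzRingType) (U V : lmodType k).

(** The value of a multilinear map on the first terms of a sequence.  Equalities of
    multilinear maps are proved on sequences, where the arguments of a composite are
    functions of their index. *)
Definition ev n (f : mlin U V n) (g : nat -> U) : V := f [tuple g j | j < n].

Lemma ev_ext n (f : mlin U V n) (g h : nat -> U) :
  (forall j, (j < n)%N -> g j = h j) -> ev f g = ev f h.
Proof.
move=> gh; congr (mlin_fun f _); apply: eq_from_tnth => j.
by rewrite !tnth_mktuple gh.
Qed.

Lemma evE n (f : mlin U V n) (a : n.-tuple U) : f a = ev f (nth 0 a).
Proof.
congr (mlin_fun f _); apply: eq_from_tnth => j.
by rewrite tnth_mktuple (tnth_nth 0).
Qed.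

Lemma mlin_ev n (f f' : mlin U V n) : (forall g, ev f g = ev f' g) -> f = f'.
Proof. by move=> ff'; apply/mlinP => a; rewrite !evE ff'. Qed.

Lemma evD n (f f' : mlin U V n) g : ev (f + f') g = ev f g + ev f' g.
Proof. by []. Qed.
Lemma evZ n c (f : mlin U V n) g : ev (c *: f) g = c *: ev f g.
Proof. by []. Qed.

Lemma nth_tuple_fun (T : Type) (x0 : T) n (g : nat -> T) j :
  nth x0 [tuple g i | i < n] j = if (j < n)%N then g j else x0.
Proof.
case: ltnP => [jn|nj]; last by rewrite nth_default ?size_tuple.
by rewrite (nth_mktuple _ _ (Ordinal jn)).
Qed.

(** A multilinear map is linear in a sequence only one term of which varies, and
    linearly so. *)
Lemma ev_lin (W : lmodType k) n (f : mlin U V n) t (h : W -> U) (H : W -> nat -> U) :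
    (t < n)%N -> linear h -> (forall x, H x t = h x) ->
    (forall x y j, (j < n)%N -> j != t -> H x j = H y j) ->
  linear (fun x => ev f (H x)).
Proof.
move=> tn lh Ht Hj; pose a := [tuple H 0 j | j < n].
have E x : ev f (H x) = f (upd a (Ordinal tn) (h x)).
  congr (mlin_fun f _); apply: eq_from_tnth => j; rewrite !tnth_mktuple -val_eqE /=.
  by case: eqVneq => [->//|jt]; apply: Hj.
by move=> c x y; rewrite !E lh (mlin_multilinear f (Ordinal tn) a).
Qed.

End Evaluation.

Section Endo.
Variables (k : comPzRingType) (A : algType k).
Local Notation O := (endo_operad A).
Local Notation circ n i phi psi := (@op_circ k O _ _ n i phi psi).

Lemma ev_circ p q n i (phi : O p) (psi : O q) (g : nat -> A) : insertable p q n i ->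
  ev (circ n i phi psi) g =
  ev phi (fun j => if (j < p - i)%N then g j
                   else if j == (p - i)%N then ev psi (fun l => g (p - i + l)%N)
                   else g (j + q - 1)%N).
Proof.
move=> ins; rewrite /ev [LHS]/= endo_circE // /endo_circ_fun.
congr (mlin_fun phi _); apply: eq_from_tnth => j; rewrite !tnth_mktuple.
have /andP[ip /eqP pq] := ins; have jp := ltn_ord j.
rewrite !nth_tuple_fun; case: ifP => [jpi|jpi].
  by have -> : (j < n)%N by lia.
case: ifP => [/eqP jE|jE]; last by have -> : (j + q - 1 < n)%N by lia.
congr (mlin_fun psi _); apply: eq_from_tnth => l; rewrite !tnth_mktuple.
by rewrite nth_tuple_fun; have lq := ltn_ord l; have -> : (p - i + l < n)%N by lia.
Qed.

Lemma ev_mul g : ev (op_mul O : mlin A A 2) g = g 0%N * g 1%N.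
Proof. by rewrite /ev [LHS]/= !nth_tuple_fun. Qed.
Lemma ev_id g : ev (op_id O : mlin A A 1) g = g 0%N.
Proof. by rewrite /ev [LHS]/= /thead tnth_mktuple. Qed.

Lemma endo_circ_deg p q n i (phi : O p) (psi : O q) :
  ~~ insertable p q n i -> circ n i phi psi = 0.
Proof. by move=> ni; rewrite /= /endo_circ; case: {-}_ / idP => // ok; rewrite ok in ni. Qed.

(* Splits on the conditions of the conditionals in the goal. *)
Ltac split_if := repeat (case: ifP => ?).

Lemma endo_operad_is_operad : is_operad O.
Proof.
split.
- move=> p q n i psi ins c x y; apply: mlin_ev => g.
  by rewrite evD evZ !ev_circ // evD evZ.
- move=> p q n i phi ins c x y; apply: mlin_ev => g.
  rewrite evD evZ !ev_circ //.
  pose H (u : O q) j := if (j < p - i)%N then g j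
     else if j == (p - i)%N then ev u (fun l => g (p - i + l)%N) else g (j + q - 1)%N.
  have /andP[ip _] := ins.
  apply: (@ev_lin _ _ _ (O q) p phi (p - i) (fun u => ev u (fun l => g (p - i + l)%N)) H).
  + by lia.
  + by [].
  + by move=> u; rewrite /H ltnn eqxx.
  + by move=> u v j _ /negbTE jt; rewrite /H jt.
- move=> p q r m l n i j phi psi chi ji ip pq pr mr; apply: mlin_ev => g.
  rewrite !ev_circ /insertable; try lia.
  apply: ev_ext => a ap; split_if; try lia; try (congr (g _); lia).
  + by apply: ev_ext => b br; split_if; try lia; congr (g _); lia.
  + by apply: ev_ext => b br; split_if; try lia; congr (g _); lia.
- move=> p q r m l n i j phi psi chi ip ij pq qr mr; apply: mlin_ev => g.
  rewrite !ev_circ /insertable; try lia.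
  apply: ev_ext => a ap; split_if; try lia; try (congr (g _); lia).
  apply: ev_ext => b br; split_if; try lia; try (congr (g _); lia).
  by apply: ev_ext => d dr; congr (g _); lia.
- move=> q psi; apply: mlin_ev => g.
  rewrite ev_circ ?ev_id /insertable /=; try lia.
  by rewrite subnn.
move=> p i phi ip; apply: mlin_ev => g.
rewrite ev_circ /insertable; try lia.
apply: ev_ext => a ap; split_if; rewrite ?ev_id; congr (g _); lia.
Qed.

Lemma endo_operad_is_mult_operad : is_mult_operad O.
Proof.
split; first exact: endo_operad_is_operad.
- by apply: mlin_ev => g; rewrite !ev_circ // !ev_mul /= mulrA.
- apply: mlin_ev => g; rewrite ev_circ // ev_mul ev_id.
  exact: mulr1.
- apply: mlin_ev => g; rewrite ev_circ // ev_mul ev_id.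
  exact: mul1r.
Qed.

(** * Calculus of the contraaction *)

Section Gamma.
Variable gamma : homk (homk A A) A.

(** The contraaction on arbitrary functions, extended by zero to the functions that
    are not linear. *)
Definition gam (F : A -> A) : A :=
  if pselect (linear F) is left lF then gamma (Homk lF) else 0.

Lemma gamE (F : A -> A) (h : homk A A) : h =1 F -> gam F = gamma h.
Proof.
move=> hF; have lF : linear F by move=> c x y; rewrite -!hF homk_linear.
rewrite /gam; case: pselect => // l'; congr (homk_fun gamma _).
by apply/homkP => x; rewrite hF.
Qed.

Lemma gam_ext (F G : A -> A) : F =1 G -> gam F = gam G.
Proof. by move/funext->. Qed.

Lemma gam_lin c (F G : A -> A) : linear F -> linear G ->
  gam (fun x => c *: F x + G x) = c *: gam F + gam G.
Proof.
move=> lF lG; rewrite (@gamE F (Homk lF)) // (@gamE G (Homk lG)) // -homk_linear.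
exact: gamE.
Qed.

(** The sequence [a_1, .., a_n, x, x, ..]. *)
Definition pad n (g : nat -> A) (x : A) (j : nat) : A := if (j < n)%N then g j else x.

(** The rotation in terms of sequences. *)
Lemma ev_tau n (f : O n) (g : nat -> A) :
  ev (tau gamma f) g =
  gam (fun x => pad n g x 0 * ev f (fun j => pad n g x j.+1)).
Proof.
rewrite /ev [LHS]/= /tau_fun; apply/esym/gamE => x.
rewrite [LHS]/= /rotate_eval.
have E j : (j <= n)%N -> (rcons [tuple g i | i < n] x)`_j = pad n g x j.
  move=> jn; rewrite nth_rcons size_tuple /pad nth_tuple_fun.
  case: ifP => jn'; first by rewrite jn'.
  by have -> : j == n by lia.
rewrite E //; congr (_ * mlin_fun f _); apply: eq_from_tnth => j.
by rewrite !tnth_mktuple E.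
Qed.

(** In degree at least 1, the first term of the padded sequence does not vary. *)
Lemma ev_tau_pos n (f : O n.+1) (g : nat -> A) :
  ev (tau gamma f) g = gam (fun x => g 0%N * ev f (fun j => pad n (g \o S) x j)).
Proof. by rewrite ev_tau. Qed.

Lemma ev_tau0 (f : O 0) (g : nat -> A) :
  ev (tau gamma f) g = gam (fun x => x * ev f g).
Proof. by rewrite ev_tau; apply: gam_ext => x; congr (_ * _); apply: ev_ext. Qed.

Lemma linear_id : linear (@id A). Proof. by []. Qed.

Lemma linear_mull (a : A) (F : A -> A) : linear F -> linear (fun x => a * F x).
Proof. by move=> lF c x y; rewrite lF mulrDr scalerAr. Qed.
Lemma linear_mulr (a : A) (F : A -> A) : linear F -> linear (fun x => F x * a).
Proof. by move=> lF c x y; rewrite lF mulrDl scalerAl. Qed.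

Lemma ev_pad_linear n (f : O n.+1) (g : nat -> A) :
  linear (fun x => ev f (fun j => pad n g x j)).
Proof.
apply: (@ev_lin _ _ _ A _ f n id) => //.
- by move=> x; rewrite /pad ltnn.
by move=> x y j jn /negbTE j_n; rewrite /pad; have -> : (j < n)%N by lia.
Qed.

Lemma tau_linear_endo n : linear (@tau k A gamma n : O n -> O n).
Proof.
case: n => [|n] c f f'; apply: mlin_ev => g.
  rewrite evD evZ !ev_tau0 -gam_lin.
  - by apply: gam_ext => x; rewrite evD evZ mulrDr scalerAr.
  - exact/linear_mulr/linear_id.
  exact/linear_mulr/linear_id.
rewrite evD evZ !ev_tau_pos -gam_lin.
- by apply: gam_ext => x; rewrite evD evZ mulrDr scalerAr.
- exact/linear_mull/ev_pad_linear.
exact/linear_mull/ev_pad_linear.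
Qed.

Hypothesis cA : is_contraaction gamma.

(** A right factor of the contraaction may be moved under it. *)
Lemma gam_right (a : A) (F : A -> A) : linear F ->
  gam (fun x => F (a * x)) = gam F * a.
Proof.
move=> lF; rewrite (@gamE F (Homk lF)) // -(contra_right cA).
exact: gamE.
Qed.

(** A nested contraaction may be evaluated at 1. *)
Lemma gam_assoc (G : A -> A -> A) :
  (forall x, linear (G x)) -> (forall y, linear (G^~ y)) ->
  gam (fun x => gam (G x)) = gam (G^~ 1).
Proof.
move=> lG lG'; pose G1 x := Homk (lG x).
have lG1 : linear G1 by move=> c x y; apply/homkP => z; apply: lG'.
pose G2 : homk A (homk A A) := Homk lG1.
have E := contra_assoc cA G2.
rewrite (@gamE _ (homk_iter gamma G2)); last first.
  by move=> x; rewrite [LHS]/= (@gamE _ (G1 x)).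
by rewrite E; apply/esym/gamE.
Qed.

Lemma gam_unit (m : A) : gam (fun x => m * x) = m.
Proof. by rewrite -[RHS](contra_unit cA); apply: gamE. Qed.

Lemma tau_circ1_endo p q n (phi : O p) (psi : O q) :
  (0 < p)%N -> (0 < q)%N -> (p + q = n.+1)%N ->
  tau gamma (circ n 1 phi psi) = circ n q (tau gamma psi) (tau gamma phi).
Proof.
case: p phi => // p phi _; case: q psi => // q psi _ pq; apply: mlin_ev => g.
have -> : n = (p + q).+1 by lia.
rewrite ev_circ /insertable ?subnn; last lia.
rewrite !ev_tau; pose w x := ev psi (fun j => pad q (fun l => g (l + p.+1)%N) x j).
pose G (x y : A) : A := g 0%N * ev phi (fun j => pad p (g \o S) (w x * y) j).
transitivity (gam (G^~ 1)).
  apply: gam_ext => x; rewrite {1}/pad /= /G; congr (_ * _).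
  rewrite ev_circ /insertable; last lia.
  apply: ev_ext => j jp; rewrite /pad /= mulr1.
  case: ifP => [jp1|jp1]; first by rewrite !ifT //; lia.
  have -> : (j == p.+1 - 1)%N by lia.
  have -> : (j < p)%N = false by lia.
  apply: ev_ext => l lq; rewrite /pad.
  have -> : ((p.+1 - 1 + l).+1 < (p + q).+1)%N = (l < q)%N by lia.
  by case: ifP => // _; congr (g _); lia.
rewrite -gam_assoc.
- apply: gam_ext => x; transitivity (ev (tau gamma phi) g * w x).
    rewrite ev_tau_pos -(gam_right (w x)) //.
    exact/linear_mull/ev_pad_linear.
  congr (_ * _); first by rewrite ev_tau.
  rewrite /w; apply: ev_ext => j jq; rewrite /pad ltnS; case: ifP => // jq'.
  by congr (g _); lia.
- move=> x; apply: (@lin_comp _ _ _ _ (fun y => w x * y)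
    (fun z => g 0%N * ev phi (pad p (g \o S) z))).
    exact/linear_mull/linear_id.
  exact/linear_mull/ev_pad_linear.
move=> y; apply: (@lin_comp _ _ _ _ (fun x => w x * y)
  (fun z => g 0%N * ev phi (pad p (g \o S) z))).
  exact/linear_mulr/ev_pad_linear.
exact/linear_mull/ev_pad_linear.
Qed.

Lemma tau_circ_endo p q n i (phi : O p) (psi : O q) :
  (1 < i <= p)%N -> (p + q = n.+1)%N ->
  tau gamma (circ n i phi psi) = circ n i.-1 (tau gamma phi) psi.
Proof.
move=> ip pq; apply: mlin_ev => g.
rewrite ev_circ /insertable; last lia.
rewrite !ev_tau; apply: gam_ext => x; rewrite {1 3}/pad.
rewrite !ifT; try lia; congr (_ * _).
rewrite ev_circ /insertable; last lia.
apply: ev_ext => j jp; rewrite /pad.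
have -> : (j.+1 < p - i.-1)%N = (j < p - i)%N by lia.
have -> : (j.+1 == p - i.-1)%N = (j == p - i)%N by lia.
case: ifP => jpi.
  have -> : (j.+1 < n)%N by lia.
  by have -> : (j.+1 < p)%N by lia.
case: ifP => jpi'.
  have -> : (j.+1 < p)%N by lia.
  apply: ev_ext => l lq; have -> : ((p - i + l).+1 < n)%N by lia.
  by congr (g _); lia.
have -> : ((j + q - 1).+1 < n)%N = (j.+1 < p)%N by lia.
by case: ifP => // _; congr (g _); lia.
Qed.

Lemma tau_id_endo : tau gamma (op_id O) = op_id O.
Proof.
apply: mlin_ev => g; rewrite ev_tau ev_id -[RHS]gam_unit; apply: gam_ext => x.
by rewrite ev_id.
Qed.

Lemma tau_mul_endo : tau gamma (op_mul O) = op_mul O.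
Proof.
apply: mlin_ev => g; rewrite ev_tau ev_mul -[RHS]gam_unit; apply: gam_ext => x.
by rewrite ev_mul /pad /= mulrA.
Qed.

Lemma endo_para_cyclic : is_para_cyclic_operad (O := O) (tau gamma).
Proof.
split; [exact: tau_linear_endo | exact: tau_circ1_endo | exact: tau_circ_endo |].
exact: tau_id_endo.
Qed.

Lemma endo_para_cyclic_mult : is_para_cyclic_mult_operad (O := O) (tau gamma).
Proof.
split; [exact: endo_operad_is_mult_operad | exact: endo_para_cyclic |].
exact: tau_mul_endo.
Qed.

Lemma endo_para_cocyclic :
  is_para_cocyclic (@coface k O) (@codegen k O) (tau gamma).
Proof.
apply: operad_para_cocyclic.
- exact: endo_operad_is_mult_operad.
- exact: endo_circ_deg.
- exact: endo_para_cyclic.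
- exact: tau_mul_endo.
- move=> x; apply: mlin_ev => g.
  rewrite coface_last coface_first ev_tau_pos [RHS]ev_circ // ev_mul ev_tau0.
  transitivity (gam (fun y => y * ev x g) * g 0%N).
    rewrite -gam_right; last exact/linear_mulr/linear_id.
    by apply: gam_ext => y; rewrite ev_circ // ev_mul /= mulrA; congr (_ * _); apply: ev_ext.
  congr (_ * _); apply: gam_ext => y; congr (_ * _); exact: ev_ext.
move=> n x; apply: mlin_ev => g.
rewrite /codegen [RHS]ev_circ /insertable; last lia.
pose G (z y : A) : A := pad n g z 0 * ev x (fun j => pad n (fun l => pad n g z l.+1) y j).
have [lG lG'] : (forall z, linear (G z)) /\ (forall y, linear (G^~ y)).
  split=> [z|y]; first exact/linear_mull/ev_pad_linear.
  rewrite /G; case: n x {G} => [|n] x.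
    have E : (fun z => pad 0 g z 0 * ev x (fun j => pad 0 (fun l => pad 0 g z l.+1) y j)) =
        (fun z => z * ev x (fun=> y)).
      by apply/funext => z; congr (_ * _); apply: ev_ext.
    by rewrite E; exact/linear_mulr/linear_id.
  apply: (@linear_mull (g 0%N)).
  apply: (@ev_lin _ _ _ A _ x n id) => //.
    by move=> z; rewrite /pad ltnSn ltnn.
  move=> z z' j _ jn; rewrite /pad ltnS; case: ifP => // jn'.
  by have -> : (j.+1 < n.+1)%N by lia.
transitivity (gam (G^~ 1)).
  rewrite ev_tau; apply: gam_ext => z; congr (_ * _).
  rewrite ev_circ /insertable; last lia.
  apply: ev_ext => j jn; rewrite /pad; have -> : (n.+1 - 1 = n)%N by lia.
  case: ifP => // jn'; have -> : j == n by lia.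
  by [].
rewrite -gam_assoc // ev_tau_pos; apply: gam_ext => z.
rewrite subnn; transitivity (1 * ev (tau gamma x) (pad n g z)); first by rewrite mul1r ev_tau.
congr (_ * _); apply: ev_ext => j jn; rewrite /pad; case: ifP => // jn'.
by congr (g _); rewrite addn0 subn1.
Qed.

(** * Cyclicity in the stable case *)

Hypothesis sA : is_stable gamma.

Lemma gam_stable (m : A) : gam (fun x => x * m) = m.
Proof. by rewrite -[RHS]sA; apply: gamE. Qed.

(** The contraaction behaves as a trace. *)
Lemma gam_trace (a : A) (h : A -> A) : linear h ->
  gam (fun x => a * h x) = gam (fun x => h x * a).
Proof.
move=> lh; pose G (x y : A) : A := h x * y * a.
transitivity (gam (G^~ 1)); last by apply: gam_ext => x; rewrite /G mulr1.
rewrite -gam_assoc.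
- apply: gam_ext => x; rewrite -{1}[a]gam_stable -gam_right //.
  exact/linear_mulr/linear_id.
- by move=> x; apply/linear_mulr/linear_mull/linear_id.
by move=> y; apply/linear_mulr/linear_mulr.
Qed.

(** The adjunction between [f] and its rotation. *)
Lemma gam_tau n (f : O n.+1) (a : A -> nat -> A) (w : A -> A) :
  (forall y, linear (fun z => a z 0%N * ev f (pad n (a z \o S) (w z * y)))) ->
  gam (fun z => ev (tau gamma f) (a z) * w z) =
  gam (fun z => a z 0%N * ev f (pad n (a z \o S) (w z))).
Proof.
move=> lG; pose G (z y : A) : A := a z 0%N * ev f (pad n (a z \o S) (w z * y)).
transitivity (gam (G^~ 1)); last by apply: gam_ext => z; rewrite /G mulr1.
rewrite -gam_assoc //.
- apply: gam_ext => z; rewrite ev_tau_pos -gam_right //.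
  exact/linear_mull/ev_pad_linear.
move=> z; apply: (@lin_comp _ _ _ _ (fun y => w z * y)
  (fun u => a z 0%N * ev f (pad n (a z \o S) u))).
  exact/linear_mull/linear_id.
exact/linear_mull/ev_pad_linear.
Qed.

(** By [gam_tau] and [gam_trace], [gam (z => (tau^(n+1) f) (a_1, .., a_n) z)] does not
    change when the letters of the cyclic word [a_1, .., a_n, z] move from the right of
    the cochain to its left, each move taking away one rotation. *)
Lemma tau_order_endo n (f : O n) : iter n.+1 (@tau k A gamma n) f = f.
Proof.
case: n f => [|n] f; apply: mlin_ev => g.
  by rewrite -[iter _ _ _]/(tau gamma f) ev_tau0 gam_stable.
(* the cyclic word [a_1, .., a_(n+1), z] is read from its term of index [m] *)
pose c (z : A) j : A := if (j < n.+1)%N then g j else if j == n.+1 then z else g (j - n.+2)%N.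
pose F m : O n.+1 := iter (n.+2 - m) (@tau k A gamma n.+1) f.
have FS m : (m <= n.+1)%N -> F m = tau gamma (F m.+1).
  by move=> mn; rewrite /F -iterS; congr (iter _ _ _); lia.
have padE m z w : (m <= n.+1)%N -> w = c z (m + n.+1)%N ->
    ev (F m.+1) (pad n ((fun j => c z (m + j)%N) \o S) w) = ev (F m.+1) (fun j => c z (m.+1 + j)%N).
  move=> mn ->; apply: ev_ext => j jn; rewrite /pad /= addSnnS; case: ifP => // jn'.
  by congr (c z _); lia.
have lF m : (0 < m <= n.+1)%N -> linear (fun z => ev (F m) (fun j => c z (m + j)%N)).
  move=> mn; apply: (@ev_lin _ _ _ A _ (F m) (n.+1 - m) id) => //; first lia.
    by move=> z; rewrite /c subnKC; [rewrite ltnn eqxx | lia].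
  move=> z z' j jn jm; rewrite /c; case: ifP => // _.
  by have -> : (m + j == n.+1)%N = false by lia.
have step m : (m <= n.+1)%N ->
    ev (F 0%N) g = gam (fun z => ev (F m) (fun j => c z (m + j)%N) * c z (m + n.+1)%N).
  elim: m => [|m IHm] mn.
    rewrite -[LHS]gam_unit; apply: gam_ext => z; rewrite /c add0n ltnn eqxx.
    by congr (_ * _); apply: ev_ext => j jn; rewrite add0n jn.
  rewrite IHm; last lia.
  rewrite FS; last lia.
  rewrite gam_tau.
    transitivity (gam (fun z => g m * ev (F m.+1) (fun j => c z (m.+1 + j)%N))).
      apply: gam_ext => z; rewrite padE //; last lia.
      by rewrite addn0 /c; have -> : (m < n.+1)%N by lia.
    rewrite gam_trace; last by apply: lF; lia.
    apply: gam_ext => z; congr (_ * _); rewrite /c.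
    have -> : (m.+1 + n.+1 < n.+1)%N = false by lia.
    have -> : (m.+1 + n.+1 == n.+1)%N = false by lia.
    by congr (g _); lia.
  move=> y; pose H z := pad n ((fun j => c z (m + j)%N) \o S) (c z (m + n.+1)%N * y).
  have E : (fun z => c z (m + 0)%N * ev (F m.+1) (H z)) = (fun z => g m * ev (F m.+1) (H z)).
    by apply/funext => z; rewrite addn0 {1}/c mn.
  rewrite [X in linear X]E; apply: linear_mull.
  have cE z j : (m + j != n.+1)%N -> c z (m + j)%N = c 0 (m + j)%N.
    by move=> /negbTE mj; rewrite /c mj.
  apply: (@ev_lin _ _ _ A _ (F m.+1) (n - m) (fun z => if m == 0%N then z * y else z)).
  - by lia.
  - by case: eqP => _; [exact/linear_mulr/linear_id | exact: linear_id].
  - move=> z; rewrite /H /pad /c; case: (m =P 0%N) => [->|m0].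
      by rewrite subn0 ltnn add0n ltnn eqxx.
    have -> : (n - m < n)%N by lia.
    rewrite /=; have -> : (m + (n - m).+1 = n.+1)%N by lia.
    by rewrite ltnn eqxx.
  move=> z z' j jn jm; rewrite /H /pad /=; case: ifP => jn'.
    by rewrite (cE z) ?(cE z') //; lia.
  by rewrite (cE z) ?(cE z') //; lia.
rewrite -[LHS]/(ev (F 0%N) g) (step n.+1) // FS // gam_tau.
  rewrite -[RHS]gam_stable; apply: gam_ext => z; congr (_ * _).
    by rewrite /c addn0 ltnn eqxx.
  rewrite padE // /F subnn; apply: ev_ext => j jn; rewrite /c.
  have -> : (n.+2 + j < n.+1)%N = false by lia.
  have -> : (n.+2 + j == n.+1)%N = false by lia.
  by rewrite addKn.
move=> y; pose u := pad n ((fun j => c 0 (n.+1 + j)%N) \o S) (c 0 (n.+1 + n.+1)%N * y).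
have E : (fun z => c z (n.+1 + 0)%N * ev (F n.+2)
      (pad n ((fun j => c z (n.+1 + j)%N) \o S) (c z (n.+1 + n.+1)%N * y))) =
    (fun z => z * ev (F n.+2) u).
  have cE z j : c z (n.+1 + j.+1)%N = c 0 (n.+1 + j.+1)%N.
    by rewrite /c; have -> : (n.+1 + j.+1 == n.+1)%N = false by lia.
  apply/funext => z; congr (_ * _); first by rewrite /c addn0 ltnn eqxx.
  by apply: ev_ext => j jn; rewrite /u /pad /= !cE.
by rewrite [X in linear X]E; exact/linear_mulr/linear_id.
Qed.

Lemma endo_cyclic_mult : is_cyclic_mult_operad (O := O) (tau gamma).
Proof. by split; [exact: endo_para_cyclic_mult | exact: tau_order_endo]. Qed.

Lemma endo_cocyclic : is_cocyclic (@coface k O) (@codegen k O) (tau gamma).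
Proof. by split; [exact: endo_para_cocyclic | exact: tau_order_endo]. Qed.

End Gamma.

End Endo.

(** * Classes in a subquotient *)

Section SubquotientClass.
Variables (k : comPzRingType) (V : lmodType k) (Z B : submodule V).

(** The class of an element of [Z], extended by zero to [V]. *)
Definition sqcls (v : V) : subquotient Z B :=
  if pselect (Z v) is left Zv then cls (to_sub _ Zv) else 0.

Lemma sqclsE v (Zv : Z v) : sqcls v = cls (to_sub _ Zv).
Proof.
rewrite /sqcls; case: pselect => // Zv'; congr (cls _).
exact: val_inj.
Qed.

Lemma sqcls_surj (x : subquotient Z B) : exists v, Z v /\ sqcls v = x.
Proof.
have := cls_repr x; set z := repr _ => zx; exists (sub_val z).
have Zz : Z (sub_val z) := sub_of_in z.
by split=> //; rewrite (sqclsE Zz) -zx; congr (cls _); apply: val_inj.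
Qed.

Lemma sqcls_eq v w : Z v -> Z w -> sqcls v = sqcls w <-> B (v - w).
Proof. by move=> Zv Zw; rewrite (sqclsE Zv) (sqclsE Zw); exact: cls_eq. Qed.

Lemma sqcls_lin c v w : Z v -> Z w ->
  sqcls (c *: v + w) = c *: sqcls v + sqcls w.
Proof.
move=> Zv Zw; rewrite (sqclsE (carrier_lin c Zv Zw)) (sqclsE Zv) (sqclsE Zw).
rewrite -[c *: cls _]/(quotient_scale c (cls _)) quotient_scaleE -clsD.
by congr (cls _); apply: val_inj.
Qed.

Lemma representsP v x : @represents _ _ Z B v x <-> Z v /\ sqcls v = x.
Proof.
split=> [[z [<- ->]]|[Zv <-]].
  split; first exact: sub_of_in.
  by rewrite (sqclsE (sub_of_in z)); congr (cls _); apply: val_inj.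
by exists (to_sub _ Zv); rewrite (sqclsE Zv).
Qed.

End SubquotientClass.

(** * Hochschild cohomology and the operad *)

Section HochschildOperad.
Variables (k : comPzRingType) (A : algType k).
Local Notation O := (endo_operad A).
Local Notation HHA n := (HH (regular A) n).

Local Notation mO := (endo_operad_is_mult_operad A).
Local Notation O0 := (@endo_circ_deg k A).

Lemma hochschild_d_bd n (f : O n) (a : n.+1.-tuple A) :
  @hochschild_d k A (regular A) n f a = ((-1) ^+ n.+1 *: bd f : mlin A A n.+1) a.
Proof.
rewrite hochschild_d_coface; congr (mlin_fun _ a).
rewrite /bd scaler_sumr big_nat_rev big_mkord; apply: eq_bigr => i _ /=.
rewrite add0n subSS scalerA; congr (_ *: _).
rewrite -exprD; apply: sign_congr; have := ltn_ord i; lia.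
Qed.

Lemma is_cocycle_bd n (f : O n) : @is_cocycle k A (regular A) n f <-> bd f = 0.
Proof.
split=> [cf|bf a]; last by rewrite hochschild_d_bd bf scaler0.
rewrite -[bd f]scale1r -(sign_sq _ n.+1) -scalerA.
suff -> : (-1) ^+ n.+1 *: bd f = 0 by rewrite scaler0.
by apply/mlinP => a; rewrite -hochschild_d_bd cf.
Qed.

Lemma is_coboundary_bd n (f : O n) :
  @is_coboundary k A (regular A) n f <-> coboundary f.
Proof.
case: n f => [|n] f //; split=> -[g fg].
  exists ((-1) ^+ n.+1 *: g); rewrite (linZ (@bd_lin _ _ mO O0 _)).
  by apply/mlinP => a; rewrite fg hochschild_d_bd.
exists ((-1) ^+ n.+1 *: g); move=> a.
by rewrite fg hochschild_d_bd (linZ (@bd_lin _ _ mO O0 _)) scalerA sign_sq scale1r.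
Qed.

(** The Hochschild class of a cochain, which is meaningful on cocycles. *)
Definition hcl n (f : O n) : HHA n :=
  @sqcls k _ (cocycles (regular A) n) (coboundaries (regular A) n) f.

Lemma hcl_surj n (x : HHA n) : exists f : O n, bd f = 0 /\ hcl f = x.
Proof. by have [f [cf fx]] := sqcls_surj x; exists f; split=> //; apply/is_cocycle_bd. Qed.

Lemma hcl_eq n (f g : O n) : bd f = 0 -> bd g = 0 ->
  hcl f = hcl g <-> coboundary (f - g).
Proof.
move=> /is_cocycle_bd cf /is_cocycle_bd cg; rewrite -is_coboundary_bd.
exact: (@sqcls_eq k _ (cocycles (regular A) n) (coboundaries (regular A) n) f g cf cg).
Qed.

Lemma hcl_lin n c (f g : O n) : bd f = 0 -> bd g = 0 ->
  hcl (c *: f + g) = c *: hcl f + hcl g.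
Proof.
move=> /is_cocycle_bd cf /is_cocycle_bd cg.
exact: (@sqcls_lin k _ (cocycles (regular A) n)).
Qed.

Lemma operad_classP n (f : O n) (x : HHA n) : operad_class f x <-> bd f = 0 /\ hcl f = x.
Proof.
split=> [/representsP[/is_cocycle_bd ? ?]//|[/is_cocycle_bd cf fx]].
by apply/representsP.
Qed.

Variable gamma : homk (homk A A) A.
Hypotheses (cA : is_contraaction gamma) (sA : is_stable gamma).

(** The operations of the endomorphism operad, on Hochschild cohomology. *)
Definition hochschild_ops : bv_ops (fun n => HHA n) :=
  @cohomology_ops k O (@tau k A gamma) (fun n => HHA n) hcl hcl_surj.

Lemma hochschild_induced : is_induced gamma hochschild_ops.
Proof.
have pO := endo_para_cyclic cA.
have coO := endo_cocyclic cA sA.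
split.
- move=> p q phi psi x y /operad_classP[bphi <-] /operad_classP[bpsi <-].
  apply/operad_classP; rewrite op_cupE (cocycle_cup mO O0) //; split=> //.
  by rewrite (gcup_hcl mO O0 _ hcl_surj hcl_eq).
- by apply/operad_classP; split=> //; apply: bd_unit mO.
- move=> p q n phi psi x y pq /operad_classP[bphi <-] /operad_classP[bpsi <-].
  apply/operad_classP; rewrite (cocycle_bracket mO O0 pO coO) //; split=> //.
  by rewrite (gbr_hcl mO O0 pO coO hcl_surj hcl_eq).
move=> n phi x /operad_classP[bphi <-]; apply/operad_classP.
by have [bc <-] := gB_connes mO O0 pO coO hcl_surj hcl_eq bphi.
Qed.

Lemma hochschild_bv : is_bv hochschild_ops.
Proof.
apply: (cohomology_bv mO O0 _ _ hcl_surj hcl_eq hcl_lin).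
  exact: endo_para_cyclic.
exact: endo_cocyclic.
Qed.

End HochschildOperad.

(** * The Hochschild complex of a bimodule *)

Section HochschildComplex.
Variables (k : comPzRingType) (A : algType k) (M : bimodule A).

(** The sequence [g] with the terms of index [m - 1] and [m] multiplied; if [m = 0], the
    first term is dropped instead.  Of the terms of [g] of index at most [n], the first
    [n] terms of [merge_at n.+1 g] are those of index less than [n]. *)
Definition merge_at m (g : nat -> A) (j : nat) : A :=
  if (j.+1 < m)%N then g j else if j.+1 == m then g j * g j.+1 else g j.+1.

(** The action of the first or last term of a sequence, for the outer faces.  Indices
    [m] greater than [n + 1] are treated as [n + 1]. *)
Definition outer m n (g : nat -> A) (v : M) : M :=
  if m == 0%N then lact (g 0%N) v else if (n < m)%N then ract v (g n) else v.

(** The face [m] of a cochain, for [0 <= m <= n + 1], with Hochschild's numbering. *)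
Section Face.
Variables (n m : nat) (f : mlin A M n).

Definition face_fun (a : n.+1.-tuple A) : M :=
  outer m n (nth 0 a) (ev f (merge_at m (nth 0 a))).

Lemma face_funE (g : nat -> A) :
  face_fun [tuple g j | j < n.+1] = outer m n g (ev f (merge_at m g)).
Proof.
have E j : (j < n.+1)%N -> nth 0 [tuple g i | i < n.+1] j = g j.
  by move=> jn; rewrite nth_tuple_fun jn.
rewrite /face_fun (_ : ev f _ = ev f (merge_at m g)); first by rewrite /outer !E.
by apply: ev_ext => j jn; rewrite /merge_at !E //; lia.
Qed.

Lemma face_multilinear : multilinear face_fun.
Proof.
move=> [i i_n] a; pose g x j := if j == i then x else a`_j.
have E x : face_fun (upd a (Ordinal i_n) x) = outer m n (g x) (ev f (merge_at m (g x))).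
  rewrite -face_funE; congr (face_fun _); apply: eq_from_tnth => j.
  by rewrite !tnth_mktuple /g -val_eqE /= (tnth_nth 0).
suff L : linear (fun x => outer m n (g x) (ev f (merge_at m (g x)))).
  by move=> c x y; rewrite !E; apply: L.
have const j : j != i -> forall u v, g u j = g v j by move=> /negbTE ji u v; rewrite /g ji.
have gi u : g u i = u by rewrite /g eqxx.
have same u v : (forall j, (j < n)%N -> merge_at m (g u) j = merge_at m (g v) j) ->
    ev f (merge_at m (g u)) = ev f (merge_at m (g v)) by exact: ev_ext.
rewrite /outer; case: eqP => [m0|m0].
  move=> c x y; have [i0|i0] := eqVneq i 0%N.
    have S u v : ev f (merge_at m (g u)) = ev f (merge_at m (g v)).
      by apply: same => j jn; rewrite /merge_at m0 /=; apply: const; rewrite i0.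
    rewrite (S x (c *: x + y)) (S y (c *: x + y)) -i0 !gi.
    exact: (lact_linearl (ev f (merge_at m (g (c *: x + y)))) c x y).
  rewrite !(const 0%N _ _ 0) 1?eq_sym //.
  have L : linear (fun u => ev f (merge_at m (g u))).
    apply: (@ev_lin _ _ _ A _ f i.-1 id) => //; first lia.
      move=> u; rewrite /merge_at m0 /=; have -> : i.-1.+1 = i by lia.
      exact: gi.
    by move=> u v j jn ji; rewrite /merge_at m0 /=; apply: const; lia.
  by rewrite L; apply: lact_linear.
case: (ltnP n m) => [mn|mn].
  move=> c x y; have [i_e|i_e] := eqVneq i n.
    have S u v : ev f (merge_at m (g u)) = ev f (merge_at m (g v)).
      apply: same => j jn; rewrite /merge_at (leq_ltn_trans jn mn); apply: const; lia.
    have gn u : g u n = u by rewrite /g i_e eqxx.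
    rewrite (S x (c *: x + y)) (S y (c *: x + y)) !gn.
    exact: (ract_linearr (ev f (merge_at m (g (c *: x + y)))) c x y).
  rewrite !(const n _ _ 0) 1?eq_sym //.
  have L : linear (fun u => ev f (merge_at m (g u))).
    apply: (@ev_lin _ _ _ A _ f i id) => //; first lia.
      by move=> u; rewrite /merge_at gi; have -> : (i.+1 < m)%N by lia.
    by move=> u v j jn ji; rewrite /merge_at (leq_ltn_trans jn mn); apply: const.
  by rewrite L; apply: ract_linear.
have [lt_im|le_mi] := ltnP i.+1 m.
  apply: (@ev_lin _ _ _ A _ f i id _ _ (@linear_id k A)) => [|u|u v j jn ji].
  - by lia.
  - by rewrite /merge_at lt_im.
  rewrite /merge_at (const j ji u v); case: ifP => // jm'; case: ifP => [/eqP jm|jm].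
    by rewrite (const j.+1 _ u v) //; lia.
  by rewrite (const j.+1 _ u v) //; lia.
have [im|im] := eqVneq i.+1 m.
  apply: (@ev_lin _ _ _ A _ f i (fun x => x * g 0 i.+1)) => [|||u v j jn ji].
  - by lia.
  - exact/linear_mulr/linear_id.
  - move=> u; rewrite /merge_at; have -> : (i.+1 < m)%N = false by lia.
    by rewrite {1}im eqxx gi (const i.+1 _ u 0) //; lia.
  rewrite /merge_at (const j ji u v); case: ifP => // jm'; case: ifP => [/eqP jm|jm].
    by exfalso; lia.
  case: (eqVneq j.+1 i) => [ji'|ji']; first by exfalso; lia.
  by rewrite (const j.+1 _ u v).
have [im'|im'] := eqVneq i m.
  apply: (@ev_lin _ _ _ A _ f i.-1 (fun x => g 0 i.-1 * x)) => [|||u v j jn ji].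
  - by lia.
  - exact/linear_mull/linear_id.
  - move=> u; rewrite /merge_at; have -> : (i.-1.+1 = i)%N by lia.
    have -> : (i < m)%N = false by lia.
    by rewrite {1}im' eqxx gi (const i.-1 _ u 0) //; lia.
  rewrite /merge_at; case: ifP => j1; first by apply: const; lia.
  case: ifP => j2; first by exfalso; lia.
  by apply: const; lia.
apply: (@ev_lin _ _ _ A _ f i.-1 id _ _ (@linear_id k A)) => [|u|u v j jn ji].
- by lia.
- rewrite /merge_at; have -> : (i.-1.+1 = i)%N by lia.
  have -> : (i < m)%N = false by lia.
  by rewrite (negbTE im') gi.
rewrite /merge_at; case: ifP => j1; first by apply: const; lia.
case: ifP => j2; last by apply: const; lia.
by rewrite (const j _ u v) ?(const j.+1 _ u v) //; lia.
Qed.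

Definition face : mlin A M n.+1 := Mlin face_multilinear.

Lemma ev_face (g : nat -> A) : ev face g = outer m n g (ev f (merge_at m g)).
Proof. by rewrite -face_funE. Qed.

End Face.

Lemma face_lin n m : linear (@face n m).
Proof.
move=> c f f'; apply: mlin_ev => g; rewrite evD evZ !ev_face evD evZ /outer.
case: ifP => _; first exact: lact_linear.
by case: ifP => _; [exact: ract_linear |].
Qed.

Lemma face_face n i j (f : mlin A M n) : (i < j <= n.+2)%N ->
  face j (face i f) = face i (face j.-1 f).
Proof.
move=> ij; apply: mlin_ev => g; rewrite !ev_face.
have -> : ev f (merge_at j.-1 (merge_at i g)) = ev f (merge_at i (merge_at j g)).
  apply: ev_ext => l ln; rewrite /merge_at.
  do ?[case: ifP => ?]; rewrite ?mulrA; try lia; try by [].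
rewrite /outer /merge_at.
by do ?[case: ifP => ?]; rewrite ?(lactM, ractM, lractA); try lia.
Qed.

(** Hochschild's differential. *)
Definition hd n (f : mlin A M n) : mlin A M n.+1 :=
  \sum_(0 <= m < n.+2) (-1) ^+ m *: face m f.

Lemma hd_lin n : linear (@hd n).
Proof.
move=> c f f'; rewrite /hd scaler_sumr -big_split; apply: eq_bigr => m _ /=.
by rewrite face_lin scalerDr !scalerA mulrC.
Qed.

Lemma hd_hd n (f : mlin A M n) : hd (hd f) = 0.
Proof. exact: (@alternating_square k (fun n => mlin A M n) _ face_lin face_face). Qed.

Lemma hdE n (f : mlin A M n) a : hochschild_d f a = hd f a.
Proof.
have E m : (face m f : mlin A M n.+1) a = outer m n (nth 0 a) (ev f (merge_at m (nth 0 a))).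
  by rewrite evE ev_face.
rewrite /hd big_mkord mlin_sum big_ord_recl big_ord_recr addrA /hochschild_d.
congr (_ + _ + _).
- by rewrite expr0 scale1r E.
- apply: eq_bigr => i _; rewrite mlinZ E lift0 /outer /=; congr (_ *: _).
  have -> : (n < i.+1)%N = false by have := ltn_ord i; lia.
  rewrite /ev; congr (mlin_fun f _); apply: eq_from_tnth => j; rewrite !tnth_mktuple.
  by rewrite /merge_at ltnS eqSS; case: ifP => // _; rewrite -val_eqE /=; case: eqP => // ->.
rewrite mlinZ E lift0 /outer /= ltnSn; congr (_ *: ract _ _).
rewrite /ev; congr (mlin_fun f _); apply: eq_from_tnth => j; rewrite !tnth_mktuple.
by rewrite /merge_at ltnS ltn_ord.
Qed.

Lemma is_cocycle_hd n (f : mlin A M n) : is_cocycle f <-> hd f = 0.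
Proof.
split=> [cf|hf a]; last by rewrite hdE hf.
by apply/mlinP => a; rewrite -hdE cf.
Qed.

Lemma is_coboundary_hd n (f : mlin A M n.+1) :
  is_coboundary f <-> exists g, f = hd g.
Proof.
split=> -[g fg]; exists g; first by apply/mlinP => a; rewrite -hdE fg.
by move=> a; rewrite hdE fg.
Qed.

End HochschildComplex.

Lemma bhom_compE (k : comPzRingType) (A : algType k) (M N : bimodule A) (h : bhom M N) n
    (f : mlin A M n) a : bhom_comp h f a = h (f a).
Proof. by []. Qed.

Section BimoduleMaps.
Variables (k : comPzRingType) (A : algType k).
Implicit Types M N : bimodule A.

Lemma bhom_lin M N (h : bhom M N) : linear h.
Proof. by case: (bhom_is_bimodule_map h). Qed.
Lemma bhom_lact M N (h : bhom M N) a x : h (lact a x) = lact a (h x).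
Proof. by case: (bhom_is_bimodule_map h). Qed.
Lemma bhom_ract M N (h : bhom M N) x a : h (ract x a) = ract (h x) a.
Proof. by case: (bhom_is_bimodule_map h). Qed.

(** The element of [bhom M N] given by a map of bimodules. *)
Definition Bhom M N (h : M -> N) (bh : is_bimodule_map h) : bhom M N :=
  @to_sub _ _ (bimodule_maps M N) h bh.

Lemma bhomP M N (h h' : bhom M N) : h =1 h' -> h = h'.
Proof. by move=> /funext hh'; apply: val_inj. Qed.

Fact bcomp_bimodule_map M N L (h' : bhom N L) (h : bhom M N) :
  is_bimodule_map (fun x => h' (h x)).
Proof.
split; first exact: lin_comp (bhom_lin h) (bhom_lin h').
  by move=> a x; rewrite !bhom_lact.
by move=> x a; rewrite !bhom_ract.
Qed.
(** Composition of maps of bimodules. *)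
Definition bcomp M N L (h' : bhom N L) (h : bhom M N) : bhom M L :=
  Bhom (bcomp_bimodule_map h' h).

Lemma bhom_comp_lin M N (h : bhom M N) n : linear (@bhom_comp k A M N h n).
Proof. by move=> c f f'; apply/mlinP => a; apply: bhom_lin. Qed.

Lemma hd_comp M N (h : bhom M N) n (f : mlin A M n) :
  hd (bhom_comp h f) = bhom_comp h (hd f).
Proof.
rewrite /hd (lin_sum (@bhom_comp_lin _ _ h _)); apply: eq_bigr => m _.
rewrite (linZ (@bhom_comp_lin _ _ h _)); congr (_ *: _); apply: mlin_ev => g.
rewrite ev_face -[RHS]/(h (ev (face m f) g)) ev_face /outer.
by case: ifP => _; [rewrite bhom_lact | case: ifP => _ //; rewrite bhom_ract].
Qed.

End BimoduleMaps.

Lemma homkD (k : comPzRingType) (U V : lmodType k) (f g : homk U V) x :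
  homk_fun (f + g) x = f x + g x.
Proof. by []. Qed.
Lemma homkZ (k : comPzRingType) (U V : lmodType k) c (f : homk U V) x :
  homk_fun (c *: f) x = c *: f x.
Proof. by []. Qed.

(** * Lifting along surjections *)

Section Lifting.
Variable k : comPzRingType.

Section Image.
Variables (U V : lmodType k) (g : U -> V) (lg : linear g).

Fact lin_image0 : exists u, g u = 0. Proof. by exists 0; apply: lin0. Qed.
Fact lin_image_lin (c : k) v w :
  (exists u, g u = v) -> (exists u, g u = w) -> exists u, g u = c *: v + w.
Proof. by move=> [u <-] [u' <-]; exists (c *: u + u'); apply: lg. Qed.
(** The image of a linear map. *)
Definition lin_image : submodule V := Submodule lin_image0 lin_image_lin.

End Image.

(** Projectivity in terms of elements: it is enough that the values of [f] lift. *)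
Lemma proj_lift (P U V : lmodType k) (g : U -> V) (f : P -> V) :
  projective_module P -> linear g -> linear f -> (forall x, exists u, g u = f x) ->
  exists h : homk P U, forall x, g (h x) = f x.
Proof.
move=> pP lg lf fg; pose I := lin_image lg.
have lg' : linear (fun u => @to_sub _ _ I (g u) (ex_intro _ u erefl)).
  by move=> c u u'; apply: val_inj; apply: lg.
have lf' : linear (fun x => @to_sub _ _ I (f x) (fg x)).
  by move=> c x x'; apply: val_inj; apply: lf.
have [|h gh] := pP _ _ (Homk lg') (Homk lf').
  move=> v; have [u gu] := sub_of_in v.
  by exists u; apply: val_inj; rewrite /= gu.
by exists h => x; have := congr1 (@sub_val _ _ I) (gh x).
Qed.

Lemma homk_surjective (P U V : lmodType k) (g : homk U V) :
  projective_module P -> surjective g ->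
  forall f : homk P V, exists h : homk P U, forall x, g (h x) = f x.
Proof.
move=> pP sg f; apply: (proj_lift pP (homk_linear g) (homk_linear f)) => x.
exact: sg.
Qed.

Variable A : algType k.
Hypothesis pA : projective_module A.

(** Multilinear maps on a projective module lift as well: the first argument is
    separated from the other ones. *)
Lemma mlin_lift (U V : lmodType k) (g : U -> V) (lg : linear g) n (f : mlin A V n) :
  (forall a, exists u, g u = f a) ->
  exists h : mlin A U n, forall a, g (h a) = f a.
Proof.
elim: n f => [|n IHn] f fg.
  have [u gu] := fg [tuple].
  have mu : multilinear (fun _ : 0.-tuple A => u) by case.
  by exists (Mlin mu) => a; rewrite (tuple0 a).
pose cons x (s : nat -> A) j := if j is j'.+1 then s j' else x.
(* [f] as a function of its first argument *)
have mf x : multilinear (fun a : n.-tuple A => ev f (cons x (nth 0 a))).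
  move=> i a; apply: (@ev_lin _ _ _ A _ f i.+1 id) => [|//|y|y z [|j] // jn ji].
  - by rewrite ltnS.
  - by rewrite /= nth_upd eqxx.
  rewrite /= !nth_upd.
  by rewrite -[j == i](eqSS j i) (negbTE ji).
pose F x : mlin A V n := Mlin (mf x).
have lF : linear F.
  move=> c x y; apply/mlinP => a.
  apply: (@ev_lin _ _ _ A _ f 0 id (fun x => cons x (nth 0 a))) => // u v [|j] //.
have mG (h : mlin A U n) : multilinear (fun a => g (h a)).
  by move=> i a c x y; rewrite (mlin_multilinear h) lg.
pose G h : mlin A V n := Mlin (mG h).
have lG : linear G by move=> c h h'; apply/mlinP => a; apply: lg.
have [x|H GH] := proj_lift pA lG lF.
  have [a|h gh] := IHn (F x); first exact: fg.
  by exists h; apply/mlinP.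
have mH : multilinear (fun a : n.+1.-tuple A => ev (H a`_0) (fun j => a`_j.+1)).
  move=> [i i_n] a; case: i i_n => [|i] i_n.
    have E x : ev (H (upd a (Ordinal i_n) x)`_0) (fun j => (upd a (Ordinal i_n) x)`_j.+1) =
        ev (H x) (fun j => a`_j.+1).
      by rewrite nth_upd eqxx; apply: ev_ext => j jn; rewrite nth_upd.
    by move=> c x y; rewrite !E homk_linear.
  have E x : (upd a (Ordinal i_n) x)`_0 = a`_0 by rewrite nth_upd.
  suff L : linear (fun x => ev (H a`_0) (fun j => (upd a (Ordinal i_n) x)`_j.+1)).
    by move=> c x y; rewrite !E; apply: L.
  apply: (@ev_lin _ _ _ A _ (H a`_0) i id) => //.
    by move=> x; rewrite nth_upd eqxx.
  by move=> x y j jn ji; rewrite !nth_upd /= eqSS (negbTE ji).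
exists (Mlin mH) => a; transitivity (ev (G (H a`_0)) (fun j => a`_j.+1)); first by [].
rewrite GH (evE f) -[LHS]/(ev f (cons a`_0 (nth 0 [tuple a`_j.+1 | j < n]))).
apply: ev_ext => -[|j] // jn.
rewrite ltnS in jn; have := nth_tuple_fun 0 n (fun j => a`_j.+1) j; rewrite jn.
by [].
Qed.

End Lifting.

(** * Coinduced bimodules *)

Section Coinduced.
Variables (k : comPzRingType) (A : algType k) (V : lmodType k).
Local Notation C := (homk A (homk A V)).

(** The value of a [k]-bilinear map from [A x A] to [V]. *)
Definition ap2 (F : C) (x y : A) : V := (F x : homk A V) y.

Lemma ap2_linl F y : linear (fun x => ap2 F x y).
Proof. by move=> c x x'; rewrite /ap2 homk_linear. Qed.
Lemma ap2_linr F x : linear (ap2 F x).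
Proof. exact: homk_linear. Qed.

Lemma homk2P (F G : C) : (forall x y, ap2 F x y = ap2 G x y) -> F = G.
Proof. by move=> FG; apply/homkP => x; apply/homkP => y; apply: FG. Qed.

Section Bilinear.
Variable f : A -> A -> V.
Hypotheses (fl : forall y, linear (f^~ y)) (fr : forall x, linear (f x)).
Fact bilinear_subproof : linear (fun x : A => Homk (fr x)).
Proof. by move=> c x y; apply/homkP => z; apply: fl. Qed.
(** The element of [C] given by a bilinear function. *)
Definition Homk2 : C := Homk bilinear_subproof.
Lemma ap2E x y : ap2 Homk2 x y = f x y. Proof. by []. Qed.
End Bilinear.

Fact coind_lact_linl (a : A) (F : C) y : linear (fun x => ap2 F (x * a) y).
Proof. by move=> c x x'; rewrite mulrDl -scalerAl ap2_linl. Qed.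
Fact coind_lact_linr (a : A) (F : C) x : linear (fun y => ap2 F (x * a) y).
Proof. exact: ap2_linr. Qed.
Definition coind_lact a F : C := Homk2 (coind_lact_linl a F) (coind_lact_linr a F).

Fact coind_ract_linl (F : C) (b : A) y : linear (fun x => ap2 F x (b * y)).
Proof. exact: ap2_linl. Qed.
Fact coind_ract_linr (F : C) (b : A) x : linear (fun y => ap2 F x (b * y)).
Proof. by move=> c y y'; rewrite mulrDr -scalerAr ap2_linr. Qed.
Definition coind_ract F b : C := Homk2 (coind_ract_linl F b) (coind_ract_linr F b).

Lemma ap2_lact a F x y : ap2 (coind_lact a F) x y = ap2 F (x * a) y. Proof. by []. Qed.
Lemma ap2_ract a F x y : ap2 (coind_ract F a) x y = ap2 F x (a * y). Proof. by []. Qed.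
Lemma ap2D F G x y : ap2 (F + G) x y = ap2 F x y + ap2 G x y.
Proof. by rewrite /ap2 homkD homkD. Qed.
Lemma ap2Z c F x y : ap2 (c *: F) x y = c *: ap2 F x y.
Proof. by rewrite /ap2 homkZ homkZ. Qed.
Let ap2S := (ap2D, ap2Z, ap2_lact, ap2_ract).

Fact coind_lact_linear a : linear (coind_lact a).
Proof. by move=> c F G; apply: homk2P => x y; rewrite !ap2S. Qed.
Fact coind_lact_linearl F : linear (coind_lact^~ F).
Proof. by move=> c a b; apply: homk2P => x y; rewrite !ap2S mulrDr -scalerAr ap2_linl. Qed.
Fact coind_ract_linear b : linear (coind_ract^~ b).
Proof. by move=> c F G; apply: homk2P => x y; rewrite !ap2S. Qed.
Fact coind_ract_linearr F : linear (coind_ract F).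
Proof. by move=> c a b; apply: homk2P => x y; rewrite !ap2S mulrDl -scalerAl ap2_linr. Qed.
Fact coind_lact1 F : coind_lact 1 F = F.
Proof. by apply: homk2P => x y; rewrite ap2S mulr1. Qed.
Fact coind_lactM a b F : coind_lact (a * b) F = coind_lact a (coind_lact b F).
Proof. by apply: homk2P => x y; rewrite !ap2S mulrA. Qed.
Fact coind_ract1 F : coind_ract F 1 = F.
Proof. by apply: homk2P => x y; rewrite ap2S mul1r. Qed.
Fact coind_ractM F a b : coind_ract F (a * b) = coind_ract (coind_ract F a) b.
Proof. by apply: homk2P => x y; rewrite !ap2S mulrA. Qed.
Fact coind_lractA a F b :
  coind_lact a (coind_ract F b) = coind_ract (coind_lact a F) b.
Proof. by apply: homk2P => x y; rewrite !ap2S. Qed.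

(** The coinduced bimodule, with [(a F b) (x, y) = F (x a, b y)]. *)
Definition coind : bimodule A := Bimodule coind_lact_linear coind_lact_linearl
  coind_ract_linear coind_ract_linearr coind_lact1 coind_lactM coind_ract1 coind_ractM
  coind_lractA.

End Coinduced.

Section CoinducedMaps.
Variables (k : comPzRingType) (A : algType k).
Implicit Types (M P : bimodule A) (V W : lmodType k).

(** A linear map from a bimodule [P] to [V] is a bimodule map from [P] to the bimodule
    coinduced from [V]. *)
Section Adjoint.
Variables (P : bimodule A) (V : lmodType k) (f : P -> V).
Hypothesis lf : linear f.

Fact adjoint_linl p y : linear (fun x => f (ract (lact x p) y)).
Proof. exact: lin_comp (lin_comp (lact_linearl p) (ract_linear y)) lf. Qed.
Fact adjoint_linr p x : linear (fun y => f (ract (lact x p) y)).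
Proof. exact: lin_comp (ract_linearr _) lf. Qed.
(** [p] is sent to [(x, y) |-> f (x p y)]. *)
Definition adjoint_fun p : coind A V := Homk2 (adjoint_linl p) (adjoint_linr p).

Fact adjoint_bimodule_map : is_bimodule_map adjoint_fun.
Proof.
split.
- move=> c p q; apply: homk2P => x y.
  by rewrite ap2D ap2Z !ap2E lact_linear ract_linear lf.
- by move=> a p; apply: homk2P => x y; rewrite ap2_lact !ap2E lactM.
by move=> p a; apply: homk2P => x y; rewrite ap2_ract !ap2E lractA ractM.
Qed.
Definition adjoint : bhom P (coind A V) := Bhom adjoint_bimodule_map.

Lemma adjointE p x y : ap2 (adjoint p) x y = f (ract (lact x p) y). Proof. by []. Qed.
End Adjoint.

(** A linear map induces a map of coinduced bimodules. *)
Section CoindMap.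
Variables (V W : lmodType k) (g : V -> W).
Hypothesis lg : linear g.
Fact coind_map_linl (F : coind A V) y : linear (fun x => g (ap2 F x y)).
Proof. exact: lin_comp (ap2_linl F y) lg. Qed.
Fact coind_map_linr (F : coind A V) x : linear (fun y => g (ap2 F x y)).
Proof. exact: lin_comp (ap2_linr F x) lg. Qed.
Definition coind_map_fun F : coind A W := Homk2 (coind_map_linl F) (coind_map_linr F).
Fact coind_map_bimodule_map : is_bimodule_map coind_map_fun.
Proof.
split=> [c F G|a F|F a]; apply: homk2P => x y; rewrite ?(ap2_lact, ap2_ract) //.
by rewrite ap2D ap2Z !ap2E ap2D ap2Z lg.
Qed.
Definition coind_map : bhom (coind A V) (coind A W) := Bhom coind_map_bimodule_map.
Lemma coind_mapE F x y : ap2 (coind_map F) x y = g (ap2 F x y). Proof. by []. Qed.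
End CoindMap.

Hypothesis pA : projective_module A.

Lemma coind_map_surjective V W (g : homk V W) :
  surjective g -> surjective (coind_map (homk_linear g)).
Proof.
move=> sg F; pose F' : homk A (homk A W) := F.
pose G (h : homk A V) : homk A W := Homk (lin_comp (homk_linear h) (homk_linear g)).
have lG : linear G by move=> c h h'; apply/homkP => x; rewrite /= homk_linear.
have [x|H GH] := proj_lift pA lG (homk_linear F').
  have [h gh] := homk_surjective pA sg (F' x : homk A W).
  by exists h; apply/homkP.
exists H; apply: homk2P => x y; rewrite coind_mapE.
exact: (congr1 (fun h : homk A W => h y) (GH x)).
Qed.

(** Since [A] is projective over [k], so is every projective bimodule. *)
Lemma projective_bimodule_module P : projective_bimodule P -> projective_module P.
Proof.
move=> pP V W g f sg.
have [h gh] := pP _ _ _ (adjoint (homk_linear f)) (coind_map_surjective sg).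
have lh : linear (fun p => ap2 (h p) 1 1).
  by move=> c p q; rewrite bhom_lin ap2D ap2Z.
exists (Homk lh) => p; rewrite -[Homk lh p]/(ap2 (h p) 1 1).
by rewrite -(coind_mapE (homk_linear g)) gh adjointE lact1 ract1.
Qed.

End CoinducedMaps.

(** * Quotients of bimodules *)

(** The quotient of a bimodule by a submodule that is stable under both actions. *)
Section QuotientBimodule.
Variables (k : comPzRingType) (A : algType k) (M : bimodule A) (S : submodule M).
Hypotheses (S_lact : forall a x, S x -> S (lact a x)).
Hypotheses (S_ract : forall x a, S x -> S (ract x a)).
Local Notation Q := (quotient S).

Lemma cls_lin : linear (@cls k M S).
Proof. by move=> c x y; rewrite clsD -quotient_scaleE. Qed.

Lemma quotient_ind (T : Q -> Prop) : (forall x, T (cls x)) -> forall q, T q.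
Proof. by move=> Tc q; rewrite -[q]cls_repr; apply: Tc. Qed.

(** The actions on the quotient, computed with representatives. *)
Definition quot_lact (a : A) (q : Q) : Q := cls (lact a (repr (q : Quotient.quot (carrierb S)))).
Definition quot_ract (q : Q) (a : A) : Q := cls (ract (repr (q : Quotient.quot (carrierb S))) a).

Lemma quot_lactE a x : quot_lact a (cls x) = cls (lact a x).
Proof.
apply/cls_eq; rewrite -(linB (lact_linear a)); apply/S_lact/cls_eq; exact: cls_repr.
Qed.
Lemma quot_ractE x a : quot_ract (cls x) a = cls (ract x a).
Proof.
apply/cls_eq; rewrite -(linB (ract_linear a)); apply/S_ract/cls_eq; exact: cls_repr.
Qed.
Let quotE := (quot_lactE, quot_ractE).

Fact quot_lact_linear a : linear (quot_lact a).
Proof.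
move=> c; elim/quotient_ind => x; elim/quotient_ind => y.
by rewrite -cls_lin !quotE lact_linear cls_lin.
Qed.
Fact quot_lact_linearl q : linear (quot_lact^~ q).
Proof. by elim/quotient_ind: q => x c a b; rewrite !quotE lact_linearl cls_lin. Qed.
Fact quot_ract_linear a : linear (quot_ract^~ a).
Proof.
move=> c; elim/quotient_ind => x; elim/quotient_ind => y.
by rewrite -cls_lin !quotE ract_linear cls_lin.
Qed.
Fact quot_ract_linearr q : linear (quot_ract q).
Proof. by elim/quotient_ind: q => x c a b; rewrite !quotE ract_linearr cls_lin. Qed.
Fact quot_lact1 q : quot_lact 1 q = q.
Proof. by elim/quotient_ind: q => x; rewrite quotE lact1. Qed.
Fact quot_lactM a b q : quot_lact (a * b) q = quot_lact a (quot_lact b q).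
Proof. by elim/quotient_ind: q => x; rewrite !quotE lactM. Qed.
Fact quot_ract1 q : quot_ract q 1 = q.
Proof. by elim/quotient_ind: q => x; rewrite quotE ract1. Qed.
Fact quot_ractM q a b : quot_ract q (a * b) = quot_ract (quot_ract q a) b.
Proof. by elim/quotient_ind: q => x; rewrite !quotE ractM. Qed.
Fact quot_lractA a q b : quot_lact a (quot_ract q b) = quot_ract (quot_lact a q) b.
Proof. by elim/quotient_ind: q => x; rewrite !quotE lractA. Qed.

Definition quotient_bimodule : bimodule A := Bimodule quot_lact_linear quot_lact_linearl
  quot_ract_linear quot_ract_linearr quot_lact1 quot_lactM quot_ract1 quot_ractM
  quot_lractA.

Fact quotient_map_bimodule_map : @is_bimodule_map _ _ M quotient_bimodule (@cls k M S).
Proof. by split; [exact: cls_lin | move=> a x; rewrite -quotE | move=> x a; rewrite -quotE]. Qed.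
Definition quotient_map : bhom M quotient_bimodule := Bhom quotient_map_bimodule_map.

Lemma quotient_map_surjective : surjective quotient_map.
Proof. by elim/quotient_ind => x; exists x. Qed.

End QuotientBimodule.

(** * Embedding a bimodule in a coinduced one *)

Section Embedding.
Variables (k : comPzRingType) (A : algType k) (M : bimodule A).

Fact id_linear : linear (@id M). Proof. by []. Qed.

(** The map [m |-> ((x, y) |-> x m y)]; evaluation at [(1, 1)] is a linear retraction. *)
Definition embed : bhom M (coind A M) := adjoint id_linear.

Lemma embedE m x y : ap2 (embed m) x y = ract (lact x m) y. Proof. by []. Qed.
Lemma embed_eval m : ap2 (embed m) 1 1 = m. Proof. by rewrite embedE lact1 ract1. Qed.

Definition embed_image : submodule (coind A M) := lin_image (bhom_lin embed).
Fact embed_image_lact a F : embed_image F -> embed_image (lact a F).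
Proof. by move=> [m <-]; exists (lact a m); rewrite bhom_lact. Qed.
Fact embed_image_ract F a : embed_image F -> embed_image (ract F a).
Proof. by move=> [m <-]; exists (ract m a); rewrite bhom_ract. Qed.

(** The cokernel of the embedding. *)
Definition coker : bimodule A := quotient_bimodule embed_image_lact embed_image_ract.
(** The projection to the cokernel. *)
Definition coker_map : bhom (coind A M) coker :=
  quotient_map embed_image_lact embed_image_ract.

Lemma coker_map_surjective : surjective coker_map.
Proof. exact: quotient_map_surjective. Qed.

Lemma coker_map_embed m : coker_map (embed m) = 0.
Proof.
rewrite -(lin0 (bhom_lin coker_map)); apply/(@cls_eq _ _ embed_image).
by exists m; rewrite subr0.
Qed.

Lemma coker_map_eq0 F : coker_map F = 0 -> embed (ap2 F 1 1) = F.
Proof.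
rewrite -(lin0 (bhom_lin coker_map)) => /(@cls_eq _ _ embed_image) [m].
by rewrite subr0 => <-; rewrite embed_eval.
Qed.

(** A map to the coinduced bimodule which vanishes in the cokernel factors through
    the bimodule; the factorization is the value at [(1, 1)]. *)
Lemma bhom_descent (P : bimodule A) (F : bhom P (coind A M)) :
  (forall x, coker_map (F x) = 0) -> exists f : bhom P M, forall x, embed (f x) = F x.
Proof.
move=> F0; have E x : embed (ap2 (F x) 1 1) = F x by apply: coker_map_eq0.
have bf : is_bimodule_map (fun x => ap2 (F x) 1 1).
  split=> [c x y|a x|x a]; first by rewrite bhom_lin ap2D ap2Z.
    by rewrite bhom_lact -{1}E -bhom_lact embed_eval.
  by rewrite bhom_ract -{1}E -bhom_ract embed_eval.
by exists (Bhom bf).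
Qed.

Lemma mlin_descent n (F : mlin A (coind A M) n) :
  bhom_comp coker_map F = 0 -> exists f : mlin A M n, bhom_comp embed f = F.
Proof.
move=> F0; have mf : multilinear (fun a => ap2 (F a) 1 1).
  by move=> i a c x y; rewrite (mlin_multilinear F) ap2D ap2Z.
exists (Mlin mf); apply/mlinP => a; rewrite bhom_compE -[Mlin mf a]/(ap2 (F a) 1 1).
by apply: coker_map_eq0; rewrite -bhom_compE F0.
Qed.

Lemma embed_inj n (f g : mlin A M n) : bhom_comp embed f = bhom_comp embed g -> f = g.
Proof.
move=> fg; apply/mlinP => a.
by rewrite -(embed_eval (f a)) -(embed_eval (g a)) -!bhom_compE fg.
Qed.

End Embedding.

(** * Acyclicity of coinduced bimodules *)

Section CoinducedAcyclic.
Variables (k : comPzRingType) (A : algType k) (V : lmodType k).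
Local Notation I := (coind A V).

(** The sequence [s] with [x] put before it. *)
Definition cons_fun (x : A) (s : nat -> A) (j : nat) : A := if j is j'.+1 then s j' else x.

(** The cochain [(a_1, .., a_n) |-> ((x, y) |-> F (x, a_1, .., a_n) (1, y))]. *)
Section Contraction.
Variables (n : nat) (F : mlin A I n.+1).

Fact contraction_linl (s : nat -> A) y :
  linear (fun x => ap2 (ev F (cons_fun x s)) 1 y).
Proof.
have L : linear (fun x => ev F (cons_fun x s)).
  by apply: (@ev_lin _ _ _ A _ F 0 id) => // x x' [].
by move=> c x x'; rewrite L ap2D ap2Z.
Qed.
Fact contraction_linr (s : nat -> A) x :
  linear (fun y => ap2 (ev F (cons_fun x s)) 1 y).
Proof. exact: ap2_linr. Qed.
Definition contraction_fun (a : n.-tuple A) : I :=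
  Homk2 (contraction_linl (nth 0 a)) (contraction_linr (nth 0 a)).

Fact contraction_multilinear : multilinear contraction_fun.
Proof.
move=> i a c u v; apply: homk2P => x y; rewrite ap2D ap2Z !ap2E.
have L : linear (fun z => ev F (cons_fun x (nth 0 (upd a i z)))).
  apply: (@ev_lin _ _ _ A _ F i.+1 id) => [|//|z|z z' [|j] // jn ji].
  - by rewrite ltnS.
  - by rewrite /= nth_upd eqxx.
  by rewrite /= !nth_upd -[j == i](eqSS j i) (negbTE ji).
by rewrite L ap2D ap2Z.
Qed.
Definition contraction : mlin A I n := Mlin contraction_multilinear.

Lemma ev_contraction (s : nat -> A) x y :
  ap2 (ev contraction s) x y = ap2 (ev F (cons_fun x s)) 1 y.
Proof.
rewrite -[LHS]/(ap2 (ev F (cons_fun x (nth 0 [tuple s j | j < n]))) 1 y).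
congr (ap2 _ 1 y); apply: ev_ext => -[|j] // jn.
rewrite ltnS in jn; have := nth_tuple_fun 0 n s j; rewrite jn.
by [].
Qed.

End Contraction.

Lemma coind_acyclic n (F : mlin A I n.+1) : hd F = 0 -> exists G, F = hd G.
Proof.
move=> hF; exists (contraction F); apply: mlin_ev => g; apply: homk2P => x y.
have L m t u v : linear (fun f : mlin A I m => ap2 (ev f t) u v).
  by move=> c f f'; rewrite evD evZ ap2D ap2Z.
have hdL m (f : mlin A I m) t u v : ap2 (ev (hd f) t) u v =
    \sum_(0 <= i < m.+2) (-1) ^+ i *: ap2 (ev (face i f) t) u v.
  by rewrite /hd (lin_sum (L _ t u v)); apply: eq_bigr => i _; apply: (linZ (L _ t u v)).
have := hdL _ F (cons_fun x g) 1 y; rewrite hF (lin0 (L _ _ _ _)) hdL.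
rewrite big_nat_recl // expr0 scale1r.
have -> : ap2 (ev (face 0 F) (cons_fun x g)) 1 y = ap2 (ev F g) x y.
  by rewrite ev_face ap2_lact mul1r; congr (ap2 _ x y); apply: ev_ext.
move=> /esym/eqP; rewrite addr_eq0 => /eqP ->.
rewrite -sumrN; apply: eq_big_nat => m mn.
rewrite exprS mulN1r scaleNr opprK; congr (_ *: _).
rewrite !ev_face /outer /=; case: (posnP m) => [->|m_gt0] /=.
  rewrite ap2_lact ev_contraction; congr (ap2 _ 1 y).
  by apply: ev_ext => -[|j] jn.
have E : ev F (merge_at m.+1 (cons_fun x g)) = ev F (cons_fun x (merge_at m g)).
  apply: ev_ext => -[|j] jn; rewrite /merge_at /=; last by rewrite !eqSS !ltnS.
  by rewrite !ltnS m_gt0.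
rewrite ltnS; case: ifP => _; last by rewrite ev_contraction E.
by rewrite !ap2_ract ev_contraction E.
Qed.

End CoinducedAcyclic.

(** * Cohomology by a projective resolution *)

Section Resolution.
Variables (k : comPzRingType) (A : algType k) (P : resolution A).
Hypothesis pA : projective_module A.
Local Notation d n := (res_d P n).
Local Notation eps := (res_eps P).

Lemma res_dd n x : d n (d n.+1 x) = 0.
Proof. by apply/res_exact; exists x. Qed.
Lemma res_eps_d x : eps (d 0 x) = 0.
Proof. by apply/res_exact0; exists x. Qed.

Lemma res_module n : projective_module (P n).
Proof. exact: (projective_bimodule_module pA (@res_projective _ _ P n)). Qed.

(** Over [k], the resolution splits. *)
Lemma res_split n : exists s : homk (P n) (P n.+1), forall x, d n (s (d n x)) = d n x.
Proof.
elim: n => [|n [s sE]].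
  have lid : linear (@id (regular A)) by [].
  have [x|t tE] := proj_lift pA (bhom_lin eps) lid; first exact: (res_eps_surj P x).
  have lf : linear (fun x => x - t (eps x)).
    move=> c x y; rewrite (bhom_lin eps) homk_linear opprD addrACA.
    by rewrite -scalerBr.
  have [x|s sE] := proj_lift (@res_module 0) (bhom_lin (d 0)) lf.
    by apply/res_exact0; rewrite (linB (bhom_lin eps)) tE subrr.
  by exists s => x; rewrite sE res_eps_d (lin0 (homk_linear t)) subr0.
have lf : linear (fun x => x - s (d n x)).
  move=> c x y; rewrite (bhom_lin (d n)) homk_linear opprD addrACA.
  by rewrite -scalerBr.
have [x|s' sE'] := proj_lift (@res_module n.+1) (bhom_lin (d n.+1)) lf.
  by apply/res_exact; rewrite (linB (bhom_lin (d n))) sE subrr.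
by exists s' => x; rewrite sE' res_dd (lin0 (homk_linear s)) subr0.
Qed.

(** Maps of bimodules to a coinduced one are linear maps, and the resolution splits
    over [k]. *)
Lemma ext_coind_acyclic (V : lmodType k) n (f : bhom (P n.+1) (coind A V)) :
  is_ext_cocycle f -> is_ext_coboundary f.
Proof.
move=> cf; have [s sE] := res_split n.
have lh : linear (fun x => ap2 (f (s x)) 1 1).
  by move=> c x y; rewrite homk_linear bhom_lin ap2D ap2Z.
exists (adjoint lh) => q; apply: homk2P => x y; rewrite adjointE.
rewrite -bhom_lact -bhom_ract; set r := ract (lact x q) y.
have /res_exact[z zE] : d n (s (d n r) - r) = 0.
  by rewrite (linB (bhom_lin (d n))) sE subrr.
have -> : s (d n r) = d n.+1 z + r by rewrite zE subrK.
rewrite (linD (bhom_lin f)) cf add0r /r bhom_ract bhom_lact.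
by rewrite ap2_ract ap2_lact mul1r mulr1.
Qed.

(** * The comparison map *)

(** The differential of the map vanishes in the resolution: the condition under which it
    is the degree [n] part of a comparison map that goes on to degree [n + 1]. *)
Definition extendable n : mlin A (P n) n -> Prop :=
  match n with
  | 0 => fun t => bhom_comp eps (hd t) = 0
  | m.+1 => fun t => bhom_comp (d m) (hd t) = 0
  end.

Lemma comparison_step n (t : mlin A (P n) n) : extendable t ->
  exists u : mlin A (P n.+1) n.+1, extendable u /\ bhom_comp (d n) u = hd t.
Proof.
move=> et; have lift a : exists u, d n u = hd t a.
  case: n t et a => [|n] t et a; [apply/res_exact0 | apply/res_exact].
    exact: (congr1 (fun f : mlin A (regular A) 1 => f a) et).
  exact: (congr1 (fun f : mlin A (P n) n.+2 => f a) et).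
have [u uE] := mlin_lift pA (bhom_lin (d n)) lift.
have duE : bhom_comp (d n) u = hd t by apply/mlinP.
by exists u; split=> //; rewrite /= -hd_comp duE hd_hd.
Qed.

Lemma comparison_exists : exists theta : forall n, mlin A (P n) n, is_comparison theta.
Proof.
have [e1 e1E] := res_eps_surj P 1.
have m0 : multilinear (fun _ : 0.-tuple A => e1) by case.
pose t0 : mlin A (P 0) 0 := Mlin m0.
have et0 : extendable t0.
  apply/mlinP => a; rewrite -hd_comp -hdE /hochschild_d big_ord0 addr0 expr1.
  rewrite scaleN1r !bhom_compE -[t0 _]/e1 e1E.
  by rewrite -[lact _ _]/(a`_0 * 1) -[ract _ _]/(1 * a`_0) mulr1 mul1r subrr.
pose step n (t : {t : mlin A (P n) n | extendable t}) := cid (comparison_step (svalP t)).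
pose fix build n : {t : mlin A (P n) n | extendable t} :=
  if n is m.+1 then exist _ (sval (step m (build m))) (proj1 (svalP (step m (build m))))
  else exist _ t0 et0.
exists (fun n => sval (build n)); split=> [|n a]; first exact: e1E.
rewrite hdE -(proj2 (svalP (step n (build n)))).
by [].
Qed.

(** * The comparison isomorphism *)

Variable theta : forall n, mlin A (P n) n.
Hypothesis theta_comp : is_comparison theta.

Lemma theta_d n : bhom_comp (d n) (theta n.+1) = hd (theta n).
Proof. by apply/mlinP => a; rewrite -hdE; apply: (proj2 theta_comp). Qed.

Section Restriction.
Variable M : bimodule A.

(** A cochain of the resolution defines a Hochschild cochain. *)
Definition restr n (f : bhom (P n) M) : mlin A M n := bhom_comp f (theta n).

Lemma restr_lin n : linear (@restr n).
Proof. by move=> c f g; apply/mlinP. Qed.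

Lemma hd_restr n (f : bhom (P n) M) : hd (restr f) = restr (bcomp f (d n)).
Proof. by rewrite hd_comp -theta_d; apply/mlinP. Qed.

Lemma restr_cocycle n (f : bhom (P n) M) : is_ext_cocycle f -> hd (restr f) = 0.
Proof. by move=> cf; rewrite hd_restr; apply/mlinP => a; apply: cf. Qed.

Lemma restr_coboundary n (f : bhom (P n) M) :
  is_ext_coboundary f -> is_coboundary (restr f).
Proof.
case: n f => [|n] f; first by move=> ->; apply/mlinP.
move=> [g fg]; apply/is_coboundary_hd; exists (restr g); rewrite hd_restr.
by apply/mlinP => a; apply: fg.
Qed.

End Restriction.

Lemma restr_comp M N (h : bhom M N) n (f : bhom (P n) M) :
  restr (bcomp h f) = bhom_comp h (restr f).
Proof. exact/mlinP. Qed.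

(** The comparison in degree [n] is surjective, resp. injective, for all bimodules at
    once.  The induction on [n] replaces [M] by the cokernel of its embedding in a
    coinduced bimodule. *)
Definition restr_onto n : Prop := forall (M : bimodule A) (phi : mlin A M n),
  hd phi = 0 ->
  exists2 f : bhom (P n) M, is_ext_cocycle f & is_coboundary (restr f - phi).
Definition restr_into n : Prop := forall (M : bimodule A) (f : bhom (P n) M),
  is_ext_cocycle f -> is_coboundary (restr f) -> is_ext_coboundary f.

Lemma restr_into0 : restr_into 0.
Proof.
move=> M f cf rf; apply: bhomP => x.
have e1E : eps (theta 0 [tuple]) = 1 := proj1 theta_comp.
have /res_exact0[y yE] : eps (x - lact (eps x) (theta 0 [tuple])) = 0.
  rewrite (linB (bhom_lin eps)) bhom_lact e1E -[lact _ _]/(eps x * 1).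
  by rewrite mulr1 subrr.
have := cf y; rewrite yE (linB (bhom_lin f)) bhom_lact => /eqP.
have -> : f (theta 0 [tuple]) = 0.
  by have := congr1 (fun g : mlin A M 0 => g [tuple]) rf.
by rewrite (lin0 (lact_linear _)) subr0 => /eqP.
Qed.

Lemma restr_onto0 : restr_onto 0.
Proof.
move=> M phi hphi; pose m := phi [tuple].
have central a : lact a m = ract m a.
  have := congr1 (fun g : mlin A M 1 => g [tuple a]) hphi.
  rewrite -hdE /hochschild_d big_ord0 addr0 expr1 scaleN1r => /eqP.
  rewrite -[X in _ == X]/(0 : M) subr_eq0 /= => /eqP.
  by rewrite (tuple0 [tuple _ | _ < 0]) (tuple0 [tuple _ | _ < 0]).
have bf : is_bimodule_map (fun x => lact (eps x) m).
  split=> [c x y|a x|x a].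
  - by rewrite (bhom_lin eps) lact_linearl.
  - by rewrite bhom_lact -[lact a (eps x)]/(a * eps x) lactM.
  by rewrite bhom_ract -[ract (eps x) a]/(eps x * a) lactM central lractA.
exists (Bhom bf) => [y|].
  by rewrite -[LHS]/(lact (eps (d 0 y)) m) res_eps_d (lin0 (lact_linearl _)).
apply/mlinP => a; rewrite (tuple0 a) -[LHS]/(lact (eps (theta 0 [tuple])) m - m).
by rewrite (proj1 theta_comp) lact1 subrr.
Qed.

Implicit Types M N : bimodule A.

Lemma coboundary_comp M N (h : bhom M N) n (f : mlin A M n) :
  is_coboundary f -> is_coboundary (bhom_comp h f).
Proof.
case: n f => [|n] f; first by move=> ->; apply/mlinP => a; apply: lin0 (bhom_lin h).
move=> /is_coboundary_hd[g ->]; apply/is_coboundary_hd.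
by exists (bhom_comp h g); rewrite hd_comp.
Qed.

Lemma bhomB M n (f g : bhom (P n) M) x : bhom_fun (f - g) x = f x - g x.
Proof. by []. Qed.

Lemma is_coboundaryN M n (f : mlin A M n) : is_coboundary f -> is_coboundary (- f).
Proof.
move=> cf; rewrite -[- f]addr0 -scaleN1r.
exact: is_coboundary_lin cf (is_coboundary0 M n).
Qed.

(** A Hochschild cochain in a coinduced bimodule whose image in the cokernel is a
    coboundary has the differential of a cochain of the submodule. *)
Lemma coker_coboundary M n (F : mlin A (coind A M) n) :
  is_coboundary (bhom_comp (coker_map M) F) ->
  exists w : mlin A M n, hd F = bhom_comp (embed M) (hd w).
Proof.
case: n F => [|n] F.
  by move=> /mlin_descent[w <-]; exists w; rewrite hd_comp.
move=> /is_coboundary_hd[u uE].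
have [a|v vE] := mlin_lift pA (bhom_lin (coker_map M)) (f := u).
  exact: coker_map_surjective.
have [|w wE] := @mlin_descent _ _ M _ (F - hd v).
  rewrite (linB (@bhom_comp_lin _ _ _ _ _ _)) uE -hd_comp.
  by have -> : bhom_comp (coker_map M) v = u by [exact/mlinP]; rewrite subrr.
by exists w; rewrite -hd_comp wE (linB (@hd_lin _ _ _ _)) hd_hd subr0.
Qed.

Lemma coker_ext_coboundary M n (F : bhom (P n) (coind A M)) :
  is_ext_coboundary (bcomp (coker_map M) F) ->
  exists w : bhom (P n) M, forall x, F (d n x) = embed M (w (d n x)).
Proof.
case: n F => [|n] F.
  move=> F0; have [x|w wE] := @bhom_descent _ _ M _ F.
    exact: (congr1 (fun f : bhom (P 0) (coker M) => f x) F0).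
  by exists w => x; rewrite wE.
move=> [u uE]; have [v vE] := res_projective u (@coker_map_surjective _ _ M).
have [x|w wE] := @bhom_descent _ _ M _ (F - bcomp v (d n)).
  by rewrite bhomB (linB (bhom_lin (coker_map M))) vE -uE subrr.
exists w => x; rewrite wE bhomB -[bcomp v _ _]/(v (d n (d n.+1 x))).
by rewrite res_dd (lin0 (bhom_lin v)) subr0.
Qed.

Lemma restr_intoS n : restr_onto n -> restr_into n -> restr_into n.+1.
Proof.
move=> onto into M f cf /is_coboundary_hd[g gE].
have [y|h hE] := @ext_coind_acyclic M n (bcomp (embed M) f).
  by rewrite -[LHS]/(embed M (f (d n.+1 y))) cf (lin0 (bhom_lin (embed M))).
have dh : hd (restr h - bhom_comp (embed M) g) = 0.
  rewrite (linB (@hd_lin _ _ _ _)) hd_comp -gE hd_restr -restr_comp.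
  by apply/eqP; rewrite subr_eq0; apply/eqP/mlinP => a; rewrite /restr !bhom_compE hE.
have [c cc cE] := onto _ _ dh.
have cQ : is_ext_cocycle (bcomp (coker_map M) (h - c)).
  move=> y; rewrite -[LHS]/(coker_map M (h (d n y) - c (d n y))) cc subr0 -hE.
  exact: coker_map_embed.
have rQ : is_coboundary (restr (bcomp (coker_map M) (h - c))).
  have := coboundary_comp (coker_map M) cE => /is_coboundaryN; congr (is_coboundary _).
  apply/mlinP => a.
  rewrite -[LHS]/(- coker_map M (c (theta n a) - (h (theta n a) - embed M (g a)))).
  rewrite -[RHS]/(coker_map M (h (theta n a) - c (theta n a))) !(linB (bhom_lin (coker_map M))).
  by rewrite coker_map_embed subr0 opprB.
have [w wE] := coker_ext_coboundary (into _ _ cQ rQ).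
exists w => x; rewrite -[f x]embed_eval -[RHS]embed_eval -wE bhomB cc subr0.
by rewrite -[embed M (f x)]/(bcomp (embed M) f x) hE.
Qed.

Lemma restr_ontoS n : restr_onto n -> restr_onto n.+1.
Proof.
move=> onto M phi hphi.
have [|g gE] := @coind_acyclic _ _ M n (bhom_comp (embed M) phi).
  by rewrite hd_comp hphi (lin0 (@bhom_comp_lin _ _ _ _ _ _)).
have gQ : hd (bhom_comp (coker_map M) g) = 0.
  rewrite hd_comp -gE; apply/mlinP => a; rewrite !bhom_compE; exact: coker_map_embed.
have [h ch hE] := onto _ _ gQ.
have [h' h'E] := res_projective h (@coker_map_surjective _ _ M).
have [|w wE] := @coker_coboundary M n (restr h' - g).
  move: hE; congr (is_coboundary _); apply/mlinP => a.
  rewrite -[LHS]/(h (theta n a) - coker_map M (g a)) -h'E -(linB (bhom_lin (coker_map M))).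
  by [].
have [x|f fE] := @bhom_descent _ _ M _ (bcomp h' (d n)).
  by rewrite -[bcomp h' _ _]/(h' (d n x)) h'E ch.
exists f => [y|].
  rewrite -[f _]embed_eval fE -[bcomp h' _ _]/(h' (d n (d n.+1 y))).
  by rewrite res_dd (lin0 (bhom_lin h')).
apply/is_coboundary_hd; exists w; apply: (@embed_inj _ _ M).
rewrite -wE (linB (@hd_lin _ _ _ _)) -gE hd_restr (linB (@bhom_comp_lin _ _ _ _ _ _)).
by congr (_ - _); apply/mlinP => a; apply: fE.
Qed.

Lemma restr_iso n : restr_onto n /\ restr_into n.
Proof.
elim: n => [|n [onto into]]; first by split; [exact: restr_onto0 | exact: restr_into0].
by split; [exact: restr_ontoS | exact: restr_intoS].
Qed.

(** The isomorphism induced on cohomology. *)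
Section ComparisonIso.
Variable M : bimodule A.
Local Notation E n := (Ext P M n).
Local Notation H n := (HH M n).

(** The class of a cochain in Hochschild cohomology, resp. in Ext. *)
Definition hhcls n (f : mlin A M n) : H n :=
  @sqcls k _ (cocycles M n) (coboundaries M n) f.
Definition extcls n (f : bhom (P n) M) : E n :=
  @sqcls k _ (ext_cocycles P M n) (ext_coboundaries P M n) f.

Lemma extcls_surj n (x : E n) : exists f, is_ext_cocycle f /\ extcls f = x.
Proof. exact: (@sqcls_surj _ _ (ext_cocycles P M n) (ext_coboundaries P M n) x). Qed.

(** A chosen cocycle in a class of Ext. *)
Definition ext_rep n (x : E n) : bhom (P n) M := sval (cid (extcls_surj x)).
Lemma ext_repP n (x : E n) : is_ext_cocycle (ext_rep x) /\ extcls (ext_rep x) = x.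
Proof. by rewrite /ext_rep; case: cid. Qed.

Definition comparison_fun n (x : E n) : H n := hhcls (restr (ext_rep x)).

Lemma comparison_cls n (f : bhom (P n) M) : is_ext_cocycle f ->
  comparison_fun (extcls f) = hhcls (restr f).
Proof.
move=> cf; have [cr rE] := ext_repP (extcls f).
apply/(@sqcls_eq _ _ (cocycles M n) (coboundaries M n)).
- by apply/is_cocycle_hd/restr_cocycle.
- by apply/is_cocycle_hd/restr_cocycle.
rewrite -[coboundaries M n _]/(is_coboundary _) -(linB (@restr_lin _ _)).
apply: restr_coboundary.
exact: (proj1 (@sqcls_eq _ _ (ext_cocycles P M n) (ext_coboundaries P M n) _ _ cr cf) rE).
Qed.

Lemma comparison_linear n : linear (@comparison_fun n).
Proof.
move=> c x y; have [cx <-] := ext_repP x; have [cy <-] := ext_repP y.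
rewrite -(@sqcls_lin _ _ (ext_cocycles P M n)) // !comparison_cls //.
  by rewrite restr_lin /hhcls (@sqcls_lin _ _ (cocycles M n)) //; apply/is_cocycle_hd/restr_cocycle.
exact: is_ext_cocycle_lin.
Qed.

(** The class of [f] is sent to the class of [restr f]. *)
Definition comparison n : homk (E n) (H n) := Homk (@comparison_linear n).

Lemma comparison_induced n (f : bhom (P n) M) (x : E n) :
  Ext_class f x -> HH_class (bhom_comp f (theta n)) (comparison n x).
Proof.
move=> /representsP[cf <-]; apply/representsP; split.
  exact/is_cocycle_hd/restr_cocycle.
exact/esym/comparison_cls.
Qed.

Lemma comparison_bijective n : bijective (comparison n).
Proof.
have [onto into] := restr_iso n.
have inj x y : comparison n x = comparison n y -> x = y.
  have [cx <-] := ext_repP x; have [cy <-] := ext_repP y.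
  rewrite -[comparison n _]/(comparison_fun _) -[in RHS]/(comparison_fun _).
  rewrite -[comparison n _]/(comparison_fun _) !comparison_cls // => xy.
  apply/(@sqcls_eq _ _ (ext_cocycles P M n) (ext_coboundaries P M n)) => //.
  apply: into; first by move=> z; rewrite bhomB cx cy subrr.
  rewrite (linB (@restr_lin _ _)).
  apply/(@sqcls_eq _ _ (cocycles M n) (coboundaries M n)) => //;
    exact/is_cocycle_hd/restr_cocycle.
have surj y : exists x, comparison n x = y.
  have [phi [cphi <-]] := @sqcls_surj _ _ (cocycles M n) (coboundaries M n) y.
  have [f cf fE] := onto _ _ (proj1 (is_cocycle_hd phi) cphi).
  exists (extcls f); rewrite -[comparison n _]/(comparison_fun _) comparison_cls //.
  apply/(@sqcls_eq _ _ (cocycles M n) (coboundaries M n)) => //;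
    exact/is_cocycle_hd/restr_cocycle.
exists (fun y => sval (cid (surj y))) => [x|y]; last exact: (svalP (cid (surj y))).
by apply: inj; apply: (svalP (cid (surj _))).
Qed.

End ComparisonIso.

End Resolution.

(** * Transport of a Batalin-Vilkovisky structure *)

Section Transport.
Variables (k : comPzRingType) (V W : nat -> lmodType k) (X : bv_ops W).
Variables (f : forall n, homk (V n) (W n)) (g : forall n, W n -> V n).
Hypotheses (fK : forall n, cancel (f n) (@g n)) (gK : forall n, cancel (@g n) (f n)).
Hypothesis bvX : is_bv X.

(** The operations carried over from [W] along the bijections [f]. *)
Definition transport_ops : bv_ops V := {|
  gcup := fun p q n a b => g (gcup X n (f p a) (f q b));
  gone := g (gone X);
  gbr := fun p q n a b => g (gbr X n (f p a) (f q b));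
  gB := fun m n a => g (gB X n (f m a))
|}.

Lemma transport_morphism_ops : is_bv_morphism transport_ops X f.
Proof. by split=> *; rewrite /= gK. Qed.

Lemma transport_bv : is_bv transport_ops.
Proof.
have lf n : linear (f n) := @homk_linear _ _ _ (f n).
have inj n : injective (f n) := can_inj (@fK n).
have f0 n := lin0 (lf n); have fD n := linD (lf n); have fZ n := linZ (lf n).
have fN n := linN (lf n); have fB n := linB (lf n).
have [[cX lX dX] Bdeg Blin BB brB] := bvX.
split.
- split.
  + split.
    * by move=> p q n a b pq; apply: inj; rewrite /= gK f0 (gcup_deg cX).
    * by move=> p q n b c a a'; apply: inj; rewrite /= [RHS]lf 3!gK lf; apply: (gcup_linl cX).
    * by move=> p q n a c b b'; apply: inj; rewrite /= [RHS]lf 3!gK lf; apply: (gcup_linr cX).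
    * by move=> p q r a b c; apply: inj; rewrite /= !gK (gcupA cX).
    * by move=> p a; apply: inj; rewrite /= !gK (gcup1l cX).
    * by move=> p a; apply: inj; rewrite /= !gK (gcup1r cX).
    by move=> p q a b; apply: inj; rewrite /= fZ !gK (gcupC cX).
  + split.
    * by move=> p q n a b pq; apply: inj; rewrite /= gK f0 (gbr_deg lX).
    * by move=> p q n b c a a'; apply: inj; rewrite /= [RHS]lf 3!gK lf; apply: (gbr_linl lX).
    * by move=> p q n a c b b'; apply: inj; rewrite /= [RHS]lf 3!gK lf; apply: (gbr_linr lX).
    * by move=> p q n a b pq; apply: inj; rewrite /= fN fZ !gK (gbrC lX).
    by move=> p q r n a b c pqr; apply: inj; rewrite /= fD fZ !gK (gbr_jacobi lX).
  by move=> p q r n c a b pqr; apply: inj; rewrite /= fD fZ !gK dX.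
- by move=> m n a mn; apply: inj; rewrite /= gK f0 Bdeg.
- by move=> m n c a a'; apply: inj; rewrite /= [RHS]lf 3!gK lf; apply: Blin.
- by move=> l m n a; apply: inj; rewrite /= !gK f0 BB.
by move=> p q n a b pq; apply: inj; rewrite /= fZ !fB fZ !gK brB.
Qed.

End Transport.

Theorem theorem1p3 (k : comPzRingType) (A : algType k) (gamma : homk (homk A A) A) :
  is_contraaction gamma ->
  [/\ is_para_cocyclic (@coface k (endo_operad A)) (@codegen k (endo_operad A))
         (tau gamma),
      is_para_cyclic_mult_operad (O := endo_operad A) (tau gamma)
    & is_stable gamma ->
      [/\ is_cocyclic (@coface k (endo_operad A)) (@codegen k (endo_operad A))
             (tau gamma),
          is_cyclic_mult_operad (O := endo_operad A) (tau gamma)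
        & exists X : bv_ops (HH (regular A)),
          [/\ is_induced gamma X,
              is_bv X
            & projective_module A ->
              forall P : resolution A,
              exists (Y : bv_ops (Ext P (regular A)))
                     (theta : forall n, mlin A (P n) n)
                     (Phi : forall n, homk (Ext P (regular A) n) (HH (regular A) n)),
                is_bv Y /\ is_ext_transport X Y theta Phi]]].
Proof.
move=> cA; split; [exact: endo_para_cocyclic | exact: endo_para_cyclic_mult |].
move=> sA; split; [exact: endo_cocyclic | exact: endo_cyclic_mult |].
exists (hochschild_ops gamma); split.
- exact: hochschild_induced.
- exact: hochschild_bv.
move=> pA P; have [theta theta_comp] := comparison_exists P pA.
have bij n : exists g, cancel (comparison theta_comp (regular A) n) g
    /\ cancel g (comparison theta_comp (regular A) n).
  by have [g gK Kg] := comparison_bijective pA theta_comp (regular A) n; exists g.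
pose g n := sval (boolp.cid (bij n)).
have gK n := proj1 (svalP (boolp.cid (bij n))).
have Kg n := proj2 (svalP (boolp.cid (bij n))).
exists (transport_ops (hochschild_ops gamma) (comparison theta_comp (regular A)) g), theta.
exists (comparison theta_comp (regular A)); split.
  exact: transport_bv gK Kg (hochschild_bv cA sA).
split.
- exact: theta_comp.
- exact: comparison_induced.
- by move=> n; exists (g n); [exact: gK | exact: Kg].
exact: transport_morphism_ops Kg.
Qed.
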